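(* Let $\lambda=0$. Suppose that $n$ and $m$ are integers with $1\le n\le q$ and $0\le m<n$ such that $F_i(x,y)\equiv0$ and $G_i(x,y)\equiv 0$ for all $i<n$, and such that $G_{n+m}(0,0)\ne0$ and $G_{n+l}(0,0)=0$ for all $0\le l<m$. Suppose $G_{n+m}(0,0)>0$ and put $\mu=\sqrt{G_{n+m}(0,0)/w(0)}$ and $$\alpha_{n,m}=\partial_xF_n(0,0)+\partial_yG_n(0,0)+\delta_{n,q}\frac{5(q+m)}{4q}.$$ Let $x_\ast(t),y_\ast(t)$ be the solution of the perturbed system $$\frac{dx}{dt}=\partial_y H(x,y;\lambda)+F(x,y,t),\qquad \frac{dy}{dt}=-\partial_x H(x,y;\lambda)+G(x,y,t)$$ with asymptotics $$x_\ast(t)=\sum_{k=n+m}^{\infty}t^{-\frac{k}{2q}}x_k,\qquad y_\ast(t)=\sum_{k=2n}^{\infty}t^{-\frac{k}{2q}}y_k,\qquad t\to\infty,$$ where $x_k,y_k$ are real constants and $x_{n+m}=\mu$. Then: (i) if $\alpha_{n,m}<0$, the solution $x_\ast(t),y_\ast(t)$ is stable; (ii) if $\alpha_{n,m}>\delta_{n,q}\,\frac{3(q+m)}{2q}$, the solution $x_\ast(t),y_\ast(t)$ is unstable.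
   Context: Standing setting. The functions $H(x,y;\lambda)$, $F(x,y,t)$, $G(x,y,t)$ are smooth for all $(x,y)\in\mathbb R^2$, $t>0$, $\lambda\in\mathbb R$. The Hamiltonian of the limiting system is $H(x,y;\lambda)=\frac{y^2}{2}+V(x;\lambda)$ with $\partial_xV(x;\lambda)=(x^2-\lambda)w(x)$, where, for some $d_0>0$, $w(x)>0$ for all $(x,\lambda)\in\{|x|<\sqrt\lambda+d_0,\ \lambda\ge 0\}\cup\{|x|<d_0,\ \lambda<0\}$. The perturbations satisfy $F(x,y,t)\to0$ and $G(x,y,t)\to0$ as $t\to\infty$ for $(x,y)$ in any compact subset of $\mathbb R^2$, and have power-law asymptotics $$F(x,y,t)=\sum_{k=1}^\infty t^{-\frac kq}F_k(x,y),\qquad G(x,y,t)=\sum_{k=1}^\infty t^{-\frac kq}G_k(x,y),\qquad t\to\infty,$$ where $q$ is a positive integer and $F_k,G_k$ are smooth functions on $\mathbb R^2$. Infinite series followed by ''$t\to\infty$'' are understood as asymptotic expansions. The coefficients $x_k,y_k$ of the solution's expansion are those obtained by substituting the series into the system and equating the coefficients of equal powers of $t$. $\delta_{n,q}$ is the Kronecker delta. Stability and instability of a solution are understood in the sense of Lyapunov, as $t\to\infty$.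
   Formalization: The asymptotic expansions of F and G, uniform on compact sets of (x,y), are also assumed to be differentiable once term by term in x and in y; without this, exponentially small but rapidly oscillating perturbations make the claim false. *)

(* Defs.v *)
(* Stdlib reals with Coquelicot. *)
From Stdlib Require Import Reals.
From Coquelicot Require Import Coquelicot.
Open Scope R_scope.

Definition d1_2 (f : R -> R -> R) : R -> R -> R :=
  fun x y => Derive (fun s => f s y) x.
Definition d2_2 (f : R -> R -> R) : R -> R -> R :=
  fun x y => Derive (fun s => f x s) y.

Definition d1_3 (f : R -> R -> R -> R) : R -> R -> R -> R :=
  fun x y z => Derive (fun s => f s y z) x.
Definition d2_3 (f : R -> R -> R -> R) : R -> R -> R -> R :=
  fun x y z => Derive (fun s => f x s z) y.
Definition d3_3 (f : R -> R -> R -> R) : R -> R -> R -> R :=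
  fun x y z => Derive (fun s => f x y s) z.

(* Three-variable analogue of Coquelicot's [ex_diff_n]: the partial derivatives
   of order at most n exist and are continuous at (x, y, z). *)
Fixpoint ex_diff_n_3 (f : R -> R -> R -> R) (n : nat) (x y z : R) : Prop :=
  continuous (fun p : R * (R * R) => f (fst p) (fst (snd p)) (snd (snd p)))
             (x, (y, z)) /\
  match n with
  | O => True
  | S n' =>
      ex_derive (fun s => f s y z) x /\
      ex_derive (fun s => f x s z) y /\
      ex_derive (fun s => f x y s) z /\
      ex_diff_n_3 (d1_3 f) n' x y z /\
      ex_diff_n_3 (d2_3 f) n' x y z /\
      ex_diff_n_3 (d3_3 f) n' x y z
  end.

Definition smooth_2 (f : R -> R -> R) : Prop :=
  forall (n : nat) (x y : R), ex_diff_n f n x y.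

(* The set U is always open below. *)
Definition smooth_3_on (U : R -> R -> R -> Prop) (f : R -> R -> R -> R) : Prop :=
  forall (n : nat) (x y z : R), U x y z -> ex_diff_n_3 f n x y z.

Definition limiting_hamiltonian (H : R -> R -> R -> R) (w : R -> R) : Prop :=
  smooth_3_on (fun _ _ _ => True) H /\
  exists V : R -> R -> R,
    (forall x y lam, H x y lam = y ^ 2 / 2 + V x lam) /\
    (forall x lam, is_derive (fun s => V s lam) x ((x ^ 2 - lam) * w x)) /\
    (exists d0 : R, 0 < d0 /\
       forall x lam,
         (0 <= lam /\ Rabs x < sqrt lam + d0) \/ (lam < 0 /\ Rabs x < d0) ->
         0 < w x).

(* f(x, y, t) -> 0 as t -> oo, uniformly on compact subsets of the (x, y)-plane;
   the squares |x|, |y| <= M suffice since they exhaust the plane. *)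
Definition vanishes_loc_unif (f : R -> R -> R -> R) : Prop :=
  forall M eps : R, 0 < eps ->
  exists T : R, forall x y t : R,
    Rabs x <= M -> Rabs y <= M -> T < t -> Rabs (f x y t) < eps.

(* The Poincare expansion f ~ sum_(k >= 1) t^(-k/q) f_k, locally uniformly in
   (x, y): the remainder of order N is o(t^(-N/q)).  [sum_n_m a 1 0] is 0. *)
Definition power_expansion (q : nat) (f : R -> R -> R -> R)
    (fk : nat -> R -> R -> R) : Prop :=
  forall N : nat,
    vanishes_loc_unif (fun x y t =>
      Rpower t (INR N / INR q) *
      (f x y t
       - sum_n_m (fun k => Rpower t (- (INR k / INR q)) * fk k x y) 1 N)).

(* The expansion of a perturbation may be differentiated once, term by term, in
   x and in y.  This cannot be dropped: a term of size exp(-t) oscillating in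
   (x, y) on the scale exp(-2t) is invisible to [power_expansion] alone, but its
   Jacobian can make any given solution Lyapunov stable. *)
Definition perturbation (q : nat) (f : R -> R -> R -> R)
    (fk : nat -> R -> R -> R) : Prop :=
  smooth_3_on (fun _ _ t => 0 < t) f /\
  (forall k : nat, (1 <= k)%nat -> smooth_2 (fk k)) /\
  vanishes_loc_unif f /\
  power_expansion q f fk /\
  power_expansion q (d1_3 f) (fun k => d1_2 (fk k)) /\
  power_expansion q (d2_3 f) (fun k => d2_2 (fk k)).

(* The Poincare expansion u(t) ~ sum_(k >= k0) t^(-k/p) a_k; the partial sum
   is 0 for N < k0. *)
Definition asymptotic_series (p k0 : nat) (u : R -> R) (a : nat -> R) : Prop :=
  forall N : nat,
    is_lim (fun t =>
      Rpower t (INR N / INR p) *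
      (u t - sum_n_m (fun k => Rpower t (- (INR k / INR p)) * a k) k0 N))
      p_infty 0.

Definition solution_after (H F G : R -> R -> R -> R) (lam T : R)
    (x y : R -> R) : Prop :=
  forall t : R, T < t ->
    is_derive x t (d2_3 H (x t) (y t) lam + F (x t) (y t) t) /\
    is_derive y t (- d1_3 H (x t) (y t) lam + G (x t) (y t) t).

(* Solution on [t0, oo) of the initial value problem; values of x and y before
   t0 are irrelevant. *)
Definition solution_from (H F G : R -> R -> R -> R) (lam t0 x0 y0 : R)
    (x y : R -> R) : Prop :=
  x t0 = x0 /\ y t0 = y0 /\
  filterlim x (at_right t0) (locally x0) /\
  filterlim y (at_right t0) (locally y0) /\
  solution_after H F G lam t0 x y.

Definition dist2 (x y x' y' : R) : R := sqrt ((x - x') ^ 2 + (y - y') ^ 2).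

(* Lyapunov stability of a solution (xs, ys) living on (T, oo): solutions
   starting close to it at time t0 exist on [t0, oo) and remain close.  The
   vector field is smooth, so solutions of the initial value problem are unique
   and one that stays near (xs, ys) extends to [t0, oo); hence the negation says
   that solutions starting arbitrarily close get at distance eps. *)
Definition lyapunov_stable (H F G : R -> R -> R -> R) (lam T : R)
    (xs ys : R -> R) : Prop :=
  forall t0 eps : R, T < t0 -> 0 < eps ->
  exists delta : R, 0 < delta /\
    forall x0 y0 : R, dist2 x0 y0 (xs t0) (ys t0) < delta ->
      (exists x y : R -> R, solution_from H F G lam t0 x0 y0 x y) /\
      (forall x y : R -> R, solution_from H F G lam t0 x0 y0 x y ->
         forall t : R, t0 <= t -> dist2 (x t) (y t) (xs t) (ys t) < eps).

Definition lyapunov_unstable (H F G : R -> R -> R -> R) (lam T : R)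
    (xs ys : R -> R) : Prop :=
  ~ lyapunov_stable H F G lam T xs ys.

Definition kronecker (i j : nat) : R := if Nat.eqb i j then 1 else 0.

Definition alpha (q n m : nat) (Fk Gk : nat -> R -> R -> R) : R :=
  d1_2 (Fk n) 0 0 + d2_2 (Gk n) 0 0
  + kronecker n q * (5 * (INR q + INR m) / (4 * INR q)).

(* Main.v *)
Require Import Defs.
From Stdlib Require Import Reals Lra Lia Psatz List Arith FinFun.
From Stdlib Require Import Classical ClassicalEpsilon.
From Coquelicot Require Import Coquelicot.
Open Scope R_scope.

(** The solution [(xs, ys)] follows, at distance of order [t ^ - kap] from the
    origin with [kap = (n + m) / (2 q)], the minimum of the slowly varying potential
    well [w(0) (x^3 / 3 - mu^2 t^(- 2 kap) x)]; the perturbation also acts as a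
    friction of order [t ^ (- n / q)]. The two statements have different reasons.

    Stability. For a deviation [(u, v)] the energy
    [v^2 / 2 + V (X + u) - V X - V' X u], where [X] is a partial sum [xs_sum] of the
    expansion of [xs], changes on average over the oscillations at the rate
    [(a0 + d0) t ^ (- n / q) - kap / (2 t)]: [a0 + d0] is the divergence of the
    leading coefficients at the origin, and the second term, which matters only for
    [n = q], is the effect of the flattening of the well on an oscillator. The
    energy has to be compared with the depth of the well, of order
    [t ^ (- 3 kap)], for otherwise the deviation escapes over the saddle. This adds
    [3 kap / t], and the resulting rate is [alpha t ^ (- n / q)]. Two corrections
    turn the average into an inequality valid at every time:
    [- stiffness u^2 / 2] absorbs the part of the perturbing force that is
    proportional to [u], and [e0 t ^ (- n / q) u v] balances kinetic and potential
    energy. All coefficients of the derivative of the corrected energy have limits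
    as [t] grows and the deviation becomes small in the units of the well ([dissipation_form]), so that
    for [alpha < 0] small deviations remain trapped ([solution_attracting]).
    Trapping for late times gives Lyapunov stability
    ([stable_of_attracting_tube]); nearby solutions exist because they solve a
    globally Lipschitz system ([picard_lindelof]).

    Instability. The condition on [alpha] says that the divergence [a0 + d0] is
    positive: for [n < q] it is [alpha], and for [n = q] it exceeds [kap / 2]. By
    Liouville's theorem areas then grow without bound, since [n <= q] makes the
    integral of [t ^ (- n / q)] diverge. A stable solution has a neighbourhood
    whose images stay in a bounded set, which is impossible. The argument is
    carried out for finitely many solutions: the area of a small triangle of
    solutions grows with the divergence up to terms of third order
    ([small_triangles_expand]), solutions that are close at a late time were
    close before ([trajectories_were_close]), and therefore a small box contains
    at a late time only few of the solutions that start in a fine lattice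
    ([lattice_pigeonhole], [trajectories_leave]). *)

(** * Calculus on the line and on boxes *)

Lemma ball_Rabs (x e y : R) : ball x e y <-> Rabs (y - x) < e.
Proof. reflexivity. Qed.

Lemma is_derive_continuous (f : R -> R) (x l : R) : is_derive f x l -> continuous f x.
Proof.
  intros Hf; apply (ex_derive_continuous (V := R_NormedModule)); exists l; exact Hf.
Qed.

Lemma is_derive_Rplus (f g : R -> R) (x lf lg : R) :
  is_derive f x lf -> is_derive g x lg -> is_derive (fun s => f s + g s) x (lf + lg).
Proof. intros Hf Hg; exact (is_derive_plus (V := R_NormedModule) f g x lf lg Hf Hg). Qed.

Lemma is_derive_Rminus (f g : R -> R) (x lf lg : R) :
  is_derive f x lf -> is_derive g x lg -> is_derive (fun s => f s - g s) x (lf - lg).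
Proof. intros Hf Hg; exact (is_derive_minus (V := R_NormedModule) f g x lf lg Hf Hg). Qed.

Lemma is_derive_Rmult (f g : R -> R) (x lf lg : R) :
  is_derive f x lf -> is_derive g x lg ->
  is_derive (fun s => f s * g s) x (lf * g x + f x * lg).
Proof. intros Hf Hg; exact (is_derive_mult f g x lf lg Hf Hg Rmult_comm). Qed.

Section RealLimits.
Context {T : Type} {U : (T -> Prop) -> Prop} {FU : Filter U}.

Lemma filterlim_Rplus (f g : T -> R) (a b : R) :
  filterlim f U (locally a) -> filterlim g U (locally b) ->
  filterlim (fun s => f s + g s) U (locally (a + b)).
Proof.
  intros Hf Hg; eapply filterlim_comp_2;
  [exact Hf | exact Hg | apply (filterlim_plus (V := R_NormedModule) a b)].
Qed.

Lemma filterlim_Ropp (f : T -> R) (a : R) :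
  filterlim f U (locally a) -> filterlim (fun s => - f s) U (locally (- a)).
Proof.
  intros Hf; eapply filterlim_comp; [exact Hf | apply (filterlim_opp (V := R_NormedModule) a)].
Qed.

Lemma filterlim_Rminus (f g : T -> R) (a b : R) :
  filterlim f U (locally a) -> filterlim g U (locally b) ->
  filterlim (fun s => f s - g s) U (locally (a - b)).
Proof.
  intros Hf Hg; apply (filterlim_Rplus f (fun s => - g s)); [|apply filterlim_Ropp]; assumption.
Qed.

Lemma filterlim_Rmult (f g : T -> R) (a b : R) :
  filterlim f U (locally a) -> filterlim g U (locally b) ->
  filterlim (fun s => f s * g s) U (locally (a * b)).
Proof.
  intros Hf Hg; eapply filterlim_comp_2;
  [exact Hf | exact Hg | apply (filterlim_mult (K := R_AbsRing) a b)].
Qed.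

End RealLimits.

Lemma right_limit_of_continuous (f : R -> R) (t : R) :
  continuous f t -> filterlim f (at_right t) (locally (f t)).
Proof.
  intros Hf; eapply filterlim_filter_le_1; [|exact Hf].
  intros P HP; unfold at_right, within.
  eapply filter_imp; [|exact HP]; auto.
Qed.

Lemma nondecreasing_from_right (f df : R -> R) (a b : R) :
  a <= b ->
  (forall t, a < t <= b -> is_derive f t (df t)) ->
  (forall t, a < t <= b -> 0 <= df t) ->
  filterlim f (at_right a) (locally (f a)) ->
  f a <= f b.
Proof.
  intros Hab Hd Hpos Hlim.
  destruct (Rle_lt_or_eq_dec a b Hab) as [Hlt | ->]; [|lra].
  assert (Hmono : forall s, a < s <= b -> f s <= f b).
  { intros s Hs.
    destruct (MVT_gen f s b df) as (c & Hc & Heq).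
    - intros x; rewrite Rmin_left, Rmax_right by lra; intros Hx; apply Hd; lra.
    - intros x; rewrite Rmin_left, Rmax_right by lra; intros Hx.
      apply continuity_pt_filterlim, (ex_derive_continuous (V := R_NormedModule)).
      eexists; apply Hd; lra.
    - rewrite Rmin_left, Rmax_right in Hc by lra.
      assert (0 <= df c) by (apply Hpos; lra).
      assert (0 <= df c * (b - s)) by (apply Rmult_le_pos; lra). lra. }
  refine (filterlim_le (F := at_right a) f (fun _ => f b) (f a) (f b) _ Hlim _).
  - unfold at_right, within, locally.
    assert (He : 0 < b - a) by lra.
    exists (mkposreal _ He); intros y Hy Hya.
    apply Hmono. apply -> ball_Rabs in Hy; cbn in Hy.
    apply Rabs_def2 in Hy; lra.
  - apply filterlim_const.
Qed.

Lemma mvt_between (f df : R -> R) (a b : R) :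
  (forall x, is_derive f x (df x)) ->
  exists c, Rmin a b <= c <= Rmax a b /\ f b - f a = df c * (b - a).
Proof.
  intros Hd; apply MVT_gen.
  - auto.
  - intros x _; apply continuity_pt_filterlim, (ex_derive_continuous (V := R_NormedModule)).
    eexists; apply Hd.
Qed.

Lemma Rabs_between (a b c M : R) :
  Rmin a b <= c <= Rmax a b -> Rabs a <= M -> Rabs b <= M -> Rabs c <= M.
Proof.
  unfold Rmin, Rmax; destruct (Rle_dec a b); intros Hc Ha Hb;
  apply Rabs_le; apply Rabs_le_between in Ha, Hb; lra.
Qed.

Lemma Rabs_between_sub (a b c : R) :
  Rmin a b <= c <= Rmax a b -> Rabs (c - a) <= Rabs (b - a).
Proof.
  unfold Rmin, Rmax; destruct (Rle_dec a b); intros Hc;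
  [rewrite !Rabs_pos_eq | rewrite !Rabs_left1]; lra.
Qed.

Definition uncurry3 (f : R -> R -> R -> R) (p : R * (R * R)) : R :=
  f (fst p) (fst (snd p)) (snd (snd p)).

(** Continuity is only available at the points of the box, so that the radii of
    the covering are chosen there and are arbitrary elsewhere. *)
Lemma continuous_bounded_box (f : R -> R -> R -> R) (a b c d e g : R) :
  (forall x y z, a <= x <= b -> c <= y <= d -> e <= z <= g ->
     continuous (uncurry3 f) (x, (y, z))) ->
  exists M, 0 < M /\ forall x y z, a <= x <= b -> c <= y <= d -> e <= z <= g ->
    Rabs (f x y z) <= M.
Proof.
  intros Hc.
  pose (lo := (a, (c, (e, tt))) : Compactness.Tn 3 R).
  pose (hi := (b, (d, (g, tt))) : Compactness.Tn 3 R).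
  assert (Hdelta : forall p : Compactness.Tn 3 R, exists dl : posreal,
    let '(x, (y, (z, _))) := p in
    bounded_n 3 lo hi p -> forall x' y' z',
      Rabs (x' - x) < dl -> Rabs (y' - y) < dl -> Rabs (z' - z) < dl ->
      Rabs (f x' y' z' - f x y z) < 1).
  { intros (x & y & z & []).
    destruct (classic (bounded_n 3 lo hi (x, (y, (z, tt))))) as [Hb | Hb].
    - assert (Hb' := Hb); cbn in Hb'.
      assert (Hxyz : continuous (uncurry3 f) (x, (y, z))) by (apply Hc; tauto).
      assert (HP := Hxyz (fun r => Rabs (r - f x y z) < 1)).
      destruct HP as [dl Hdl].
      { exists (mkposreal _ Rlt_0_1); intros r Hr; exact Hr. }
      exists dl; intros _ x' y' z' Hx Hy Hz.
      apply (Hdl (x', (y', z'))); repeat split; assumption.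
    - exists (mkposreal _ Rlt_0_1); intros Hb'; contradiction. }
  pose (delta := fun p => proj1_sig (constructive_indefinite_description _ (Hdelta p))).
  assert (Hl := compactness_list 3 lo hi delta).
  apply NNPP in Hl; destruct Hl as [l Hl].
  assert (Hmax : exists M, 0 < M /\ forall p, In p l ->
    let '(x, (y, (z, _))) := p in Rabs (f x y z) + 1 <= M).
  { clear Hl; induction l as [|(x & y & z & []) l IH].
    - exists 1; split; [lra | intros p []].
    - destruct IH as (M & HM & IH).
      exists (Rmax M (Rabs (f x y z) + 1)); split.
      + eapply Rlt_le_trans; [apply HM | apply Rmax_l].
      + intros p [<- | Hp].
        * apply Rmax_r.
        * specialize (IH p Hp); destruct p as (x' & y' & z' & ?).
          eapply Rle_trans; [apply IH | apply Rmax_l]. }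
  destruct Hmax as (M & HM & Hmax); exists M; split; [assumption|].
  intros x y z Hx Hy Hz.
  destruct (Hl (x, (y, (z, tt)))) as ((x' & y' & z' & []) & Hin & Hb & Hclose).
  { cbn; tauto. }
  specialize (Hmax _ Hin); cbn in Hmax.
  cbn in Hclose.
  assert (Hd := proj2_sig (constructive_indefinite_description _ (Hdelta (x', (y', (z', tt)))))).
  cbv beta iota zeta in Hd.
  specialize (Hd Hb x y z). fold (delta (x', (y', (z', tt)))) in Hd.
  assert (Hfx : Rabs (f x y z - f x' y' z') < 1) by (apply Hd; tauto).
  replace (f x y z) with ((f x y z - f x' y' z') + f x' y' z') by ring.
  eapply Rle_trans; [apply Rabs_triang|]. lra.
Qed.

(** This is the form in which smoothness of a vector field is used: it implies
    Lipschitz continuity, and it makes the area of a small triangle of solutions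
    follow the divergence. *)
Definition taylor_box (f f1 f2 : R -> R -> R -> R) : Prop :=
  forall M ta tb, 0 < ta -> exists C, 0 < C /\
  forall t x y x' y', ta <= t <= tb ->
    Rabs x <= M -> Rabs y <= M -> Rabs x' <= M -> Rabs y' <= M ->
    Rabs (f1 x y t) <= C /\ Rabs (f2 x y t) <= C /\
    Rabs (f x' y' t - f x y t - f1 x y t * (x' - x) - f2 x y t * (y' - y))
      <= C * (Rabs (x' - x) + Rabs (y' - y)) ^ 2.

Definition continuous_along_curves (f : R -> R -> R -> R) : Prop :=
  forall (x y z : R -> R) t, 0 < z t ->
    continuous x t -> continuous y t -> continuous z t ->
    continuous (fun s => f (x s) (y s) (z s)) t.

Lemma continuous_triple (x y z : R -> R) (t : R) :
  continuous x t -> continuous y t -> continuous z t ->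
  continuous (fun s => (x s, (y s, z s))) t.
Proof.
  intros Hx Hy Hz P [e HP].
  assert (Hx' := Hx (ball (x t) e) (locally_ball _ _)).
  assert (Hy' := Hy (ball (y t) e) (locally_ball _ _)).
  assert (Hz' := Hz (ball (z t) e) (locally_ball _ _)).
  unfold filtermap in *.
  generalize (filter_and _ _ Hx' (filter_and _ _ Hy' Hz')).
  apply filter_imp; intros s (H1 & H2 & H3).
  apply HP; repeat split; assumption.
Qed.

Lemma smooth_continuous_along_curves (f : R -> R -> R -> R) :
  smooth_3_on (fun _ _ t => 0 < t) f -> continuous_along_curves f.
Proof.
  intros Hf x y z t Ht Hx Hy Hz.
  apply (continuous_comp (fun s => (x s, (y s, z s))) (uncurry3 f)).
  - apply continuous_triple; assumption.
  - apply (Hf O (x t) (y t) (z t) Ht).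
Qed.

Lemma smooth_taylor_box (f : R -> R -> R -> R) :
  smooth_3_on (fun _ _ t => 0 < t) f -> taylor_box f (d1_3 f) (d2_3 f).
Proof.
  intros Hf M ta tb Hta.
  assert (Hbound : forall h, (forall x y z, 0 < z -> continuous (uncurry3 h) (x, (y, z))) ->
    exists B, 0 < B /\ forall x y t, ta <= t <= tb -> Rabs x <= M -> Rabs y <= M ->
      Rabs (h x y t) <= B).
  { intros h Hh.
    destruct (continuous_bounded_box h (-M) M (-M) M ta tb) as (B & HB & HB').
    - intros; apply Hh; lra.
    - exists B; split; [assumption|]; intros x y t Ht Hx Hy.
      apply HB'; try assumption; apply Rabs_le_between; assumption. }
  destruct (Hbound (d1_3 f)) as (B1 & HB1 & H1).
  { intros x y z Hz; apply (Hf 1%nat x y z Hz). }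
  destruct (Hbound (d2_3 f)) as (B2 & HB2 & H2).
  { intros x y z Hz; apply (Hf 1%nat x y z Hz). }
  destruct (Hbound (d1_3 (d1_3 f))) as (B11 & HB11 & H11).
  { intros x y z Hz; apply (Hf 2%nat x y z Hz). }
  destruct (Hbound (d2_3 (d1_3 f))) as (B21 & HB21 & H21).
  { intros x y z Hz; apply (Hf 2%nat x y z Hz). }
  destruct (Hbound (d2_3 (d2_3 f))) as (B22 & HB22 & H22).
  { intros x y z Hz; apply (Hf 2%nat x y z Hz). }
  exists (B1 + B2 + B11 + B21 + B22); split; [lra|].
  intros t x y x' y' Ht Hx Hy Hx' Hy'.
  assert (Ht0 : 0 < t) by lra.
  split; [|split].
  { specialize (H1 x y t Ht Hx Hy); lra. }
  { specialize (H2 x y t Ht Hx Hy); lra. }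
  destruct (mvt_between (fun s => f s y' t) (fun s => d1_3 f s y' t) x x') as (xi & Hxi & E1).
  { intros s; apply Derive_correct, (Hf 1%nat s y' t Ht0). }
  destruct (mvt_between (fun s => f x s t) (fun s => d2_3 f x s t) y y') as (et & Het & E2).
  { intros s; apply Derive_correct, (Hf 1%nat x s t Ht0). }
  destruct (mvt_between (fun s => d1_3 f s y' t) (fun s => d1_3 (d1_3 f) s y' t) x xi)
    as (z1 & Hz1 & E3).
  { intros s; apply Derive_correct, (Hf 2%nat s y' t Ht0). }
  destruct (mvt_between (fun s => d1_3 f x s t) (fun s => d2_3 (d1_3 f) x s t) y y')
    as (z2 & Hz2 & E4).
  { intros s; apply Derive_correct, (Hf 2%nat x s t Ht0). }
  destruct (mvt_between (fun s => d2_3 f x s t) (fun s => d2_3 (d2_3 f) x s t) y et)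
    as (z3 & Hz3 & E5).
  { intros s; apply Derive_correct, (Hf 2%nat x s t Ht0). }
  assert (Mxi : Rabs xi <= M) by (eapply Rabs_between; eassumption).
  assert (Met : Rabs et <= M) by (eapply Rabs_between; eassumption).
  specialize (H11 z1 y' t Ht (Rabs_between _ _ _ _ Hz1 Hx Mxi) Hy').
  specialize (H21 x z2 t Ht Hx (Rabs_between _ _ _ _ Hz2 Hy Hy')).
  specialize (H22 x z3 t Ht Hx (Rabs_between _ _ _ _ Hz3 Hy Met)).
  apply Rabs_between_sub in Hxi, Het.
  replace (f x' y' t - f x y t - d1_3 f x y t * (x' - x) - d2_3 f x y t * (y' - y))
    with (d1_3 (d1_3 f) z1 y' t * (xi - x) * (x' - x)
          + d2_3 (d1_3 f) x z2 t * (y' - y) * (x' - x)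
          + d2_3 (d2_3 f) x z3 t * (et - y) * (y' - y)).
  2:{ rewrite <- E3, <- E4, <- E5.
      replace (f x' y' t - f x y t) with ((f x' y' t - f x y' t) + (f x y' t - f x y t)) by ring.
      rewrite E1, E2; ring. }
  set (p := Rabs (x' - x)) in *; set (r := Rabs (y' - y)) in *.
  assert (0 <= p) by apply Rabs_pos. assert (0 <= r) by apply Rabs_pos.
  assert (K : forall A B u v w z, Rabs A <= B -> Rabs u <= w -> Rabs v <= z ->
     Rabs (A * u * v) <= B * (w * z)).
  { intros A B u v w' z HA Hu Hv; rewrite !Rabs_mult, Rmult_assoc.
    apply Rmult_le_compat; try apply Rabs_pos; [|assumption|].
    - apply Rmult_le_pos; apply Rabs_pos.
    - apply Rmult_le_compat; try apply Rabs_pos; assumption. }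
  assert (K1 := K _ _ _ _ _ _ H11 Hxi (Rle_refl p)).
  assert (K2 := K _ _ _ _ _ _ H21 (Rle_refl r) (Rle_refl p)).
  assert (K3 := K _ _ _ _ _ _ H22 Het (Rle_refl r)).
  eapply Rle_trans; [apply Rabs_triang|].
  eapply Rle_trans; [apply Rplus_le_compat_r, Rabs_triang|].
  assert (0 <= p * r) by (apply Rmult_le_pos; assumption).
  assert (0 <= p * p) by (apply Rmult_le_pos; assumption).
  assert (0 <= r * r) by (apply Rmult_le_pos; assumption).
  assert (B11 * (p * p) <= B11 * (p + r) ^ 2) by (apply Rmult_le_compat_l; nra).
  assert (B21 * (r * p) <= B21 * (p + r) ^ 2) by (apply Rmult_le_compat_l; nra).
  assert (B22 * (r * r) <= B22 * (p + r) ^ 2) by (apply Rmult_le_compat_l; nra).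
  assert (0 <= (B1 + B2) * (p + r) ^ 2) by (apply Rmult_le_pos; [lra | apply pow2_ge_0]).
  fold r p in K1, K2, K3.
  lra.
Qed.

Lemma continuous_bounded_interval (h : R -> R) (a b : R) :
  (forall t, a <= t <= b -> continuous h t) ->
  exists M, 0 < M /\ forall t, a <= t <= b -> Rabs (h t) <= M.
Proof.
  intros Hh.
  destruct (continuous_bounded_box (fun _ _ t => h t) 0 0 0 0 a b) as (M & HM & HM').
  - intros x y z _ _ Hz.
    apply (continuous_comp (fun p : R * (R * R) => snd (snd p)) h); [|apply Hh, Hz].
    apply (continuous_comp snd snd); apply continuous_snd.
  - exists M; split; [assumption|]; intros t Ht; apply (HM' 0 0 t); lra.
Qed.

(** The derivative of the squared norm is bounded by [4 * L] times the squared norm;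
    the sign [e] selects the direction of time. *)
Lemma gronwall_squares (a b da db : R -> R) (L t T : R) :
  t <= T ->
  (forall s, t < s <= T -> is_derive a s (da s) /\ is_derive b s (db s)) ->
  (forall s, t < s <= T -> Rabs (da s) <= L * (Rabs (a s) + Rabs (b s)) /\
     Rabs (db s) <= L * (Rabs (a s) + Rabs (b s))) ->
  0 <= L ->
  filterlim a (at_right t) (locally (a t)) -> filterlim b (at_right t) (locally (b t)) ->
  a T * a T + b T * b T <= (a t * a t + b t * b t) * exp (4 * L * (T - t)) /\
  a t * a t + b t * b t <= (a T * a T + b T * b T) * exp (4 * L * (T - t)).
Proof.
  intros HtT Hd Hle HL La Lb.
  pose (N := fun s => a s * a s + b s * b s).
  assert (Hgen : forall e, e * e = 1 -> e * N t <= e * N T * exp (e * (4 * L) * (T - t))).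
  { intros e He.
    pose (w := fun s => exp (e * (4 * L) * (s - t))).
    assert (Hw : forall s, is_derive w s (e * (4 * L) * w s)).
    { intros s; unfold w; auto_derive; [trivial | unfold Rminus; ring]. }
    assert (Hw0 : w t = 1) by (unfold w; rewrite Rminus_diag, Rmult_0_r; apply exp_0).
    change (e * N t <= e * N T * w T); rewrite <- (Rmult_1_r (e * N t)), <- Hw0.
    apply (nondecreasing_from_right (fun s => e * N s * w s)
      (fun s => (e * (2 * (a s * da s + b s * db s)) + 4 * L * N s) * w s)); [assumption | | |].
    - intros s Hs; destruct (Hd s Hs) as [Da Db].
      replace ((e * (2 * (a s * da s + b s * db s)) + 4 * L * N s) * w s)
        with (e * ((da s * a s + a s * da s) + (db s * b s + b s * db s)) * w s
          + e * N s * (e * (4 * L) * w s)).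
      2:{ transitivity ((e * (2 * (a s * da s + b s * db s)) + e * e * (4 * L * N s)) * w s);
          [ring | rewrite He; ring]. }
      apply (is_derive_Rmult (fun s => e * N s) w); [|apply Hw].
      apply (is_derive_scal N s e).
      apply is_derive_Rplus; apply is_derive_Rmult; assumption.
    - intros s Hs; destruct (Hle s Hs) as [Ha Hb].
      apply Rmult_le_pos; [|left; apply exp_pos].
      assert (Q : Rabs (e * (2 * (a s * da s + b s * db s))) <= 4 * L * N s).
      { assert (He1 : Rabs e = 1).
        { assert (H1 : Rabs e * Rabs e = 1) by (rewrite <- Rabs_mult, He; apply Rabs_R1).
          assert (H0 := Rabs_pos e); nra. }
        rewrite !Rabs_mult, He1, Rmult_1_l, (Rabs_pos_eq 2) by lra.
        assert (H2 := Rabs_triang (a s * da s) (b s * db s)); rewrite !Rabs_mult in H2.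
        assert (HN : N s = Rabs (a s) * Rabs (a s) + Rabs (b s) * Rabs (b s)).
        { unfold N; rewrite <- !Rabs_mult, !Rabs_pos_eq by nra; reflexivity. }
        rewrite HN; assert (P := Rabs_pos (a s)); assert (P' := Rabs_pos (b s)).
        set (p := Rabs (a s)) in *; set (r := Rabs (b s)) in *.
        assert (p * Rabs (da s) <= p * (L * (p + r))) by (apply Rmult_le_compat_l; assumption).
        assert (r * Rabs (db s) <= r * (L * (p + r))) by (apply Rmult_le_compat_l; assumption).
        assert (0 <= L * (p - r) ^ 2) by (apply Rmult_le_pos; [lra | apply pow2_ge_0]).
        nra. }
      apply Rabs_le_between in Q; lra.
    - apply filterlim_Rmult; [apply filterlim_Rmult; [apply filterlim_const|]|].
      + apply filterlim_Rplus; apply filterlim_Rmult; assumption.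
      + apply (right_limit_of_continuous w); eapply is_derive_continuous, Hw. }
  assert (H1 := Hgen 1 ltac:(ring)). assert (H2 := Hgen (- (1)) ltac:(ring)).
  rewrite !Rmult_1_l in H1. fold (N t) (N T); split; [|exact H1].
  assert (HE : exp (- (1) * (4 * L) * (T - t)) * exp (4 * L * (T - t)) = 1).
  { rewrite <- exp_plus; transitivity (exp 0); [f_equal; ring | apply exp_0]. }
  assert (HP := exp_pos (4 * L * (T - t))).
  set (E := exp (4 * L * (T - t))) in *; set (E' := exp (- (1) * (4 * L) * (T - t))) in *.
  replace (N T) with (N T * E' * E) by (rewrite Rmult_assoc, HE; ring).
  apply Rmult_le_compat_r; lra.
Qed.

Lemma exp_ge_1 x : 0 <= x -> 1 <= exp x.
Proof.
  intros Hx; rewrite <- exp_0; destruct (Req_dec x 0) as [-> | Hne]; [lra|].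
  left; apply exp_increasing; lra.
Qed.

(** * The force of the limiting system *)

Lemma force_of_potential (H : R -> R -> R -> R) (V : R -> R -> R) (w : R -> R) :
  (forall x y lam, H x y lam = y ^ 2 / 2 + V x lam) ->
  (forall x lam, is_derive (fun s => V s lam) x ((x ^ 2 - lam) * w x)) ->
  forall x y lam, d1_3 H x y lam = (x ^ 2 - lam) * w x.
Proof.
  intros HV HdV x y lam; apply is_derive_unique.
  apply (is_derive_ext (fun s => plus (y ^ 2 / 2) (V s lam))).
  { intros s; symmetry; apply HV. }
  replace ((x ^ 2 - lam) * w x) with (plus 0 ((x ^ 2 - lam) * w x)) by apply Rplus_0_l.
  apply (is_derive_plus (fun _ => y ^ 2 / 2) (fun s => V s lam)); [|apply HdV].
  apply (is_derive_const (V := R_NormedModule)).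
Qed.

(** At [lam = -1] the factor [x ^ 2 - lam] of the force has no zero, which makes
    [w] a quotient of smooth functions. *)
Lemma weight_twice_differentiable (H : R -> R -> R -> R) (w : R -> R) :
  limiting_hamiltonian H w ->
  exists w1 w2 : R -> R,
    (forall x, is_derive w x (w1 x)) /\ (forall x, is_derive w1 x (w2 x)) /\
    (forall x, continuous w2 x).
Proof.
  intros (Hs & V & HV & HdV & _).
  pose (p0 := fun x => d1_3 H x 0 (-1)).
  pose (p1 := fun x => d1_3 (d1_3 H) x 0 (-1)).
  pose (p2 := fun x => d1_3 (d1_3 (d1_3 H)) x 0 (-1)).
  assert (H01 : forall x, is_derive p0 x (p1 x)).
  { intros x; apply Derive_correct, (Hs 2%nat x 0 (-1) I). }
  assert (H12 : forall x, is_derive p1 x (p2 x)).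
  { intros x; apply Derive_correct, (Hs 3%nat x 0 (-1) I). }
  assert (C2 : forall x, continuous p2 x).
  { intros x.
    apply (continuous_comp (fun s => (s, (0, -1))) (uncurry3 (d1_3 (d1_3 (d1_3 H))))).
    - intros P [e HP]; exists e; intros s Hball; apply HP.
      repeat split; [assumption | apply ball_center | apply ball_center].
    - apply (Hs 3%nat x 0 (-1) I). }
  assert (Hw : forall x, w x = p0 x / (x ^ 2 + 1)).
  { intros x; unfold p0.
    rewrite (force_of_potential H V w HV HdV).
    assert (0 <= x ^ 2) by apply pow2_ge_0; field; lra. }
  clearbody p0 p1 p2.
  assert (C0 : forall x, continuous p0 x).
  { intros x; apply (ex_derive_continuous (V := R_NormedModule)); eexists; apply H01. }
  assert (C1 : forall x, continuous p1 x).
  { intros x; apply (ex_derive_continuous (V := R_NormedModule)); eexists; apply H12. }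
  pose (w1 := fun x => (p1 x * (x ^ 2 + 1) - 2 * x * p0 x) / (x ^ 2 + 1) ^ 2).
  pose (w2 := fun x =>
    ((p2 x * (x ^ 2 + 1) - 2 * p0 x) * (x ^ 2 + 1)
     - (p1 x * (x ^ 2 + 1) - 2 * x * p0 x) * (4 * x)) * / (x ^ 2 + 1) ^ 3).
  assert (Hpos : forall x, x ^ 2 + 1 <> 0).
  { intros x; assert (0 <= x ^ 2) by apply pow2_ge_0; lra. }
  assert (E01 : forall x, Derive (fun s => p0 s) x = p1 x)
    by (intros; apply is_derive_unique, H01).
  assert (E12 : forall x, Derive (fun s => p1 s) x = p2 x)
    by (intros; apply is_derive_unique, H12).
  exists w1, w2; split; [|split].
  - intros x. apply (is_derive_ext (fun s => p0 s / (s ^ 2 + 1))).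
    { intros; symmetry; apply Hw. }
    auto_derive.
    + repeat split; [eexists; apply H01 | apply Hpos].
    + rewrite E01; unfold w1; specialize (Hpos x); simpl in Hpos; field; simpl; lra.
  - intros x; unfold w1; auto_derive.
    + repeat split; [eexists; apply H12 | eexists; apply H01 |].
      specialize (Hpos x); intro HH; apply Hpos; simpl in *; nra.
    + rewrite E01, E12; unfold w2; specialize (Hpos x); simpl in *; field; lra.
  - intros x. unfold w2.
    assert (CX : forall (h : R -> R), ex_derive h x -> continuous h x)
      by (intros; apply (ex_derive_continuous (V := R_NormedModule)); assumption).
    assert (CM : forall h k : R -> R, continuous h x -> continuous k x ->
              continuous (fun s => h s * k s) x)
      by (intros h k Hh Hk; apply (continuous_mult h k); assumption).
    assert (CS : forall h k : R -> R, continuous h x -> continuous k x ->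
              continuous (fun s => h s - k s) x)
      by (intros h k Hh Hk; apply (continuous_minus h k); assumption).
    apply CM; [|apply CX; auto_derive; specialize (Hpos x); simpl in *; nra].
    assert (Q : continuous (fun s : R => s ^ 2 + 1) x) by (apply CX; auto_derive; trivial).
    assert (Q0 : continuous (fun s : R => 2 * p0 s) x)
      by (apply CX; auto_derive; eexists; apply H01).
    apply (CS _ _ (CM _ _ (CS _ _ (CM _ _ (C2 x) Q) Q0) Q)).
    apply CX; auto_derive; repeat split; eexists; [apply H12 | apply H01].
Qed.

Set Implicit Arguments.

(** The limiting system at [lam = 0]. The factor [psi] of the derivative of the
    force [phi] is there because the linearization is taken at points that tend
    to the degenerate equilibrium, where only [psi] has a nonzero limit. *)
Record limiting_force (H : R -> R -> R -> R) (w : R -> R)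
    (V phi phi1 phi2 psi : R -> R) : Prop := {
  lf_velocity : forall x y, d2_3 H x y 0 = y;
  lf_force : forall x y, d1_3 H x y 0 = phi x;
  lf_V : forall x, is_derive V x (phi x);
  lf_phi : forall x, is_derive phi x (phi1 x);
  lf_phi1 : forall x, is_derive phi1 x (phi2 x);
  lf_phi2 : forall x, continuous phi2 x;
  lf_phi2_0 : phi2 0 = 2 * w 0;
  lf_psi : forall x, phi1 x = x * psi x;
  lf_psi_cont : continuous psi 0;
  lf_psi_0 : psi 0 = 2 * w 0;
  lf_w : 0 < w 0 }.

Unset Implicit Arguments.

Lemma limiting_force_exists (H : R -> R -> R -> R) (w : R -> R) :
  limiting_hamiltonian H w ->
  exists V phi phi1 phi2 psi, limiting_force H w V phi phi1 phi2 psi.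
Proof.
  intros HH.
  destruct (weight_twice_differentiable H w HH) as (w1 & w2 & D1 & D2 & C2).
  destruct HH as (_ & V & HV & HdV & d0 & Hd0 & Hw).
  assert (E1 : forall x, Derive (fun s => w s) x = w1 x)
    by (intros; apply is_derive_unique, D1).
  assert (E2 : forall x, Derive (fun s => w1 s) x = w2 x)
    by (intros; apply is_derive_unique, D2).
  assert (CX : forall (h : R -> R) x, ex_derive h x -> continuous h x)
      by (intros; apply (ex_derive_continuous (V := R_NormedModule)); assumption).
  exists (fun x => V x 0), (fun x => x ^ 2 * w x),
    (fun x => 2 * x * w x + x ^ 2 * w1 x),
    (fun x => (2 * w x + 4 * x * w1 x) + x ^ 2 * w2 x),
    (fun x => 2 * w x + x * w1 x).
  split.
  - intros x y; unfold d2_3.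
    rewrite (Derive_ext _ (fun s => s ^ 2 / 2 + V x 0)) by (intros; apply HV).
    apply is_derive_unique; auto_derive; [trivial | field].
  - intros x y; rewrite (force_of_potential H V w HV HdV); ring.
  - intros x; replace (x ^ 2 * w x) with ((x ^ 2 - 0) * w x) by ring; apply HdV.
  - intros x; auto_derive; [eexists; apply D1 | rewrite E1; ring].
  - intros x; auto_derive.
    + repeat split; eexists; [apply D1 | apply D2].
    + rewrite E1, E2; ring.
  - intros x.
    apply (continuous_plus (fun x => 2 * w x + 4 * x * w1 x) (fun x => x ^ 2 * w2 x)).
    + apply CX; auto_derive; repeat split; eexists; [apply D1 | apply D2].
    + apply (continuous_mult (fun x => x ^ 2) w2); [|apply C2].
      apply CX; auto_derive; trivial.
  - ring.
  - intros x; ring.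
  - apply CX; auto_derive; repeat split; eexists; [apply D1 | apply D2].
  - ring.
  - apply (Hw 0 0); left; rewrite sqrt_0, Rabs_R0; lra.
Qed.

Section Field.

Context {H : R -> R -> R -> R} {w V phi phi1 phi2 psi : R -> R}.
Context (Hlf : limiting_force H w V phi phi1 phi2 psi).

Lemma velocity_taylor_box (F : R -> R -> R -> R) :
  taylor_box F (d1_3 F) (d2_3 F) ->
  taylor_box (fun x y t => d2_3 H x y 0 + F x y t)
    (d1_3 F) (fun x y t => 1 + d2_3 F x y t).
Proof.
  intros HF M ta tb Hta; destruct (HF M ta tb Hta) as (C & HC & HC').
  exists (1 + C); split; [lra|].
  intros t x y x' y' Ht Hx Hy Hx' Hy'.
  destruct (HC' t x y x' y' Ht Hx Hy Hx' Hy') as (A1 & A2 & A3).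
  rewrite !(lf_velocity Hlf).
  split; [lra|split].
  - eapply Rle_trans; [apply Rabs_triang|]; rewrite Rabs_R1; lra.
  - replace (y' + F x' y' t - (y + F x y t) - d1_3 F x y t * (x' - x)
       - (1 + d2_3 F x y t) * (y' - y))
    with (F x' y' t - F x y t - d1_3 F x y t * (x' - x) - d2_3 F x y t * (y' - y)) by ring.
    assert (0 <= (Rabs (x' - x) + Rabs (y' - y)) ^ 2) by apply pow2_ge_0. nra.
Qed.

Lemma force_taylor_box (G : R -> R -> R -> R) :
  taylor_box G (d1_3 G) (d2_3 G) ->
  taylor_box (fun x y t => - d1_3 H x y 0 + G x y t)
    (fun x y t => - phi1 x + d1_3 G x y t) (d2_3 G).
Proof.
  intros HG M ta tb Hta; destruct (HG M ta tb Hta) as (C & HC & HC').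
  assert (Hb : forall h : R -> R, (forall x, continuous h x) ->
    exists B, 0 < B /\ forall x, Rabs x <= M -> Rabs (h x) <= B).
  { intros h Hh.
    destruct (continuous_bounded_interval h (-M) M) as (B & HB & HB'); [auto|].
    exists B; split; [assumption|]; intros x Hx; apply HB', Rabs_le_between, Hx. }
  destruct (Hb phi1) as (B1 & HB1 & H1).
  { intros x; apply (is_derive_continuous _ _ _ (lf_phi1 Hlf x)). }
  destruct (Hb phi2) as (B2 & HB2 & H2); [apply (lf_phi2 Hlf)|].
  exists (B1 + B2 + C); split; [lra|].
  intros t x y x' y' Ht Hx Hy Hx' Hy'.
  destruct (HC' t x y x' y' Ht Hx Hy Hx' Hy') as (A1 & A2 & A3).
  rewrite !(lf_force Hlf).
  split; [|split].
  - eapply Rle_trans; [apply Rabs_triang|]; rewrite Rabs_Ropp; specialize (H1 x Hx); lra.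
  - lra.
  - destruct (mvt_between phi phi1 x x') as (xi & Hxi & E1); [apply (lf_phi Hlf)|].
    destruct (mvt_between phi1 phi2 x xi) as (z & Hz & E2); [apply (lf_phi1 Hlf)|].
    assert (Mxi : Rabs xi <= M) by (eapply Rabs_between; eassumption).
    specialize (H2 z (Rabs_between _ _ _ _ Hz Hx Mxi)).
    apply Rabs_between_sub in Hxi.
    replace (- phi x' + G x' y' t - (- phi x + G x y t)
       - (- phi1 x + d1_3 G x y t) * (x' - x) - d2_3 G x y t * (y' - y))
    with (- (phi2 z * (xi - x)) * (x' - x)
       + (G x' y' t - G x y t - d1_3 G x y t * (x' - x) - d2_3 G x y t * (y' - y))).
    2:{ rewrite <- E2; replace (phi x') with (phi x + (phi x' - phi x)) by ring.
        rewrite E1; ring. }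
    eapply Rle_trans; [apply Rabs_triang|].
    rewrite Rabs_mult, Rabs_Ropp, Rabs_mult.
    set (p := Rabs (x' - x)) in *; set (r := Rabs (y' - y)) in *.
    assert (0 <= p) by apply Rabs_pos. assert (0 <= r) by apply Rabs_pos.
    assert (Rabs (phi2 z) * Rabs (xi - x) * p <= B2 * (p * p)).
    { rewrite Rmult_assoc. apply Rmult_le_compat; try apply Rabs_pos; [|assumption|].
      - apply Rmult_le_pos; [apply Rabs_pos | assumption].
      - apply Rmult_le_compat_r; assumption. }
    assert (0 <= p * r) by (apply Rmult_le_pos; assumption).
    assert (0 <= r * r) by (apply Rmult_le_pos; assumption).
    assert (B2 * (p * p) <= B2 * (p + r) ^ 2) by (apply Rmult_le_compat_l; nra).
    assert (0 <= B1 * (p + r) ^ 2) by (apply Rmult_le_pos; [lra | apply pow2_ge_0]).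
    lra.
Qed.

Lemma velocity_continuous_along_curves (F : R -> R -> R -> R) :
  continuous_along_curves F ->
  continuous_along_curves (fun x y t => d2_3 H x y 0 + F x y t).
Proof.
  intros HF x y z t Ht Hx Hy Hz.
  apply (continuous_plus (fun s => d2_3 H (x s) (y s) 0) (fun s => F (x s) (y s) (z s))).
  - apply (continuous_ext y); [|assumption].
    intros s; symmetry; apply (lf_velocity Hlf).
  - apply HF; assumption.
Qed.

Lemma force_continuous_along_curves (G : R -> R -> R -> R) :
  continuous_along_curves G ->
  continuous_along_curves (fun x y t => - d1_3 H x y 0 + G x y t).
Proof.
  intros HG x y z t Ht Hx Hy Hz.
  apply (continuous_plus (fun s => - d1_3 H (x s) (y s) 0) (fun s => G (x s) (y s) (z s))).
  - apply (continuous_opp (fun s => d1_3 H (x s) (y s) 0)).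
    apply (continuous_ext (fun s => phi (x s))).
    { intros s; symmetry; apply (lf_force Hlf). }
    apply continuous_comp; [assumption|].
    apply (is_derive_continuous _ _ _ (lf_phi Hlf _)).
  - apply HG; assumption.
Qed.

End Field.

(** * Existence of solutions *)

Lemma dominated_by_derivative (f df g dg : R -> R) (a b : R) :
  a <= b ->
  (forall t, a < t <= b -> is_derive f t (df t)) ->
  (forall t, a < t <= b -> is_derive g t (dg t)) ->
  (forall t, a < t <= b -> Rabs (df t) <= dg t) ->
  filterlim f (at_right a) (locally (f a)) ->
  filterlim g (at_right a) (locally (g a)) ->
  Rabs (f a) <= g a -> Rabs (f b) <= g b.
Proof.
  intros Hab Hf Hg Hle Lf Lg H0.
  apply Rabs_le_between in H0; apply Rabs_le_between.
  assert (g a - f a <= g b - f b).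
  { apply (nondecreasing_from_right (fun t => g t - f t) (fun t => dg t - df t) a b); auto.
    - intros t Ht; apply is_derive_Rminus; auto.
    - intros t Ht; specialize (Hle t Ht); apply Rabs_le_between in Hle; lra.
    - apply filterlim_Rminus; assumption. }
  assert (g a + f a <= g b + f b).
  { apply (nondecreasing_from_right (fun t => g t + f t) (fun t => dg t + df t) a b); auto.
    - intros t Ht; apply is_derive_Rplus; auto.
    - intros t Ht; specialize (Hle t Ht); apply Rabs_le_between in Hle; lra.
    - apply filterlim_Rplus; assumption. }
  lra.
Qed.

Lemma geometric_increments_limit (a : nat -> R) (B : R) :
  (forall k, Rabs (a (S k) - a k) <= B * (/ 2) ^ k) ->
  forall k, Rabs (real (Lim_seq a) - a k) <= 2 * B * (/ 2) ^ k.
Proof.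
  intros Ha.
  assert (HB : 0 <= B).
  { specialize (Ha O); simpl in Ha; assert (HP := Rabs_pos (a 1%nat - a O)); lra. }
  assert (Hp : forall k, 0 < (/ 2) ^ k) by (intros; apply pow_lt; lra).
  assert (Hj : forall k j, Rabs (a (j + k)%nat - a k) <= 2 * B * (/ 2) ^ k * (1 - (/ 2) ^ j)).
  { intros k; induction j as [|j IH]; cbn [Nat.add].
    - rewrite Rminus_diag, Rabs_R0; simpl; lra.
    - replace (a (S (j + k)) - a k) with ((a (S (j + k)) - a (j + k)%nat) + (a (j + k)%nat - a k)) by ring.
      eapply Rle_trans; [apply Rabs_triang|].
      specialize (Ha (j + k)%nat). rewrite pow_add in Ha.
      replace ((/ 2) ^ S j) with (/ 2 * (/ 2) ^ j) by reflexivity. nra. }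
  assert (Hj' : forall k j, Rabs (a (j + k)%nat - a k) <= 2 * B * (/ 2) ^ k).
  { intros k j; eapply Rle_trans; [apply Hj|].
    assert (0 <= 2 * B * (/ 2) ^ k) by (specialize (Hp k); nra).
    specialize (Hp j). nra. }
  assert (Hc : ex_finite_lim_seq a).
  { apply ex_lim_seq_cauchy_corr; intros eps.
    destruct (pow_lt_1_zero (/ 2)) with (y := eps / (4 * B + 1)) as [N HN].
    - rewrite Rabs_pos_eq; lra.
    - apply Rdiv_lt_0_compat; [apply eps | lra].
    - exists N; intros n m Hn Hm.
      assert (HNN := HN N (Nat.le_refl N)).
      rewrite Rabs_pos_eq in HNN by (left; apply Hp).
      assert (H4 : (4 * B + 1) * (/ 2) ^ N < eps).
      { replace (pos eps) with ((4 * B + 1) * (eps / (4 * B + 1))) by (field; lra).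
        apply Rmult_lt_compat_l; lra. }
      assert (A1 := Hj' N (n - N)%nat). assert (A2 := Hj' N (m - N)%nat).
      rewrite Nat.sub_add in A1, A2 by assumption.
      replace (a n - a m) with ((a n - a N) - (a m - a N)) by ring.
      eapply Rle_lt_trans; [apply Rabs_triang|]. rewrite Rabs_Ropp.
      specialize (Hp N); lra. }
  intros k; apply Lim_seq_correct' in Hc.
  assert (H1 : is_lim_seq (fun j => Rabs (a (j + k)%nat - a k)) (Rabs (real (Lim_seq a) - a k))).
  { apply (is_lim_seq_abs (fun j => a (j + k)%nat - a k) (Finite (real (Lim_seq a) - a k))).
    apply is_lim_seq_minus'; [|apply is_lim_seq_const].
    apply -> (is_lim_seq_incr_n a k (Finite (real (Lim_seq a)))); exact Hc. }
  assert (H2 := is_lim_seq_le _ _ (Finite (Rabs (real (Lim_seq a) - a k)))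
    (Finite (2 * B * (/ 2) ^ k)) (Hj' k) H1 (is_lim_seq_const _)).
  exact H2.
Qed.

Lemma antiderivative (h : R -> R) (a c : R) :
  (forall t, continuous h t) ->
  forall t, is_derive (fun s => c + RInt h a s) t (h t).
Proof.
  intros Hh t.
  replace (h t) with (plus 0 (h t)) by apply Rplus_0_l.
  apply (is_derive_plus (fun _ => c)); [apply (is_derive_const (V := R_NormedModule))|].
  apply (is_derive_RInt h (RInt h a) a); [|apply Hh].
  apply filter_forall; intros b.
  apply (RInt_correct (V := R_CompleteNormedModule)).
  apply (ex_RInt_continuous (V := R_CompleteNormedModule)); intros; apply Hh.
Qed.

Lemma continuous_small (h : R -> R) (t eps : R) : continuous h t -> 0 < eps ->
  locally t (fun s => Rabs (h s - h t) < eps).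
Proof.
  intros Hh He.
  apply (Hh (fun r => Rabs (r - h t) < eps)).
  exists (mkposreal _ He); intros r Hr; exact Hr.
Qed.

Lemma continuous_of_small (h : R -> R) (t : R) :
  (forall eps, 0 < eps -> locally t (fun s => Rabs (h s - h t) < eps)) ->
  continuous h t.
Proof.
  intros Hh P [e HP].
  change (locally t (fun s => P (h s))).
  generalize (Hh e (cond_pos e)); apply filter_imp.
  intros s Hs; apply HP; exact Hs.
Qed.

(** Global existence by successive approximation. The half-line is treated at
    once: the iterates are defined on it, and only the constants of the estimates
    depend on the bounded interval considered. *)
Section Picard.

Variables P Q : R -> R -> R -> R.
Variables t0 u0 v0 : R.

Hypothesis P_cont : forall u v : R -> R,
  (forall t, continuous u t) -> (forall t, continuous v t) ->
  forall t, continuous (fun s => P (u s) (v s) s) t.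
Hypothesis Q_cont : forall u v : R -> R,
  (forall t, continuous u t) -> (forall t, continuous v t) ->
  forall t, continuous (fun s => Q (u s) (v s) s) t.
Hypothesis PQ_lip : forall b, exists L, 0 < L /\ forall t u v u' v', t0 <= t <= b ->
  Rabs (P u v t - P u' v' t) <= L * (Rabs (u - u') + Rabs (v - v')) /\
  Rabs (Q u v t - Q u' v' t) <= L * (Rabs (u - u') + Rabs (v - v')).

Fixpoint picard_iterate (k : nat) : (R -> R) * (R -> R) :=
  match k with
  | O => (fun _ => u0, fun _ => v0)
  | S k =>
      let u := fst (picard_iterate k) in
      let v := snd (picard_iterate k) in
      (fun t => u0 + RInt (fun s => P (u s) (v s) s) t0 t,
       fun t => v0 + RInt (fun s => Q (u s) (v s) s) t0 t)
  end.

Let uk k := fst (picard_iterate k).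
Let vk k := snd (picard_iterate k).

Lemma picard_continuous k :
  (forall t, continuous (uk k) t) /\ (forall t, continuous (vk k) t).
Proof.
  induction k as [|k [IHu IHv]].
  - split; intros t; apply continuous_const.
  - split; intros t; eapply is_derive_continuous.
    + apply (antiderivative (fun s => P (uk k s) (vk k s) s)), P_cont; assumption.
    + apply (antiderivative (fun s => Q (uk k s) (vk k s) s)), Q_cont; assumption.
Qed.

Lemma picard_derive k t :
  is_derive (uk (S k)) t (P (uk k t) (vk k t) t) /\
  is_derive (vk (S k)) t (Q (uk k t) (vk k t) t).
Proof.
  destruct (picard_continuous k) as [Hu Hv]. split.
  - apply (antiderivative (fun s => P (uk k s) (vk k s) s)), P_cont; assumption.
  - apply (antiderivative (fun s => Q (uk k s) (vk k s) s)), Q_cont; assumption.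
Qed.

Lemma picard_start k : uk k t0 = u0 /\ vk k t0 = v0.
Proof.
  destruct k as [|k]; [split; reflexivity|]; split.
  - change (u0 + RInt (fun s => P (uk k s) (vk k s) s) t0 t0 = u0).
    rewrite RInt_point; apply Rplus_0_r.
  - change (v0 + RInt (fun s => Q (uk k s) (vk k s) s) t0 t0 = v0).
    rewrite RInt_point; apply Rplus_0_r.
Qed.

Lemma picard_increments b : t0 <= b -> exists B, forall k t, t0 <= t <= b ->
  Rabs (uk (S k) t - uk k t) <= B * (/ 2) ^ k /\
  Rabs (vk (S k) t - vk k t) <= B * (/ 2) ^ k.
Proof.
  intros Hb.
  destruct (PQ_lip b) as (L & HL & Hlip).
  destruct (continuous_bounded_interval (fun t => uk 1 t - uk 0 t) t0 b) as (A1 & HA1 & H1).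
  { intros t _; apply (continuous_minus (uk 1) (uk 0)); apply (proj1 (picard_continuous _)). }
  destruct (continuous_bounded_interval (fun t => vk 1 t - vk 0 t) t0 b) as (A2 & HA2 & H2).
  { intros t _; apply (continuous_minus (vk 1) (vk 0)); apply (proj2 (picard_continuous _)). }
  pose (A := A1 + A2).
  (* the weight exp (4 L (t - t0)) makes the integral operator halve the
     distance of consecutive iterates *)
  assert (Hk : forall k t, t0 <= t <= b ->
    Rabs (uk (S k) t - uk k t) <= A * (/ 2) ^ k * exp (4 * L * (t - t0)) /\
    Rabs (vk (S k) t - vk k t) <= A * (/ 2) ^ k * exp (4 * L * (t - t0))).
  { induction k as [|k IH]; intros t Ht.
    - assert (1 <= exp (4 * L * (t - t0))) by (apply exp_ge_1; nra).
      specialize (H1 t Ht); specialize (H2 t Ht); rewrite pow_O, Rmult_1_r.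
      assert (A * 1 <= A * exp (4 * L * (t - t0))) by (apply Rmult_le_compat_l; unfold A; lra).
      unfold A in *; lra.
    - assert (Hg : forall s, is_derive (fun t => A * (/ 2) ^ S k * exp (4 * L * (t - t0))) s
         (A * (/ 2) ^ S k * (4 * L) * exp (4 * L * (s - t0)))).
      { intros s; generalize (A * (/ 2) ^ S k); intros c; auto_derive; [trivial | unfold Rminus; ring]. }
      assert (Hgc : forall s, continuous (fun t => A * (/ 2) ^ S k * exp (4 * L * (t - t0))) s)
        by (intros s; eapply is_derive_continuous, Hg).
      assert (Hle : forall s x, t0 <= s <= b ->
         x <= L * (Rabs (uk (S k) s - uk k s) + Rabs (vk (S k) s - vk k s)) ->
         x <= A * (/ 2) ^ S k * (4 * L) * exp (4 * L * (s - t0))).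
      { intros s x Hs Hx; specialize (IH s Hs); eapply Rle_trans; [apply Hx|].
        replace (A * (/ 2) ^ S k * (4 * L) * exp (4 * L * (s - t0)))
          with (L * (A * (/ 2) ^ k * exp (4 * L * (s - t0)) + A * (/ 2) ^ k * exp (4 * L * (s - t0))))
          by (simpl; field).
        apply Rmult_le_compat_l; lra. }
      assert (HA0 : 0 <= A * (/ 2) ^ S k * exp (4 * L * (t0 - t0))).
      { apply Rmult_le_pos; [apply Rmult_le_pos; [unfold A; lra | apply pow_le; lra] | left; apply exp_pos]. }
      assert (Hgen : forall (x : nat -> R -> R) (h : R -> R -> R -> R) (a : R),
        (forall j s, is_derive (x (S j)) s (h (uk j s) (vk j s) s)) ->
        (forall j, x j t0 = a) ->
        (forall u v u' v' s, t0 <= s <= b ->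
           Rabs (h u v s - h u' v' s) <= L * (Rabs (u - u') + Rabs (v - v'))) ->
        Rabs (x (S (S k)) t - x (S k) t) <= A * (/ 2) ^ S k * exp (4 * L * (t - t0))).
      { intros x h a Hx Hx0 Hh.
        apply (dominated_by_derivative (fun t => x (S (S k)) t - x (S k) t)
          (fun s => h (uk (S k) s) (vk (S k) s) s - h (uk k s) (vk k s) s)
          (fun t => A * (/ 2) ^ S k * exp (4 * L * (t - t0)))
          (fun s => A * (/ 2) ^ S k * (4 * L) * exp (4 * L * (s - t0))) t0 t); auto.
        - lra.
        - intros s _; apply is_derive_Rminus; apply Hx.
        - intros s Hs; apply Hle; [lra|]; apply Hh; lra.
        - apply (right_limit_of_continuous (fun t => x (S (S k)) t - x (S k) t)).
          eapply is_derive_continuous, is_derive_Rminus; apply Hx.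
        - apply (right_limit_of_continuous (fun t => A * (/ 2) ^ S k * exp (4 * L * (t - t0)))), Hgc.
        - rewrite !Hx0, Rminus_diag, Rabs_R0; exact HA0. }
      split.
      + apply (Hgen uk P u0); [intros; apply picard_derive | intros; apply picard_start |].
        intros; apply Hlip; assumption.
      + apply (Hgen vk Q v0); [intros; apply picard_derive | intros; apply picard_start |].
        intros; apply Hlip; assumption. }
  exists (A * exp (4 * L * (b - t0))); intros k t Ht.
  assert (He : A * (/ 2) ^ k * exp (4 * L * (t - t0)) <= A * exp (4 * L * (b - t0)) * (/ 2) ^ k).
  { replace (A * exp (4 * L * (b - t0)) * (/ 2) ^ k) with (A * (/ 2) ^ k * exp (4 * L * (b - t0))) by ring.
    apply Rmult_le_compat_l.
    - apply Rmult_le_pos; [unfold A; lra | apply pow_le; lra].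
    - destruct (Req_dec t b) as [-> | Hne]; [lra|]. left; apply exp_increasing; nra. }
  specialize (Hk k t Ht); lra.
Qed.

(* Freezing the time at [t0] on the left gives a limit that is continuous on the
   whole line, as the continuity hypotheses on the field demand. *)
Let ul t := real (Lim_seq (fun k => uk k (Rmax t0 t))).
Let vl t := real (Lim_seq (fun k => vk k (Rmax t0 t))).

Lemma picard_uniform b : t0 <= b -> exists B, 0 <= B /\ forall k t, t <= b ->
  Rabs (ul t - uk k (Rmax t0 t)) <= B * (/ 2) ^ k /\
  Rabs (vl t - vk k (Rmax t0 t)) <= B * (/ 2) ^ k.
Proof.
  intros Hb; destruct (picard_increments b Hb) as (B & HB).
  exists (2 * B); split.
  - destruct (HB O b) as [H _]; [lra|]. rewrite pow_O in H.
    assert (H' := Rabs_pos (uk 1 b - uk 0 b)). lra.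
  - intros k t Ht.
    assert (Hm : t0 <= Rmax t0 t <= b) by (split; [apply Rmax_l | apply Rmax_lub; lra]).
    split; apply (geometric_increments_limit (fun k => _ k (Rmax t0 t)) B);
    intros j; apply HB; assumption.
Qed.

Lemma continuous_Rmax a t : continuous (Rmax a) t.
Proof.
  apply continuous_of_small; intros eps He.
  exists (mkposreal _ He); intros s Hs.
  apply -> ball_Rabs in Hs; cbn in Hs.
  apply Rabs_def2 in Hs; unfold Rmax.
  destruct (Rle_dec a s), (Rle_dec a t); apply Rabs_def1; lra.
Qed.

Lemma picard_limit_continuous :
  (forall t, continuous ul t) /\ (forall t, continuous vl t).
Proof.
  assert (Hgen : forall (l : R -> R) (k_ : nat -> R -> R),
    (forall k t, continuous (k_ k) t) ->
    (forall b, t0 <= b -> exists B, 0 <= B /\ forall k t, t <= b ->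
       Rabs (l t - k_ k (Rmax t0 t)) <= B * (/ 2) ^ k) ->
    forall t, continuous l t).
  { intros l k_ Hk Hl t; apply continuous_of_small; intros eps He.
    destruct (Hl (Rmax t0 (t + 1)) (Rmax_l _ _)) as (B & HB & HlB).
    destruct (pow_lt_1_zero (/ 2)) with (y := eps / (4 * B + 4)) as [N HN].
    { rewrite Rabs_pos_eq; lra. }
    { apply Rdiv_lt_0_compat; lra. }
    specialize (HN N (Nat.le_refl N)).
    assert (Hp : 0 < (/ 2) ^ N) by (apply pow_lt; lra).
    rewrite Rabs_pos_eq in HN by lra.
    assert (H4 : (4 * B + 4) * (/ 2) ^ N < eps).
    { replace eps with ((4 * B + 4) * (eps / (4 * B + 4))) by (field; lra).
      apply Rmult_lt_compat_l; lra. }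
    assert (Hc : continuous (fun s => k_ N (Rmax t0 s)) t).
    { apply continuous_comp; [apply continuous_Rmax | apply Hk]. }
    assert (He2 : 0 < eps / 2) by lra.
    assert (H1 : locally t (fun s => s < t + 1)).
    { apply (locally_open (fun s => s < t + 1) (fun s => s < t + 1)); auto.
      - apply open_lt.
      - lra. }
    generalize (filter_and _ _ (continuous_small _ _ _ Hc He2) H1).
    apply filter_imp; intros s [Hs Hst]; cbv beta in Hs.
    assert (A1 := HlB N s ltac:(assert (E := Rmax_r t0 (t + 1)); lra)).
    assert (A2 := HlB N t ltac:(assert (E := Rmax_r t0 (t + 1)); lra)).
    replace (l s - l t) with ((l s - k_ N (Rmax t0 s)) + (k_ N (Rmax t0 s) - k_ N (Rmax t0 t))
       - (l t - k_ N (Rmax t0 t))) by ring.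
    eapply Rle_lt_trans; [apply Rabs_triang|]; rewrite Rabs_Ropp.
    assert (A3 := Rabs_triang (l s - k_ N (Rmax t0 s)) (k_ N (Rmax t0 s) - k_ N (Rmax t0 t))).
    nra. }
  split.
  - apply (Hgen ul uk); [apply picard_continuous|].
    intros b Hb; destruct (picard_uniform b Hb) as (B & HB & H).
    exists B; split; [assumption | intros k t Ht; apply H; assumption].
  - apply (Hgen vl vk); [apply picard_continuous|].
    intros b Hb; destruct (picard_uniform b Hb) as (B & HB & H).
    exists B; split; [assumption | intros k t Ht; apply H; assumption].
Qed.

Lemma picard_fixpoint t : t0 <= t ->
  ul t = u0 + RInt (fun s => P (ul s) (vl s) s) t0 t /\
  vl t = v0 + RInt (fun s => Q (ul s) (vl s) s) t0 t.
Proof.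
  intros Ht.
  destruct (picard_uniform t Ht) as (B & HB & Hunif).
  destruct (PQ_lip t) as (L & HL & Hlip).
  destruct picard_limit_continuous as [Cu Cv].
  assert (Hzero : forall x C, (forall k, Rabs x <= C * (/ 2) ^ k) -> x = 0).
  { intros x C Hx.
    destruct (Req_dec x 0) as [|Hne]; [assumption|exfalso].
    assert (Hx0 : 0 < Rabs x) by (apply Rabs_pos_lt; assumption).
    assert (HC : 0 < C) by (specialize (Hx O); simpl in Hx; lra).
    destruct (pow_lt_1_zero (/ 2)) with (y := Rabs x / C) as [N HN].
    { rewrite Rabs_pos_eq; lra. }
    { apply Rdiv_lt_0_compat; lra. }
    specialize (HN N (Nat.le_refl N)).
    rewrite Rabs_pos_eq in HN by (apply pow_le; lra).
    specialize (Hx N).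
    assert (C * (/ 2) ^ N < C * (Rabs x / C)) by (apply Rmult_lt_compat_l; assumption).
    replace (C * (Rabs x / C)) with (Rabs x) in * by (field; lra). lra. }
  assert (Hsum : forall k s, t0 < s <= t ->
    L * (Rabs (uk k s - ul s) + Rabs (vk k s - vl s)) <= 2 * L * B * (/ 2) ^ k).
  { intros k s Hs. destruct (Hunif k s) as [A1 A2]; [lra|].
    rewrite Rmax_right in A1, A2 by lra.
    rewrite (Rabs_minus_sym (uk k s)), (Rabs_minus_sym (vk k s)). nra. }
  assert (Hg : forall k s, is_derive (fun s => 2 * L * B * (/ 2) ^ k * (s - t0)) s
    (2 * L * B * (/ 2) ^ k)).
  { intros k s; generalize (2 * L * B * (/ 2) ^ k); intros c; auto_derive; [trivial | ring]. }
  assert (Hp : forall k, 0 < (/ 2) ^ k) by (intros; apply pow_lt; lra).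
  assert (Hgen : forall (l : R -> R) (x : nat -> R -> R) (h : R -> R -> R -> R) (a : R),
    (forall k s, is_derive (x (S k)) s (h (uk k s) (vk k s) s)) ->
    (forall k, x k t0 = a) ->
    (forall s, continuous (fun s => h (ul s) (vl s) s) s) ->
    (forall u v u' v' s, t0 <= s <= t ->
       Rabs (h u v s - h u' v' s) <= L * (Rabs (u - u') + Rabs (v - v'))) ->
    (forall k, Rabs (l t - x k t) <= B * (/ 2) ^ k) ->
    l t = a + RInt (fun s => h (ul s) (vl s) s) t0 t).
  { intros l x h a Hx Hx0 Hhc Hh Hl.
    apply Rminus_diag_uniq, (Hzero _ (B + 2 * L * B * (t - t0))); intros k.
    assert (D1 : forall s, is_derive
      (fun s => x (S k) s - (a + RInt (fun s => h (ul s) (vl s) s) t0 s)) s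
      (h (uk k s) (vk k s) s - h (ul s) (vl s) s)).
    { intros s; apply is_derive_Rminus; [apply Hx|].
      apply (antiderivative (fun s => h (ul s) (vl s) s)), Hhc. }
    assert (D : Rabs (x (S k) t - (a + RInt (fun s => h (ul s) (vl s) s) t0 t))
       <= 2 * L * B * (/ 2) ^ k * (t - t0)).
    { apply (dominated_by_derivative
        (fun s => x (S k) s - (a + RInt (fun s => h (ul s) (vl s) s) t0 s))
        (fun s => h (uk k s) (vk k s) s - h (ul s) (vl s) s)
        (fun s => 2 * L * B * (/ 2) ^ k * (s - t0)) (fun s => 2 * L * B * (/ 2) ^ k) t0 t Ht).
      - intros s _; apply D1.
      - intros s _; apply Hg.
      - intros s Hs; eapply Rle_trans; [apply Hh; lra | apply Hsum; assumption].
      - eapply (right_limit_of_continuous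
          (fun s => x (S k) s - (a + RInt (fun s => h (ul s) (vl s) s) t0 s))),
          is_derive_continuous, D1.
      - eapply (right_limit_of_continuous (fun s => 2 * L * B * (/ 2) ^ k * (s - t0))),
          is_derive_continuous, Hg.
      - rewrite Hx0, RInt_point.
        unfold zero; cbn. replace (a - (a + 0)) with 0 by ring. rewrite Rabs_R0; lra. }
    specialize (Hl (S k)).
    replace (l t - (a + RInt (fun s => h (ul s) (vl s) s) t0 t))
      with ((l t - x (S k) t) + (x (S k) t - (a + RInt (fun s => h (ul s) (vl s) s) t0 t))) by ring.
    eapply Rle_trans; [apply Rabs_triang|].
    assert (B * (/ 2) ^ S k <= B * (/ 2) ^ k) by (simpl; specialize (Hp k); nra).
    lra. }
  assert (Hunif' : forall k, Rabs (ul t - uk k t) <= B * (/ 2) ^ k /\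
    Rabs (vl t - vk k t) <= B * (/ 2) ^ k).
  { intros k; destruct (Hunif k t) as [A1 A2]; [lra|].
    rewrite Rmax_right in A1, A2 by lra; split; assumption. }
  split.
  - apply (Hgen ul uk P u0); [intros; apply picard_derive | intros; apply picard_start | | |].
    + apply P_cont; assumption.
    + intros; apply Hlip; assumption.
    + intros; apply Hunif'.
  - apply (Hgen vl vk Q v0); [intros; apply picard_derive | intros; apply picard_start | | |].
    + apply Q_cont; assumption.
    + intros; apply Hlip; assumption.
    + intros; apply Hunif'.
Qed.

Theorem picard_lindelof : exists u v : R -> R,
  u t0 = u0 /\ v t0 = v0 /\
  (forall t, continuous u t) /\ (forall t, continuous v t) /\
  forall t, t0 < t ->
    is_derive u t (P (u t) (v t) t) /\ is_derive v t (Q (u t) (v t) t).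
Proof.
  destruct picard_limit_continuous as [Cu Cv].
  exists ul, vl.
  destruct (picard_fixpoint t0 (Rle_refl t0)) as [E1 E2].
  rewrite RInt_point in E1, E2.
  split; [rewrite E1; apply Rplus_0_r|].
  split; [rewrite E2; apply Rplus_0_r|].
  split; [exact Cu | split; [exact Cv|]].
  intros t Ht.
  assert (Hloc : locally t (fun s => t0 < s)).
  { apply (locally_open (fun s => t0 < s) (fun s => t0 < s)); auto; apply open_gt. }
  split.
  - apply (is_derive_ext_loc (fun t => u0 + RInt (fun s => P (ul s) (vl s) s) t0 t)).
    + revert Hloc; apply filter_imp; intros s Hs; symmetry; apply picard_fixpoint; lra.
    + apply (antiderivative (fun s => P (ul s) (vl s) s)), P_cont; assumption.
  - apply (is_derive_ext_loc (fun t => v0 + RInt (fun s => Q (ul s) (vl s) s) t0 t)).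
    + revert Hloc; apply filter_imp; intros s Hs; symmetry; apply picard_fixpoint; lra.
    + apply (antiderivative (fun s => Q (ul s) (vl s) s)), Q_cont; assumption.
Qed.

End Picard.

(** * From trapped deviations to Lyapunov stability *)

Lemma right_limit_small (h : R -> R) (a eps : R) :
  filterlim h (at_right a) (locally (h a)) -> 0 < eps ->
  exists d, 0 < d /\ forall s, a < s < a + d -> Rabs (h s - h a) < eps.
Proof.
  intros Hh He.
  destruct (Hh (fun r => Rabs (r - h a) < eps)) as [d Hd].
  { exists (mkposreal _ He); intros r Hr; exact Hr. }
  exists d; split; [apply cond_pos|].
  intros s Hs; apply Hd; [|lra].
  apply ball_Rabs.
  apply Rabs_def1; lra.
Qed.

(** There is no first time at which [N] reaches [b], because the estimate that is
    valid up to this time improves the bound. *)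
Lemma continuous_induction (N : R -> R) (t0 t1 b : R) :
  filterlim N (at_right t0) (locally (N t0)) ->
  (forall t, t0 < t <= t1 -> continuous N t) ->
  N t0 < b ->
  (forall t, t0 < t <= t1 -> (forall s, t0 <= s <= t -> N s <= b) -> N t < b) ->
  forall t, t0 <= t <= t1 -> N t < b.
Proof.
  intros Hr Hc H0 Hstep t Ht.
  apply NNPP; intros Hbad.
  pose (E := fun s => t0 <= s <= t /\ forall r, t0 <= r <= s -> N r < b).
  destruct (completeness E) as [c [Hub Hlub]].
  { exists t; intros s [Hs _]; lra. }
  { exists t0; split; [lra|]; intros r Hr0; replace r with t0 by lra; assumption. }
  assert (Hc0 : t0 <= c).
  { apply Hub; split; [lra|]; intros r Hr0; replace r with t0 by lra; assumption. }
  assert (Hct : c <= t) by (apply Hlub; intros s [Hs _]; lra).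
  assert (Hbelow : forall r, t0 <= r < c -> N r < b).
  { intros r Hr0; apply NNPP; intros Hn.
    assert (c <= r); [|lra].
    apply Hlub; intros s [Hs Hs']; apply Rnot_lt_le; intros Hrs.
    apply Hn, Hs'; lra. }
  assert (HNc : N c < b).
  { destruct (Req_dec c t0) as [-> | Hne]; [assumption|].
    apply Hstep; [lra|].
    intros s Hs; destruct (Req_dec s c) as [-> | Hsc]; [|left; apply Hbelow; lra].
    apply Rnot_lt_le; intros Hlt.
    assert (He : 0 < N c - b) by lra.
    destruct (continuous_small N c _ (Hc c ltac:(lra)) He) as [d Hd].
    assert (Hd0 := cond_pos d).
    pose (r := Rmax t0 (c - d / 2)).
    assert (t0 <= r) by apply Rmax_l.
    assert (c - d / 2 <= r) by apply Rmax_r.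
    assert (r < c) by (apply Rmax_lub_lt; lra).
    assert (Hn : Rabs (N r - N c) < N c - b).
    { apply Hd; apply ball_Rabs.
      apply Rabs_def1; lra. }
    apply Rabs_def2 in Hn. specialize (Hbelow r); lra. }
  destruct (Req_dec c t) as [-> | Hne]; [contradiction|].
  assert (He : 0 < b - N c) by lra.
  assert (Hd : exists d, 0 < d /\ forall s, c < s < c + d -> Rabs (N s - N c) < b - N c).
  { destruct (Req_dec c t0) as [E0 | Hne0].
    - rewrite E0 in *; apply right_limit_small; assumption.
    - destruct (continuous_small N c _ (Hc c ltac:(lra)) He) as [d Hd].
      exists d; split; [apply cond_pos|]; intros s Hs; apply Hd.
      apply ball_Rabs.
      apply Rabs_def1; lra. }
  destruct Hd as (d & Hd & Hd').
  pose (s := Rmin t (c + d / 2)).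
  assert (s <= t) by apply Rmin_l.
  assert (s <= c + d / 2) by apply Rmin_r.
  assert (c < s) by (apply Rmin_glb_lt; lra).
  assert (s <= c); [|lra].
  apply Hub; split; [lra|]; intros r Hr0.
  destruct (Rlt_le_dec r c); [apply Hbelow; lra|].
  destruct (Req_dec r c) as [-> | Hrc]; [assumption|].
  specialize (Hd' r ltac:(lra)); apply Rabs_def2 in Hd'; lra.
Qed.

Lemma taylor_box_lipschitz (f f1 f2 : R -> R -> R -> R) :
  taylor_box f f1 f2 ->
  forall M ta tb, 0 < ta -> exists L, 0 < L /\
  forall t x y x' y', ta <= t <= tb ->
    Rabs x <= M -> Rabs y <= M -> Rabs x' <= M -> Rabs y' <= M ->
    Rabs (f x' y' t - f x y t) <= L * (Rabs (x' - x) + Rabs (y' - y)).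
Proof.
  intros Hf M ta tb Hta; destruct (Hf M ta tb Hta) as (C & HC & HC').
  exists (C * (1 + 4 * Rabs M)); split.
  { assert (0 <= Rabs M) by apply Rabs_pos; nra. }
  intros t x y x' y' Ht Hx Hy Hx' Hy'.
  destruct (HC' t x y x' y' Ht Hx Hy Hx' Hy') as (A1 & A2 & A3).
  replace (f x' y' t - f x y t) with
    ((f x' y' t - f x y t - f1 x y t * (x' - x) - f2 x y t * (y' - y))
      + (f1 x y t * (x' - x) + f2 x y t * (y' - y))) by ring.
  eapply Rle_trans; [apply Rabs_triang|].
  assert (A4 := Rabs_triang (f1 x y t * (x' - x)) (f2 x y t * (y' - y))).
  rewrite !Rabs_mult in A4.
  assert (P1 := Rabs_pos (x' - x)); assert (P2 := Rabs_pos (y' - y)).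
  assert (Hd : Rabs (x' - x) + Rabs (y' - y) <= 4 * Rabs M).
  { assert (B1 := Rabs_triang x' (- x)); assert (B2 := Rabs_triang y' (- y)).
    rewrite Rabs_Ropp in B1, B2. unfold Rminus.
    assert (B3 := Rle_abs M). lra. }
  set (d := Rabs (x' - x)) in *; set (e := Rabs (y' - y)) in *.
  assert (Rabs (f1 x y t) * d <= C * d) by (apply Rmult_le_compat_r; assumption).
  assert (Rabs (f2 x y t) * e <= C * e) by (apply Rmult_le_compat_r; assumption).
  assert (C * (d + e) ^ 2 <= C * (4 * Rabs M * (d + e))).
  { apply Rmult_le_compat_l; [lra|]. simpl; rewrite Rmult_1_r.
    apply Rmult_le_compat_r; lra. }
  lra.
Qed.

Section Deviation.

Variables f g f1 f2 g1 g2 : R -> R -> R -> R.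
Hypothesis f_taylor : taylor_box f f1 f2.
Hypothesis g_taylor : taylor_box g g1 g2.
Hypothesis f_cont : continuous_along_curves f.
Hypothesis g_cont : continuous_along_curves g.

Variables (T : R) (xs ys : R -> R).
Hypothesis T_pos : 0 <= T.
Hypothesis xs_sol : forall t, T < t -> is_derive xs t (f (xs t) (ys t) t).
Hypothesis ys_sol : forall t, T < t -> is_derive ys t (g (xs t) (ys t) t).

(** The equation is only required inside the unit tube, so that solutions of the
    system and of its modification outside the tube satisfy it alike. *)
Definition deviation (t0 : R) (u v : R -> R) : Prop :=
  (forall t, t0 < t -> continuous u t /\ continuous v t) /\
  filterlim u (at_right t0) (locally (u t0)) /\
  filterlim v (at_right t0) (locally (v t0)) /\
  forall t, t0 < t -> Rabs (u t) <= 1 -> Rabs (v t) <= 1 ->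
    is_derive u t (f (xs t + u t) (ys t + v t) t - f (xs t) (ys t) t) /\
    is_derive v t (g (xs t + u t) (ys t + v t) t - g (xs t) (ys t) t).

Lemma deviation_later t0 t1 u v :
  t0 <= t1 -> deviation t0 u v -> deviation t1 u v.
Proof.
  intros Ht (Hc & Lu & Lv & Hd).
  destruct (Req_dec t0 t1) as [<- | Hne]; [repeat split; try assumption; apply Hc || apply Hd; assumption|].
  split; [intros t Ht'; apply Hc; lra|].
  split; [apply right_limit_of_continuous, (Hc t1); lra|].
  split; [apply right_limit_of_continuous, (Hc t1); lra|].
  intros t Ht'; apply Hd; lra.
Qed.

Lemma xs_ys_bounded t0 t1 : T < t0 -> exists M, 0 < M /\ forall t, t0 <= t <= t1 ->
  Rabs (xs t) <= M /\ Rabs (ys t) <= M.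
Proof.
  intros Ht0.
  destruct (continuous_bounded_interval xs t0 t1) as (M1 & HM1 & H1).
  { intros t Ht; apply (is_derive_continuous _ _ _ (xs_sol t ltac:(lra))). }
  destruct (continuous_bounded_interval ys t0 t1) as (M2 & HM2 & H2).
  { intros t Ht; apply (is_derive_continuous _ _ _ (ys_sol t ltac:(lra))). }
  exists (M1 + M2); split; [lra|]; intros t Ht; specialize (H1 t Ht); specialize (H2 t Ht); lra.
Qed.

Lemma tube_lipschitz t0 t1 : T < t0 -> exists L, 0 < L /\
  forall t u v u' v', t0 <= t <= t1 -> Rabs u <= 1 -> Rabs v <= 1 -> Rabs u' <= 1 -> Rabs v' <= 1 ->
    Rabs (f (xs t + u') (ys t + v') t - f (xs t + u) (ys t + v) t)
      <= L * (Rabs (u' - u) + Rabs (v' - v)) /\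
    Rabs (g (xs t + u') (ys t + v') t - g (xs t + u) (ys t + v) t)
      <= L * (Rabs (u' - u) + Rabs (v' - v)).
Proof.
  intros Ht0.
  destruct (xs_ys_bounded t0 t1 Ht0) as (M & HM & HM').
  destruct (taylor_box_lipschitz f f1 f2 f_taylor (M + 1) t0 t1) as (L1 & HL1 & H1); [lra|].
  destruct (taylor_box_lipschitz g g1 g2 g_taylor (M + 1) t0 t1) as (L2 & HL2 & H2); [lra|].
  exists (L1 + L2); split; [lra|].
  intros t u v u' v' Ht Hu Hv Hu' Hv'.
  destruct (HM' t Ht) as [Bx By].
  assert (Hsum : forall a b, Rabs a <= M -> Rabs b <= 1 -> Rabs (a + b) <= M + 1).
  { intros a b Ha Hb; eapply Rle_trans; [apply Rabs_triang | lra]. }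
  specialize (H1 t (xs t + u) (ys t + v) (xs t + u') (ys t + v') Ht
    (Hsum _ _ Bx Hu) (Hsum _ _ By Hv) (Hsum _ _ Bx Hu') (Hsum _ _ By Hv')).
  specialize (H2 t (xs t + u) (ys t + v) (xs t + u') (ys t + v') Ht
    (Hsum _ _ Bx Hu) (Hsum _ _ By Hv) (Hsum _ _ Bx Hu') (Hsum _ _ By Hv')).
  replace (xs t + u' - (xs t + u)) with (u' - u) in * by ring.
  replace (ys t + v' - (ys t + v)) with (v' - v) in * by ring.
  assert (0 <= Rabs (u' - u) + Rabs (v' - v)).
  { apply Rplus_le_le_0_compat; apply Rabs_pos. }
  split; nra.
Qed.

Lemma sq_le_1 u v : u ^ 2 + v ^ 2 <= 1 -> Rabs u <= 1 /\ Rabs v <= 1.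
Proof. intros H; split; apply Rabs_le; nra. Qed.

Lemma deviation_finite_time t0 t1 eps : T < t0 -> t0 <= t1 -> 0 < eps ->
  exists delta, 0 < delta /\ forall u v, deviation t0 u v ->
    Rabs (u t0) < delta -> Rabs (v t0) < delta ->
    forall t, t0 <= t <= t1 -> Rabs (u t) < eps /\ Rabs (v t) < eps.
Proof.
  intros Ht0 Ht1 Heps.
  destruct (tube_lipschitz t0 t1 Ht0) as (L & HL & Hlip).
  pose (e := Rmin eps 1).
  assert (He : 0 < e) by (apply Rmin_glb_lt; lra).
  assert (He1 : e <= 1) by apply Rmin_r.
  assert (Hee : e <= eps) by apply Rmin_l.
  pose (K := exp (4 * L * (t1 - t0))).
  assert (HK : 1 <= K) by (apply exp_ge_1; nra).
  exists (e / (2 * K)); split; [apply Rdiv_lt_0_compat; lra|].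
  intros u v (Hc & Lu & Lv & Hd) Hu0 Hv0.
  pose (N := fun t => u t * u t + v t * v t).
  assert (Hsq : forall x, Rabs x < e / (2 * K) -> x * x * K < e * e / 4).
  { intros x Hx. assert (Hx2 : Rabs x * Rabs x < (e / (2 * K)) * (e / (2 * K))).
    { apply Rmult_le_0_lt_compat; try apply Rabs_pos; assumption. }
    rewrite <- Rabs_mult, Rabs_pos_eq in Hx2 by nra.
    assert (x * x * K < e / (2 * K) * (e / (2 * K)) * K) by (apply Rmult_lt_compat_r; lra).
    replace (e / (2 * K) * (e / (2 * K)) * K) with (e * e / 4 * / K) in H by (field; lra).
    assert (/ K <= 1) by (rewrite <- Rinv_1; apply Rinv_le_contravar; lra).
    assert (e * e / 4 * / K <= e * e / 4 * 1) by (apply Rmult_le_compat_l; nra). lra. }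
  assert (HN0K : N t0 * K < e * e).
  { unfold N; rewrite Rmult_plus_distr_r. specialize (Hsq (u t0) Hu0) as S1.
    specialize (Hsq (v t0) Hv0) as S2. nra. }
  assert (HN0 : 0 <= N t0) by (unfold N; nra).
  assert (HN : forall t, t0 <= t <= t1 -> N t < e * e).
  { apply continuous_induction.
    - apply filterlim_Rplus; apply filterlim_Rmult; assumption.
    - intros t Ht; destruct (Hc t ltac:(lra)) as [Cu Cv].
      apply (filterlim_Rplus (U := locally t)); apply (filterlim_Rmult (U := locally t)); assumption.
    - nra.
    - intros t Ht Hbelow.
      assert (Htube : forall s, t0 <= s <= t -> Rabs (u s) <= 1 /\ Rabs (v s) <= 1).
      { intros s Hs; apply sq_le_1; specialize (Hbelow s Hs); unfold N in Hbelow; nra. }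
      assert (Hgr : N t <= N t0 * exp (4 * L * (t - t0))).
      { apply (gronwall_squares u v
          (fun s => f (xs s + u s) (ys s + v s) s - f (xs s) (ys s) s)
          (fun s => g (xs s + u s) (ys s + v s) s - g (xs s) (ys s) s)); try assumption; try lra.
        - intros s Hs; destruct (Htube s ltac:(lra)); apply Hd; lra.
        - intros s Hs; destruct (Htube s ltac:(lra)) as [B1 B2].
          assert (R0 : Rabs 0 <= 1) by (rewrite Rabs_R0; lra).
          destruct (Hlip s 0 0 (u s) (v s) ltac:(lra) R0 R0 B1 B2) as [K1 K2].
          rewrite !Rplus_0_r, !Rminus_0_r in K1, K2; split; assumption. }
      eapply Rle_lt_trans; [exact Hgr|]. eapply Rle_lt_trans; [|exact HN0K].
      apply Rmult_le_compat_l; [assumption|].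
      unfold K; destruct (Req_dec t t1) as [-> | Hne]; [lra|].
      left; apply exp_increasing; nra. }
  intros t Ht; specialize (HN t Ht); unfold N in HN.
  assert (e * e <= eps * eps) by nra.
  split; apply Rabs_def1; nra.
Qed.

(** Composing the field with this retraction of the tube makes it globally
    Lipschitz without changing it inside. *)
Definition clip (x : R) : R := Rmax (-1) (Rmin 1 x).

Lemma clip_bounded x : Rabs (clip x) <= 1.
Proof. unfold clip, Rmax, Rmin; apply Rabs_le; destruct (Rle_dec 1 x); destruct Rle_dec; lra. Qed.

Lemma clip_id x : Rabs x <= 1 -> clip x = x.
Proof.
  intros Hx; apply Rabs_le_between in Hx.
  unfold clip, Rmax, Rmin; destruct (Rle_dec 1 x); destruct Rle_dec; lra.
Qed.

Lemma clip_lipschitz x y : Rabs (clip x - clip y) <= Rabs (x - y).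
Proof.
  unfold clip, Rmax, Rmin.
  repeat destruct Rle_dec; unfold Rabs; repeat destruct Rcase_abs; lra.
Qed.

Lemma continuous_clip (h : R -> R) t : continuous h t -> continuous (fun s => clip (h s)) t.
Proof.
  intros Hh; apply continuous_of_small; intros eps He.
  generalize (continuous_small h t eps Hh He); apply filter_imp; intros s Hs.
  eapply Rle_lt_trans; [apply clip_lipschitz | exact Hs].
Qed.

Lemma deviation_exists t0 u0 v0 : T < t0 ->
  exists u v, u t0 = u0 /\ v t0 = v0 /\ deviation t0 u v.
Proof.
  intros Ht0.
  pose (field := fun (h : R -> R -> R -> R) (u v t : R) =>
    h (xs (Rmax t0 t) + clip u) (ys (Rmax t0 t) + clip v) (Rmax t0 t)
    - h (xs (Rmax t0 t)) (ys (Rmax t0 t)) (Rmax t0 t)).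
  assert (Hcont : forall h, continuous_along_curves h -> forall u v : R -> R,
    (forall t, continuous u t) -> (forall t, continuous v t) ->
    forall t, continuous (fun s => field h (u s) (v s) s) t).
  { intros h Hh u v Hu Hv t.
    assert (Hm : T < Rmax t0 t) by (eapply Rlt_le_trans; [apply Ht0 | apply Rmax_l]).
    assert (Cm : continuous (Rmax t0) t) by apply continuous_Rmax.
    assert (Cx : continuous (fun s => xs (Rmax t0 s)) t).
    { apply continuous_comp; [assumption|]. apply (is_derive_continuous _ _ _ (xs_sol _ Hm)). }
    assert (Cy : continuous (fun s => ys (Rmax t0 s)) t).
    { apply continuous_comp; [assumption|]. apply (is_derive_continuous _ _ _ (ys_sol _ Hm)). }
    apply (filterlim_Rminus (U := locally t)).
    - apply (Hh (fun s => xs (Rmax t0 s) + clip (u s)) (fun s => ys (Rmax t0 s) + clip (v s)) (Rmax t0) t);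
      [lra | | | assumption];
      apply (filterlim_Rplus (U := locally t)); try assumption; apply continuous_clip; auto.
    - apply (Hh (fun s => xs (Rmax t0 s)) (fun s => ys (Rmax t0 s)) (Rmax t0) t);
      [lra | assumption ..]. }
  destruct (picard_lindelof (field f) (field g) t0 u0 v0) as (u & v & E1 & E2 & Cu & Cv & D).
  - apply Hcont, f_cont.
  - apply Hcont, g_cont.
  - intros b; destruct (tube_lipschitz t0 b Ht0) as (L & HL & Hlip).
    exists L; split; [assumption|].
    intros t u v u' v' Ht; unfold field; rewrite Rmax_right by lra.
    destruct (Hlip t (clip u') (clip v') (clip u) (clip v) Ht
      (clip_bounded _) (clip_bounded _) (clip_bounded _) (clip_bounded _)) as [K1 K2].
    assert (Hc : L * (Rabs (clip u - clip u') + Rabs (clip v - clip v')) <= L * (Rabs (u - u') + Rabs (v - v'))).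
    { apply Rmult_le_compat_l; [lra|]; apply Rplus_le_compat; apply clip_lipschitz. }
    assert (Hsub : forall a b c, a - c - (b - c) = a - b) by (intros; ring).
    rewrite !Hsub.
    split; [eapply Rle_trans; [exact K1 | exact Hc] | eapply Rle_trans; [exact K2 | exact Hc]].
  - exists u, v; split; [assumption|]; split; [assumption|].
    split; [intros t _; split; auto|].
    split; [apply right_limit_of_continuous, Cu|].
    split; [apply right_limit_of_continuous, Cv|].
    intros t Ht Bu Bv; destruct (D t Ht) as [D1 D2]; unfold field in D1, D2.
    rewrite Rmax_right, !clip_id in D1, D2 by (assumption || lra).
    split; assumption.
Qed.

Definition attracting_tube : Prop :=
  exists t1, T < t1 /\ forall t2 eps, t1 <= t2 -> 0 < eps ->
  exists delta, 0 < delta /\ forall u v, deviation t2 u v ->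
    Rabs (u t2) < delta -> Rabs (v t2) < delta ->
    forall t, t2 <= t -> Rabs (u t) < eps /\ Rabs (v t) < eps.

Lemma deviation_stable : attracting_tube ->
  forall t0 eps, T < t0 -> 0 < eps ->
  exists delta, 0 < delta /\ forall u v, deviation t0 u v ->
    Rabs (u t0) < delta -> Rabs (v t0) < delta ->
    forall t, t0 <= t -> Rabs (u t) < eps /\ Rabs (v t) < eps.
Proof.
  intros (t1 & Ht1 & Htube) t0 eps Ht0 Heps.
  pose (t2 := Rmax t0 t1).
  assert (H02 : t0 <= t2) by apply Rmax_l.
  assert (H12 : t1 <= t2) by apply Rmax_r.
  destruct (Htube t2 eps H12 Heps) as (d2 & Hd2 & H2).
  destruct (deviation_finite_time t0 t2 (Rmin eps d2) Ht0 H02) as (d & Hd & H1).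
  { apply Rmin_glb_lt; assumption. }
  assert (Rmin eps d2 <= eps) by apply Rmin_l.
  assert (Rmin eps d2 <= d2) by apply Rmin_r.
  exists d; split; [assumption|].
  intros u v Huv Hu Hv t Ht.
  specialize (H1 u v Huv Hu Hv).
  destruct (Rle_lt_dec t t2) as [Hle | Hgt].
  - destruct (H1 t ltac:(lra)); lra.
  - destruct (H1 t2 ltac:(lra)) as [B1 B2].
    apply (H2 u v (deviation_later _ _ _ _ H02 Huv)); lra.
Qed.

End Deviation.

Lemma dist2_small x y x' y' d : dist2 x y x' y' < d -> Rabs (x - x') < d /\ Rabs (y - y') < d.
Proof.
  unfold dist2; intros Hd.
  assert (Hp := sqrt_pos ((x - x') ^ 2 + (y - y') ^ 2)).
  assert (P1 := pow2_ge_0 (x - x')); assert (P2 := pow2_ge_0 (y - y')).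
  assert (Hs := sqrt_sqrt ((x - x') ^ 2 + (y - y') ^ 2) ltac:(lra)).
  set (s := sqrt _) in *.
  split; apply Rabs_def1; nra.
Qed.

Lemma dist2_of_small x y x' y' e :
  Rabs (x - x') < e -> Rabs (y - y') < e -> dist2 x y x' y' < 2 * e.
Proof.
  unfold dist2; intros Hx Hy.
  assert (He : 0 < e) by (eapply Rle_lt_trans; [apply Rabs_pos | exact Hx]).
  apply Rabs_def2 in Hx, Hy.
  rewrite <- (sqrt_pow2 (2 * e)) by lra.
  apply sqrt_lt_1_alt; split; [|nra].
  assert (P1 := pow2_ge_0 (x - x')); assert (P2 := pow2_ge_0 (y - y')); lra.
Qed.

(** Lyapunov stability of a solution follows from trapping its deviations on a
    half-line: on the remaining bounded time interval the flow is continuous, and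
    nearby solutions exist because they solve a globally Lipschitz system. *)
Lemma stable_of_attracting_tube (H F G : R -> R -> R -> R) (lam T : R) (xs ys : R -> R)
    (f1 f2 g1 g2 : R -> R -> R -> R) :
  taylor_box (fun x y t => d2_3 H x y lam + F x y t) f1 f2 ->
  taylor_box (fun x y t => - d1_3 H x y lam + G x y t) g1 g2 ->
  continuous_along_curves (fun x y t => d2_3 H x y lam + F x y t) ->
  continuous_along_curves (fun x y t => - d1_3 H x y lam + G x y t) ->
  0 <= T -> solution_after H F G lam T xs ys ->
  attracting_tube (fun x y t => d2_3 H x y lam + F x y t)
    (fun x y t => - d1_3 H x y lam + G x y t) T xs ys ->
  lyapunov_stable H F G lam T xs ys.
Proof.
  intros Tf Tg Cf Cg HT Hsol Htube t0 eps Ht0 Heps.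
  set (f := fun x y t => d2_3 H x y lam + F x y t) in *.
  set (g := fun x y t => - d1_3 H x y lam + G x y t) in *.
  assert (Sx : forall t, T < t -> is_derive xs t (f (xs t) (ys t) t)) by apply Hsol.
  assert (Sy : forall t, T < t -> is_derive ys t (g (xs t) (ys t) t)) by apply Hsol.
  pose (e := Rmin (eps / 2) (1 / 2)).
  assert (He : 0 < e) by (apply Rmin_glb_lt; lra).
  assert (He1 : e <= 1 / 2) by apply Rmin_r.
  assert (He2 : e <= eps / 2) by apply Rmin_l.
  destruct (deviation_stable f g f1 f2 g1 g2 Tf Tg T xs ys HT Sx Sy Htube t0 e Ht0 He)
    as (d & Hd & Hstay).
  exists d; split; [assumption|].
  intros x0 y0 H0; apply dist2_small in H0.
  split.
  - destruct (deviation_exists f g f1 f2 g1 g2 Tf Tg Cf Cg T xs ys HT Sx Sy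
      t0 (x0 - xs t0) (y0 - ys t0) Ht0) as (u & v & E1 & E2 & Huv).
    assert (Hs := Hstay u v Huv); rewrite E1, E2 in Hs.
    specialize (Hs (proj1 H0) (proj2 H0)).
    destruct Huv as (Hc & Lu & Lv & Hder).
    exists (fun t => xs t + u t), (fun t => ys t + v t).
    split; [rewrite E1; ring|]. split; [rewrite E2; ring|].
    split; [|split].
    + replace x0 with (xs t0 + u t0) by (rewrite E1; ring).
      apply filterlim_Rplus; [|assumption].
      eapply right_limit_of_continuous, is_derive_continuous, Sx; assumption.
    + replace y0 with (ys t0 + v t0) by (rewrite E2; ring).
      apply filterlim_Rplus; [|assumption].
      eapply right_limit_of_continuous, is_derive_continuous, Sy; assumption.
    + intros t Ht; destruct (Hs t ltac:(lra)) as [B1 B2].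
      destruct (Hder t Ht ltac:(lra) ltac:(lra)) as [D1 D2].
      split.
      * change (is_derive (fun t => xs t + u t) t (f (xs t + u t) (ys t + v t) t)).
        replace (f (xs t + u t) (ys t + v t) t) with
          (f (xs t) (ys t) t + (f (xs t + u t) (ys t + v t) t - f (xs t) (ys t) t)) by ring.
        apply is_derive_Rplus; [apply Sx; lra | assumption].
      * change (is_derive (fun t => ys t + v t) t (g (xs t + u t) (ys t + v t) t)).
        replace (g (xs t + u t) (ys t + v t) t) with
          (g (xs t) (ys t) t + (g (xs t + u t) (ys t + v t) t - g (xs t) (ys t) t)) by ring.
        apply is_derive_Rplus; [apply Sy; lra | assumption].
  - intros x y (X0 & Y0 & Lx & Ly & Hxy) t Ht.
    assert (Hdev : deviation f g xs ys t0 (fun t => x t - xs t) (fun t => y t - ys t)).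
    { assert (Hder : forall s, t0 < s ->
        is_derive (fun t => x t - xs t) s (f (x s) (y s) s - f (xs s) (ys s) s) /\
        is_derive (fun t => y t - ys t) s (g (x s) (y s) s - g (xs s) (ys s) s)).
      { intros s Hs; destruct (Hxy s Hs) as [D1 D2]; split; apply is_derive_Rminus;
        [exact D1 | apply Sx; lra | exact D2 | apply Sy; lra]. }
      split; [|split; [|split]].
      - intros s Hs; destruct (Hder s Hs) as [D1 D2].
        split; eapply is_derive_continuous; eassumption.
      - apply filterlim_Rminus; [rewrite X0; assumption|].
        eapply right_limit_of_continuous, is_derive_continuous, Sx; assumption.
      - apply filterlim_Rminus; [rewrite Y0; assumption|].
        eapply right_limit_of_continuous, is_derive_continuous, Sy; assumption.
      - intros s Hs _ _.
        replace (xs s + (x s - xs s)) with (x s) by ring.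
        replace (ys s + (y s - ys s)) with (y s) by ring.
        apply Hder; assumption. }
    destruct (Hstay _ _ Hdev) with (t := t) as [B1 B2]; cbv beta.
    + rewrite X0; apply H0.
    + rewrite Y0; apply H0.
    + assumption.
    + eapply Rlt_le_trans; [apply dist2_of_small; eassumption | lra].
Qed.

(** * Powers of t and asymptotic expansions *)

Lemma Rpower_pos t a : 0 < Rpower t a.
Proof. apply exp_pos. Qed.

Lemma Rpower_neg_lim a : 0 < a -> is_lim (fun t => Rpower t (- a)) p_infty 0.
Proof.
  intros Ha; unfold Rpower.
  apply (is_lim_comp exp (fun t => - a * ln t) p_infty 0 m_infty).
  - apply is_lim_exp_m.
  - replace m_infty with (Rbar_mult (- a) p_infty).
    2:{ cbn. destruct Rle_dec; [exfalso; lra|]. reflexivity. }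
    apply is_lim_scal_l, is_lim_ln_p.
  - exists 0; intros; discriminate.
Qed.

Lemma sum_n_m_single (c : nat -> R) k0 n : (k0 <= n)%nat ->
  (forall k, (k0 <= k < n)%nat -> c k = 0) -> sum_n_m c k0 n = c n.
Proof.
  intros Hn Hc; destruct n as [|n].
  - replace k0 with O by lia. apply sum_n_n.
  - rewrite sum_n_Sm by assumption.
    rewrite (sum_n_m_ext_loc _ (fun _ => zero)).
    + rewrite sum_n_m_const_zero; apply plus_zero_l.
    + intros k Hk; apply Hc; lia.
Qed.

Section PowerSums.

Variables (p k0 : nat) (a : nat -> R).
Hypothesis p_pos : (0 < p)%nat.

Definition power_sum (N : nat) (t : R) : R :=
  sum_n_m (fun k => Rpower t (- (INR k / INR p)) * a k) k0 N.

Lemma power_sum_single (t : R) : power_sum k0 t = Rpower t (- (INR k0 / INR p)) * a k0.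
Proof. unfold power_sum; rewrite sum_n_n; reflexivity. Qed.

Lemma power_sum_S N t : (k0 <= N)%nat ->
  power_sum (S N) t = power_sum N t + Rpower t (- (INR (S N) / INR p)) * a (S N).
Proof. clear p_pos; intros HN; unfold power_sum; rewrite sum_n_Sm by lia; reflexivity. Qed.

Lemma power_sum_leading N : (k0 <= N)%nat ->
  is_lim (fun t => Rpower t (INR k0 / INR p) * power_sum N t) p_infty (a k0).
Proof.
  assert (Hp : 0 < INR p) by (apply lt_0_INR; assumption).
  induction 1 as [|N HN IH].
  - apply (is_lim_ext (fun _ => a k0)); [|apply is_lim_const].
    intros t; rewrite power_sum_single, <- Rmult_assoc, <- Rpower_plus.
    rewrite Rplus_opp_r; unfold Rpower; rewrite Rmult_0_l, exp_0; ring.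
  - apply (is_lim_ext (fun t => Rpower t (INR k0 / INR p) * power_sum N t
       + Rpower t (- ((INR (S N) - INR k0) / INR p)) * a (S N))).
    { intros t; rewrite power_sum_S, Rmult_plus_distr_l, <- Rmult_assoc, <- Rpower_plus by assumption.
      do 3 f_equal; field; lra. }
    replace (a k0) with (a k0 + 0 * a (S N)) by ring.
    apply is_lim_plus'; [exact IH|].
    apply (is_lim_scal_r _ (a (S N)) p_infty 0), Rpower_neg_lim.
    apply Rdiv_lt_0_compat; [|assumption].
    assert (INR k0 < INR (S N)) by (apply lt_INR; lia); lra.
Qed.

End PowerSums.

Lemma power_sum_derive p k0 a N t : (k0 <= N)%nat -> 0 < t ->
  is_derive (power_sum p k0 a N) t
    (/ t * power_sum p k0 (fun k => - (INR k / INR p) * a k) N t).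
Proof.
  intros HN Ht.
  assert (H1 : forall k, is_derive (fun t => Rpower t (- (INR k / INR p)) * a k) t
     (/ t * (Rpower t (- (INR k / INR p)) * (- (INR k / INR p) * a k)))).
  { intros k; generalize (INR k / INR p); intros e; unfold Rpower; auto_derive; [lra | field; lra]. }
  induction HN as [|N HN IH].
  - apply (is_derive_ext (fun t => Rpower t (- (INR k0 / INR p)) * a k0)).
    { intros; symmetry; apply power_sum_single. }
    rewrite power_sum_single; apply H1.
  - apply (is_derive_ext (fun t => power_sum p k0 a N t + Rpower t (- (INR (S N) / INR p)) * a (S N))).
    { intros; symmetry; apply power_sum_S; assumption. }
    rewrite power_sum_S, Rmult_plus_distr_l by assumption.
    apply is_derive_Rplus; [exact IH | apply H1].
Qed.

Section Filters.
Context {T : Type} {U : (T -> Prop) -> Prop} {FU : Filter U}.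

Lemma filterlim_eps (f : T -> R) (l : R) :
  filterlim f U (locally l) <-> forall eps, 0 < eps -> U (fun p => Rabs (f p - l) < eps).
Proof.
  split.
  - intros Hf eps He; apply (Hf (fun r => Rabs (r - l) < eps)).
    exists (mkposreal _ He); intros r Hr; exact Hr.
  - intros Hf P [e HP]. generalize (Hf e (cond_pos e)).
    unfold filtermap; apply filter_imp; intros p Hp; apply HP; exact Hp.
Qed.

Lemma filterlim_squeeze_0 (f g : T -> R) :
  U (fun p => Rabs (f p) <= g p) -> filterlim g U (locally 0) -> filterlim f U (locally 0).
Proof.
  intros Hfg Hg; apply filterlim_eps; intros eps He.
  generalize (filter_and _ _ Hfg (proj1 (filterlim_eps g 0) Hg eps He)).
  apply filter_imp; intros p [H1 H2].
  rewrite Rminus_0_r in *; apply Rabs_def2 in H2; lra.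
Qed.

Lemma vanishing_Rabs (f : T -> R) :
  filterlim f U (locally 0) -> filterlim (fun p => Rabs (f p)) U (locally 0).
Proof.
  intros Hf; apply filterlim_eps; intros eps He.
  generalize (proj1 (filterlim_eps f 0) Hf eps He).
  apply filter_imp; intros p Hp; rewrite Rminus_0_r in *; rewrite Rabs_Rabsolu; exact Hp.
Qed.

Lemma filterlim_eq (f g : T -> R) (l : R) :
  U (fun p => f p = g p) -> filterlim f U (locally l) -> filterlim g U (locally l).
Proof.
  intros Hfg Hf; apply filterlim_eps; intros eps He.
  generalize (filter_and _ _ Hfg (proj1 (filterlim_eps f l) Hf eps He)).
  apply filter_imp; intros p [<- H]; exact H.
Qed.

Lemma filterlim_Rmult_0 (f g : T -> R) (l : R) :
  filterlim f U (locally 0) -> filterlim g U (locally l) ->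
  filterlim (fun p => f p * g p) U (locally 0).
Proof.
  intros Hf Hg; rewrite <- (Rmult_0_l l); apply filterlim_Rmult; assumption.
Qed.

Lemma filterlim_Rplus_0 (f g : T -> R) :
  filterlim f U (locally 0) -> filterlim g U (locally 0) ->
  filterlim (fun p => f p + g p) U (locally 0).
Proof.
  intros Hf Hg; replace 0 with (0 + 0) by ring; apply filterlim_Rplus; assumption.
Qed.

(** Stated along an arbitrary filter, for it serves both the intermediate points
    of the mean value theorem and all points near the origin. *)
Lemma expansion_leading (q n : nat) (f : R -> R -> R -> R) (fk : nat -> R -> R -> R)
    (t x y : T -> R) :
  (1 <= n)%nat -> power_expansion q f fk ->
  (forall k x y, (1 <= k < n)%nat -> fk k x y = 0) ->
  continuity_2d_pt (fk n) 0 0 ->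
  filterlim t U (Rbar_locally p_infty) ->
  filterlim x U (locally 0) -> filterlim y U (locally 0) ->
  filterlim (fun p => Rpower (t p) (INR n / INR q) * f (x p) (y p) (t p)) U (locally (fk n 0 0)).
Proof.
  intros Hn Hexp Hz Hc Ht Hx Hy; apply filterlim_eps; intros eps He.
  assert (He2 : 0 < eps / 2) by lra.
  destruct (Hexp n 1 (eps / 2) He2) as [t1 Hexp1].
  destruct (Hc (mkposreal _ He2)) as [d Hd].
  assert (Hm : 0 < Rmin d 1) by (apply Rmin_glb_lt; [apply cond_pos | lra]).
  assert (Ht1 : U (fun p => t1 < t p)) by (apply (Ht (fun s => t1 < s)); exists t1; auto).
  generalize (filter_and _ _ (proj1 (filterlim_eps x 0) Hx _ Hm)
    (filter_and _ _ (proj1 (filterlim_eps y 0) Hy _ Hm)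
      Ht1)).
  apply filter_imp; intros p (H1 & H2 & H3).
  assert (M1 : Rmin d 1 <= d) by apply Rmin_l.
  assert (M2 : Rmin d 1 <= 1) by apply Rmin_r.
  assert (A1 : Rabs (fk n (x p) (y p) - fk n 0 0) < eps / 2) by (apply Hd; lra).
  rewrite !Rminus_0_r in *.
  specialize (Hexp1 (x p) (y p) (t p) ltac:(lra) ltac:(lra) H3).
  rewrite sum_n_m_single in Hexp1; [|assumption|].
  2:{ intros k Hk; rewrite Hz by assumption; ring. }
  rewrite Rmult_minus_distr_l, <- Rmult_assoc, <- Rpower_plus, Rplus_opp_r in Hexp1.
  replace (Rpower (t p) 0) with 1 in Hexp1 by (unfold Rpower; rewrite Rmult_0_l, exp_0; reflexivity).
  rewrite Rmult_1_l in Hexp1.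
  match goal with |- Rabs (?a - ?c) < _ =>
    replace (a - c) with ((a - fk n (x p) (y p)) + (fk n (x p) (y p) - c)) by ring end.
  eapply Rle_lt_trans; [apply Rabs_triang|]. lra.
Qed.

End Filters.

(** Each term is Lipschitz at the origin, those below order [n] vanish, and the
    power of [t] in the term of order [n] dominates the later ones. *)
Lemma power_sum_lipschitz_at_0 (q n N : nat) (h : nat -> R -> R -> R) :
  (0 < q)%nat ->
  (forall k x y, (1 <= k < n)%nat -> h k x y = 0) ->
  (forall k, (1 <= k)%nat -> exists K r, 0 < r /\ forall x y, Rabs x <= r -> Rabs y <= r ->
     Rabs (h k x y - h k 0 0) <= K * (Rabs x + Rabs y)) ->
  exists K r, 0 <= K /\ 0 < r /\ forall t x y, 1 <= t -> Rabs x <= r -> Rabs y <= r ->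
    Rabs (power_sum q 1 (fun k => h k x y) N t - power_sum q 1 (fun k => h k 0 0) N t)
      <= K * Rpower t (- (INR n / INR q)) * (Rabs x + Rabs y).
Proof.
  intros Hq Hz Hl.
  assert (Hq' : 0 < INR q) by (apply lt_0_INR; assumption).
  induction N as [|N IH].
  - exists 0, 1; split; [lra|]; split; [lra|].
    intros t x y Ht Hx Hy; unfold power_sum; rewrite !sum_n_m_zero by lia.
    rewrite Rminus_diag, Rabs_R0, !Rmult_0_l; lra.
  - destruct IH as (K & r & HK & Hr & IH).
    destruct (Hl (S N) ltac:(lia)) as (K' & r' & Hr' & H').
    exists (K + Rabs K'), (Rmin r r'); split; [|split].
    + assert (0 <= Rabs K') by apply Rabs_pos; lra.
    + apply Rmin_glb_lt; assumption.
    + intros t x y Ht Hx Hy.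
      assert (M1 : Rmin r r' <= r) by apply Rmin_l.
      assert (M2 : Rmin r r' <= r') by apply Rmin_r.
      specialize (IH t x y Ht ltac:(lra) ltac:(lra)).
      specialize (H' x y ltac:(lra) ltac:(lra)).
      assert (E : forall c, power_sum q 1 c (S N) t
         = power_sum q 1 c N t + Rpower t (- (INR (S N) / INR q)) * c (S N)).
      { intros c; destruct N; [|apply power_sum_S; lia].
        unfold power_sum; rewrite sum_n_n, sum_n_m_zero by lia; unfold zero; cbn; ring. }
      rewrite !E.
      set (S1 := power_sum _ _ _ _ _) in *; set (S2 := power_sum _ _ (fun k => h k 0 0) _ _) in *.
      replace (S1 + Rpower t (- (INR (S N) / INR q)) * h (S N) x y
        - (S2 + Rpower t (- (INR (S N) / INR q)) * h (S N) 0 0))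
        with ((S1 - S2) + Rpower t (- (INR (S N) / INR q)) * (h (S N) x y - h (S N) 0 0)) by ring.
      eapply Rle_trans; [apply Rabs_triang|].
      rewrite !Rmult_plus_distr_r; apply Rplus_le_compat; [exact IH|].
      assert (P0 : 0 <= Rabs x + Rabs y) by (apply Rplus_le_le_0_compat; apply Rabs_pos).
      assert (Q0 := Rpower_pos t (- (INR n / INR q))).
      destruct (Nat.lt_ge_cases (S N) n) as [Hlt | Hge].
      * rewrite !Hz by lia. rewrite Rminus_diag, Rmult_0_r, Rabs_R0.
        apply Rmult_le_pos; [apply Rmult_le_pos; [apply Rabs_pos | lra] | assumption].
      * rewrite Rabs_mult, Rabs_pos_eq by (left; apply Rpower_pos).
        rewrite (Rmult_comm (Rabs K')), Rmult_assoc.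
        apply Rmult_le_compat; [left; apply Rpower_pos | apply Rabs_pos | |].
        -- apply Rle_Rpower; [assumption|]. apply Ropp_le_contravar.
           apply Rmult_le_compat_r; [left; apply Rinv_0_lt_compat; assumption|].
           apply le_INR; assumption.
        -- eapply Rle_trans; [exact H'|]. apply Rmult_le_compat_r; [assumption | apply Rle_abs].
Qed.

Lemma locally_2d_bounded (h : R -> R -> R) : continuity_2d_pt h 0 0 ->
  exists B r, 0 < r /\ forall x y, Rabs x < r -> Rabs y < r -> Rabs (h x y) <= B.
Proof.
  intros Hh; destruct (Hh (mkposreal _ Rlt_0_1)) as [d Hd]; cbn in Hd.
  exists (Rabs (h 0 0) + 1), d; split; [apply cond_pos|].
  intros x y Hx Hy; specialize (Hd x y); rewrite !Rminus_0_r in Hd.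
  specialize (Hd Hx Hy).
  replace (h x y) with (h 0 0 + (h x y - h 0 0)) by ring.
  eapply Rle_trans; [apply Rabs_triang|]; lra.
Qed.

Lemma C1_lipschitz_at_0 (h : R -> R -> R) :
  (forall x y, ex_diff_n h 1 x y) ->
  exists K r, 0 < r /\ forall x y, Rabs x <= r -> Rabs y <= r ->
    Rabs (h x y - h 0 0) <= K * (Rabs x + Rabs y).
Proof.
  intros Hh.
  destruct (locally_2d_bounded (d1_2 h)) as (B1 & r1 & Hr1 & H1).
  { destruct (Hh 0 0) as (_ & _ & _ & H & _); apply H. }
  destruct (locally_2d_bounded (d2_2 h)) as (B2 & r2 & Hr2 & H2).
  { destruct (Hh 0 0) as (_ & _ & _ & _ & H); apply H. }
  exists (Rabs B1 + Rabs B2), (Rmin r1 r2 / 2).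
  assert (M1 : Rmin r1 r2 <= r1) by apply Rmin_l.
  assert (M2 : Rmin r1 r2 <= r2) by apply Rmin_r.
  assert (M0 : 0 < Rmin r1 r2) by (apply Rmin_glb_lt; assumption).
  split; [lra|].
  intros x y Hx Hy.
  destruct (mvt_between (fun s => h s y) (fun s => d1_2 h s y) 0 x) as (xi & Hxi & E1).
  { intros s; apply Derive_correct, (Hh s y). }
  destruct (mvt_between (fun s => h 0 s) (fun s => d2_2 h 0 s) 0 y) as (et & Het & E2).
  { intros s; apply Derive_correct, (Hh 0 s). }
  apply Rabs_between_sub in Hxi, Het. rewrite !Rminus_0_r in *.
  replace (h x y - h 0 0) with ((h x y - h 0 y) + (h 0 y - h 0 0)) by ring.
  rewrite E1, E2.
  eapply Rle_trans; [apply Rabs_triang|]. rewrite !Rabs_mult.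
  specialize (H1 xi y ltac:(lra) ltac:(lra)).
  specialize (H2 0 et ltac:(rewrite Rabs_R0; lra) ltac:(lra)).
  assert (X0 := Rabs_pos x); assert (Y0 := Rabs_pos y).
  assert (B1' := Rle_abs B1); assert (B2' := Rle_abs B2).
  assert (P1 := Rabs_pos B1); assert (P2 := Rabs_pos B2).
  assert (Rabs (d1_2 h xi y) * Rabs x <= Rabs B1 * Rabs x) by (apply Rmult_le_compat_r; lra).
  assert (Rabs (d2_2 h 0 et) * Rabs y <= Rabs B2 * Rabs y) by (apply Rmult_le_compat_r; lra).
  assert (0 <= Rabs B2 * Rabs x) by (apply Rmult_le_pos; assumption).
  assert (0 <= Rabs B1 * Rabs y) by (apply Rmult_le_pos; assumption).
  lra.
Qed.

(** * Limits in the potential well *)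

Lemma choose_function {P : Type} (Q : P -> R -> Prop) :
  (forall p, exists x, Q p x) -> exists f : P -> R, forall p, Q p (f p).
Proof.
  intros HQ; exists (fun p => proj1_sig (constructive_indefinite_description _ (HQ p))).
  intros p; apply proj2_sig.
Qed.

Lemma mvt_family {P : Type} (good : P -> Prop) (f df : P -> R -> R) (x h : P -> R) :
  (forall p s, good p -> is_derive (f p) s (df p s)) ->
  exists xi : P -> R, forall p, good p ->
    f p (x p + h p) - f p (x p) = df p (xi p) * h p /\ Rabs (xi p - x p) <= Rabs (h p).
Proof.
  intros Hf.
  destruct (choose_function (fun p xi => good p ->
    f p (x p + h p) - f p (x p) = df p xi * h p /\ Rabs (xi - x p) <= Rabs (h p))) as [xi Hxi].
  - intros p; destruct (classic (good p)) as [Hg | Hg].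
    + destruct (mvt_between (f p) (df p) (x p) (x p + h p)) as (c & Hc & E).
      { intros s; apply Hf; assumption. }
      exists c; intros _; apply Rabs_between_sub in Hc.
      replace (x p + h p - x p) with (h p) in * by ring; split; assumption.
    + exists 0; intros; contradiction.
  - exists xi; exact Hxi.
Qed.

(** The remainder with an intermediate point, for increments of either sign:
    Rolle's argument for the segment from [x] to [x + h], parametrized by [s]. *)
Lemma taylor_second_order (f f1 f2 : R -> R) (x h : R) :
  (forall s, is_derive f s (f1 s)) -> (forall s, is_derive f1 s (f2 s)) ->
  exists xi, f (x + h) - f x - f1 x * h = f2 xi / 2 * h ^ 2 /\ Rabs (xi - x) <= Rabs h.
Proof.
  intros H1 H2.
  pose (r := f (x + h) - f x - f1 x * h).
  pose (psi := fun s => f (x + s * h) - f x - f1 x * (s * h) - s ^ 2 * r).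
  pose (dpsi := fun s => f1 (x + s * h) * h - f1 x * h - 2 * s * r).
  assert (Hd : forall s, is_derive psi s (dpsi s)).
  { intros s; unfold psi, dpsi; auto_derive.
    - eexists; apply H1.
    - replace (Derive _ (x + s * h)) with (f1 (x + s * h)) by (symmetry; apply is_derive_unique, H1).
      ring. }
  destruct (MVT_cor2 psi dpsi 0 1 Rlt_0_1) as (s & E & Hs).
  { intros; apply is_derive_Reals, Hd. }
  assert (E0 : psi 0 = 0) by (unfold psi; rewrite Rmult_0_l, Rplus_0_r; ring).
  assert (E1 : psi 1 = 0) by (unfold psi, r; rewrite Rmult_1_l; ring).
  rewrite E0, E1 in E; unfold dpsi in E.
  destruct (mvt_between f1 f2 x (x + s * h)) as (xi & Hxi & E2); [assumption|].
  exists xi; fold r; split.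
  - apply (Rmult_eq_reg_l (2 * s)); [|lra].
    replace (x + s * h - x) with (s * h) in E2 by ring.
    replace (2 * s * r) with ((f1 (x + s * h) - f1 x) * h) by lra.
    rewrite E2; field.
  - apply Rabs_between_sub in Hxi. eapply Rle_trans; [exact Hxi|].
    replace (x + s * h - x) with (s * h) by ring. rewrite Rabs_mult, (Rabs_pos_eq s) by lra.
    assert (0 <= Rabs h) by apply Rabs_pos; nra.
Qed.

Lemma taylor_family {P : Type} (f f1 f2 : R -> R) (x h : P -> R) :
  (forall s, is_derive f s (f1 s)) -> (forall s, is_derive f1 s (f2 s)) ->
  exists xi : P -> R, forall p,
    f (x p + h p) - f (x p) - f1 (x p) * h p = f2 (xi p) / 2 * h p ^ 2 /\
    Rabs (xi p - x p) <= Rabs (h p).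
Proof.
  intros H1 H2; apply (choose_function (fun p xi =>
    f (x p + h p) - f (x p) - f1 (x p) * h p = f2 xi / 2 * h p ^ 2 /\
    Rabs (xi - x p) <= Rabs (h p))).
  intros p; apply taylor_second_order; assumption.
Qed.

Lemma filterlim_value {P : Type} (U : (P -> Prop) -> Prop) (f : P -> R) (l l' : R) :
  filterlim f U (locally l) -> l = l' -> filterlim f U (locally l').
Proof. intros Hf <-; exact Hf. Qed.

Ltac limits :=
  match goal with
  | |- filterlim (fun p => @?f p + @?g p) _ _ => apply (filterlim_Rplus f g); limits
  | |- filterlim (fun p => @?f p - @?g p) _ _ => apply (filterlim_Rminus f g); limits
  | |- filterlim (fun p => @?f p * @?g p) _ _ => apply (filterlim_Rmult f g); limits
  | |- filterlim (fun p => - @?f p) _ _ => apply (filterlim_Ropp f); limits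
  | |- filterlim (fun p => ?c) _ _ => apply filterlim_const
  | |- _ => eassumption
  end.

(** The solution follows the minimum of a slowly varying potential well whose width
    is of order [t ^ - kap] and whose depth is of order [t ^ (- 3 * kap)]. In the
    units used here both are of order one. *)
Definition region_norm (kap t u v : R) : R :=
  Rpower t (3 * kap) * v ^ 2 + Rpower t (2 * kap) * u ^ 2.

Definition time (p : R * R * R) : R := fst (fst p).
Local Notation tpow p := (Rpower (time p)).
Definition dx (p : R * R * R) : R := snd (fst p).
Definition dy (p : R * R * R) : R := snd p.

(** Limits along this filter are taken for late times and deviations that are
    small in the units of the well; the coefficients of the energy estimate have
    limits in this sense. *)
Definition region_filter (kap : R) (Q : R * R * R -> Prop) : Prop :=
  exists eta t1, 0 < eta /\ 0 < t1 /\ forall p, t1 < time p ->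
    region_norm kap (time p) (dx p) (dy p) <= eta -> Q p.

Global Instance region_filter_filter kap : Filter (region_filter kap).
Proof.
  split.
  - exists 1, 1; repeat split; lra.
  - intros P Q (e1 & t1 & He1 & Ht1 & H1) (e2 & t2 & He2 & Ht2 & H2).
    exists (Rmin e1 e2), (Rmax t1 t2).
    assert (A1 := Rmin_l e1 e2). assert (A2 := Rmin_r e1 e2).
    assert (B1 := Rmax_l t1 t2). assert (B2 := Rmax_r t1 t2).
    split; [apply Rmin_glb_lt; assumption|]. split; [lra|].
    intros p Hp Hr; split; [apply H1 | apply H2]; lra.
  - intros P Q HPQ (e1 & t1 & He1 & Ht1 & H1).
    exists e1, t1; repeat split; try assumption; intros; apply HPQ, H1; assumption.
Qed.

Section Region.

Variable kap : R.
Hypothesis kap_pos : 0 < kap.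
Notation RF := (region_filter kap).

Lemma time_to_infinity : filterlim time RF (Rbar_locally p_infty).
Proof.
  intros Q [M HM]; exists 1, (Rabs M + 1).
  assert (H0 := Rabs_pos M); assert (H1 := Rle_abs M).
  split; [lra|]; split; [lra|]; intros p Hp _; apply HM; lra.
Qed.

Lemma time_large M : RF (fun p => M < time p).
Proof. apply (time_to_infinity (fun s => M < s)); exists M; auto. Qed.

Lemma lim_time (h : R -> R) (l : R) :
  is_lim h p_infty l -> filterlim (fun p => h (time p)) RF (locally l).
Proof. intros Hh; eapply filterlim_comp; [apply time_to_infinity | exact Hh]. Qed.

Lemma Rpower_time_0 e : 0 < e -> filterlim (fun p => tpow p (- e)) RF (locally 0).
Proof. intros He; apply (lim_time (fun t => Rpower t (- e))), Rpower_neg_lim, He. Qed.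

Lemma Rpower_ge_1 t e : 1 <= t -> 0 <= e -> 1 <= Rpower t e.
Proof.
  intros Ht He; replace 1 with (Rpower t 0).
  - apply Rle_Rpower; assumption.
  - unfold Rpower; rewrite Rmult_0_l, exp_0; reflexivity.
Qed.

Lemma Rpower_double t e : Rpower t (2 * e) = Rpower t e ^ 2.
Proof. replace (2 * e) with (e + e) by ring; rewrite Rpower_plus; ring. Qed.

Lemma region_dx_dy eta t u v : 0 < eta -> 1 <= t -> region_norm kap t u v < eta ^ 2 ->
  Rabs (Rpower t kap * u) < eta /\ Rabs (Rpower t kap * v) < eta.
Proof.
  unfold region_norm; intros He Ht Hr.
  assert (H3 : Rpower t (2 * kap) <= Rpower t (3 * kap)) by (apply Rle_Rpower; lra).
  rewrite Rpower_double in *.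
  assert (P3 := Rpower_pos t (3 * kap)).
  assert (Q1 : 0 <= Rpower t (3 * kap) * v ^ 2) by (apply Rmult_le_pos; [lra | apply pow2_ge_0]).
  assert (Q2 : 0 <= (Rpower t kap * u) ^ 2) by apply pow2_ge_0.
  assert (Q3 : Rpower t kap ^ 2 * v ^ 2 <= Rpower t (3 * kap) * v ^ 2)
    by (apply Rmult_le_compat_r; [apply pow2_ge_0 | assumption]).
  assert (Hsq : forall x, x ^ 2 < eta ^ 2 -> Rabs x < eta).
  { intros x Hx; apply Rabs_def1; nra. }
  split; apply Hsq; rewrite Rpow_mult_distr in *; nra.
Qed.

Lemma dx_dy_small :
  filterlim (fun p => tpow p kap * dx p) RF (locally 0) /\
  filterlim (fun p => tpow p kap * dy p) RF (locally 0).
Proof.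
  assert (H : forall eps, 0 < eps -> RF (fun p => Rabs (tpow p kap * dx p) < eps /\
     Rabs (tpow p kap * dy p) < eps)).
  { intros eps He; exists (eps ^ 2 / 2), 1.
    assert (0 < eps ^ 2) by (apply pow_lt; assumption).
    split; [lra|]; split; [lra|]; intros p Hp Hr; apply region_dx_dy; lra. }
  split; apply filterlim_eps; intros eps He; generalize (H eps He); apply filter_imp;
  intros p [H1 H2]; rewrite Rminus_0_r; assumption.
Qed.

Lemma Rpower_cancel t e : Rpower t (- e) * Rpower t e = 1.
Proof.
  rewrite <- Rpower_plus; replace (- e + e) with 0 by ring.
  unfold Rpower; rewrite Rmult_0_l, exp_0; reflexivity.
Qed.

Lemma vanishes_of_scaled (x : R * R * R -> R) (l : R) :
  filterlim (fun p => tpow p kap * x p) RF (locally l) ->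
  filterlim x RF (locally 0).
Proof.
  intros Hx.
  apply (filterlim_eq (fun p => tpow p (- kap) * (tpow p kap * x p))).
  - apply filter_forall; intros p; rewrite <- Rmult_assoc, Rpower_cancel; ring.
  - eapply filterlim_Rmult_0; [apply Rpower_time_0; assumption | exact Hx].
Qed.

Lemma scaled_intermediate (x xi h : R * R * R -> R) (l : R) :
  filterlim (fun p => tpow p kap * x p) RF (locally l) ->
  filterlim (fun p => tpow p kap * h p) RF (locally 0) ->
  RF (fun p => Rabs (xi p - x p) <= Rabs (h p)) ->
  filterlim (fun p => tpow p kap * xi p) RF (locally l).
Proof.
  intros Hx Hh Hxi.
  apply (filterlim_eq (fun p => tpow p kap * x p + tpow p kap * (xi p - x p))).
  { apply filter_forall; intros p; ring. }
  eapply filterlim_value; [apply filterlim_Rplus; [exact Hx|]|apply Rplus_0_r].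
  apply (filterlim_squeeze_0 _ (fun p => Rabs (tpow p kap * h p))).
  - revert Hxi; apply filter_imp; intros p Hp.
    rewrite !Rabs_mult; apply Rmult_le_compat_l; [apply Rabs_pos | exact Hp].
  - apply vanishing_Rabs, Hh.
Qed.

End Region.

(** * The energy of a deviation *)

Lemma power_sum_skip p n a N : (1 <= n <= N)%nat ->
  (forall k, (1 <= k < n)%nat -> a k = 0) ->
  forall t, power_sum p 1 a N t = power_sum p n a N t.
Proof.
  intros Hn Ha t; unfold power_sum.
  destruct (Nat.eq_dec n 1) as [-> | Hne]; [reflexivity|].
  destruct n as [|n]; [lia|].
  rewrite (sum_n_m_Chasles _ 1 n N) by lia.
  rewrite (sum_n_m_ext_loc _ (fun _ => zero) 1 n).
  - rewrite sum_n_m_const_zero; apply plus_zero_l.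
  - intros k Hk; rewrite Ha by lia; apply Rmult_0_r.
Qed.

Section Stability.

Variables H F G : R -> R -> R -> R.
Variables w V phi phi1 phi2 psi : R -> R.
Variables Fk Gk : nat -> R -> R -> R.
Variables q n m : nat.
Variables (T : R) (xs ys : R -> R) (xk yk : nat -> R).

Hypothesis q_pos : (0 < q)%nat.
Hypothesis n_range : (1 <= n <= q)%nat.
Hypothesis m_range : (m < n)%nat.
Hypothesis force : limiting_force H w V phi phi1 phi2 psi.
Hypothesis F_perturbation : perturbation q F Fk.
Hypothesis G_perturbation : perturbation q G Gk.
Hypothesis low_order : forall i, (1 <= i < n)%nat -> forall x y, Fk i x y = 0 /\ Gk i x y = 0.
Hypothesis T_pos : 0 <= T.
Hypothesis solution : solution_after H F G 0 T xs ys.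
Hypothesis xs_series : asymptotic_series (2 * q) (n + m) xs xk.
Hypothesis ys_series : asymptotic_series (2 * q) (2 * n) ys yk.

Let kap := INR (n + m) / INR (2 * q).
Let bet := INR n / INR q.
Let mu := xk (n + m)%nat.
Let nu0 := kronecker n q.
Let RF := region_filter kap.
Local Notation "f --> l" := (filterlim f RF (locally l)) (at level 70).

Hypothesis mu_pos : 0 < mu.

Lemma INR_q_pos : 0 < INR q.
Proof. apply lt_0_INR; assumption. Qed.

Lemma kap_pos : 0 < kap.
Proof. apply Rdiv_lt_0_compat; apply lt_0_INR; lia. Qed.

Lemma bet_double : bet = INR (2 * n) / INR (2 * q).
Proof.
  unfold bet; assert (Hq := INR_q_pos); rewrite !mult_INR; simpl; field; lra.
Qed.

Lemma kap_lt_bet : kap < bet.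
Proof.
  rewrite bet_double; unfold kap. apply Rmult_lt_compat_r.
  - apply Rinv_0_lt_compat, lt_0_INR; lia.
  - apply lt_INR; lia.
Qed.

Lemma Rpower_nu : is_lim (fun t => Rpower t (bet - 1)) p_infty nu0.
Proof.
  unfold nu0, kronecker; destruct (Nat.eqb_spec n q) as [E | Hne].
  - apply (is_lim_ext (fun _ => 1)); [|apply is_lim_const].
    intros t; replace (bet - 1) with 0; [unfold Rpower; rewrite Rmult_0_l, exp_0; reflexivity|].
    unfold bet; rewrite E; assert (Hq := INR_q_pos); field; lra.
  - replace (bet - 1) with (- (1 - bet)) by ring.
    apply Rpower_neg_lim.
    assert (bet < 1); [|lra].
    unfold bet; apply (Rmult_lt_reg_r (INR q)); [apply INR_q_pos|].
    unfold Rdiv; rewrite Rmult_assoc, Rinv_l by (assert (Hq := INR_q_pos); lra).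
    rewrite Rmult_1_l, Rmult_1_r; apply lt_INR; lia.
Qed.

(** The expansion of the solution may not be differentiated term by term. The energy
    is therefore centred at a partial sum, whose derivative is explicit; up to order
    [4 * n] the error [t ^ (- 2 * bet)] is negligible against the dissipation. *)
Definition xs_sum : R -> R := power_sum (2 * q) (n + m) xk (4 * n).
(** [t] times the derivative of the partial sum. *)
Definition xs_sum_log : R -> R :=
  power_sum (2 * q) (n + m) (fun k => - (INR k / INR (2 * q)) * xk k) (4 * n).

Lemma X_derive t : 0 < t -> is_derive xs_sum t (/ t * xs_sum_log t).
Proof. intros Ht; apply power_sum_derive; [lia | assumption]. Qed.

Lemma X_leading : (fun p => tpow p kap * xs_sum (time p)) --> mu.
Proof.
  apply (lim_time kap (fun t => Rpower t kap * xs_sum t)).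
  apply (power_sum_leading (2 * q) (n + m) xk); lia.
Qed.

Lemma Xlog_leading :
  (fun p => tpow p kap * xs_sum_log (time p)) --> (- kap * mu).
Proof.
  apply (lim_time kap (fun t => Rpower t kap * xs_sum_log t)).
  apply (power_sum_leading (2 * q) (n + m) (fun k => - (INR k / INR (2 * q)) * xk k)); lia.
Qed.

Lemma X_error :
  (fun p => tpow p (2 * bet) * (xs (time p) - xs_sum (time p))) --> 0.
Proof.
  apply (lim_time kap (fun t => Rpower t (2 * bet) * (xs t - xs_sum t))).
  apply (is_lim_ext (fun t => Rpower t (INR (4 * n) / INR (2 * q)) * (xs t - xs_sum t))).
  - intros t; do 2 f_equal; rewrite bet_double, !mult_INR; simpl.
    assert (Hq := INR_q_pos); field; lra.
  - apply (xs_series (4 * n)%nat).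
Qed.

Lemma ys_leading : (fun p => tpow p kap * ys (time p)) --> 0.
Proof.
  apply (filterlim_eq (fun p => tpow p (- (bet - kap)) *
    (tpow p bet * (ys (time p) - power_sum (2 * q) (2 * n) yk (2 * n) (time p))
      + yk (2 * n)%nat))).
  { apply filter_forall; intros p.
    rewrite power_sum_single, <- bet_double, Rmult_minus_distr_l, <- Rmult_assoc.
    replace (tpow p bet * tpow p (- bet)) with 1
      by (rewrite Rmult_comm, Rpower_cancel; reflexivity).
    replace (tpow p kap) with (tpow p (- (bet - kap)) * tpow p bet).
    - ring.
    - rewrite <- Rpower_plus; f_equal; ring. }
  eapply filterlim_Rmult_0.
  - apply Rpower_time_0; assert (A := kap_lt_bet); lra.
  - apply filterlim_Rplus; [|apply filterlim_const].
    apply (lim_time kap (fun t => Rpower t bet * (ys t - power_sum (2 * q) (2 * n) yk (2 * n) t))).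
    rewrite bet_double; apply (ys_series (2 * n)%nat).
Qed.

Lemma xs_leading : (fun p => tpow p kap * xs (time p)) --> mu.
Proof.
  apply (filterlim_eq (fun p => tpow p kap * xs_sum (time p) +
    tpow p (- (2 * bet - kap)) * (tpow p (2 * bet) * (xs (time p) - xs_sum (time p))))).
  { apply filter_forall; intros p; rewrite <- Rmult_assoc, <- Rpower_plus.
    replace (- (2 * bet - kap) + 2 * bet) with kap by ring; ring. }
  eapply filterlim_value; [apply filterlim_Rplus|].
  - apply X_leading.
  - eapply filterlim_Rmult_0; [|apply X_error].
    apply Rpower_time_0; assert (A := kap_lt_bet); assert (B := kap_pos); lra.
  - apply Rplus_0_r.
Qed.

(* [tau] is the size of the dissipation, [1 / s] the period of the oscillations up
   to a constant, and [tau * nu] is [1 / t]. *)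
Let tau (p : R * R * R) := tpow p (- bet).
Let s (p : R * R * R) := tpow p (- (kap / 2)).
Let k (p : R * R * R) := tpow p (- (bet - kap)).
Let nu (p : R * R * R) := tpow p (bet - 1).

Lemma tau_k_s p : tau p = k p * s p ^ 2.
Proof.
  unfold tau, k, s; rewrite <- Rpower_double, <- Rpower_plus; f_equal; field.
Qed.

Lemma s_square p : tpow p (- kap) = s p ^ 2.
Proof. unfold s; rewrite <- Rpower_double; f_equal; field. Qed.

Lemma inv_time p : 0 < time p -> / time p = tau p * nu p.
Proof.
  intros Ht; unfold tau, nu; rewrite <- Rpower_plus.
  replace (- bet + (bet - 1)) with (- (1)) by ring.
  rewrite Rpower_Ropp, Rpower_1 by assumption; reflexivity.
Qed.

Lemma k_lim : k --> 0.
Proof. apply Rpower_time_0; assert (A := kap_lt_bet); lra. Qed.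

Lemma s_lim : s --> 0.
Proof. apply Rpower_time_0; assert (A := kap_pos); lra. Qed.

Lemma nu_lim : nu --> nu0.
Proof. apply (lim_time kap (fun t => Rpower t (bet - 1))), Rpower_nu. Qed.

Lemma tau_lim : tau --> 0.
Proof. apply Rpower_time_0; assert (A := kap_lt_bet); assert (B := kap_pos); lra. Qed.

Lemma dx_lim : (fun p => tpow p kap * dx p) --> 0.
Proof. apply dx_dy_small, kap_pos. Qed.

Lemma dy_lim : (fun p => tpow p kap * dy p) --> 0.
Proof. apply dx_dy_small, kap_pos. Qed.

Lemma all_time (Q : R * R * R -> Prop) : (forall p, 0 < time p -> Q p) -> RF Q.
Proof. intros HQ; generalize (time_large kap 0); apply filter_imp; exact HQ. Qed.

Lemma ys_dy_lim :
  (fun p => tpow p kap * (ys (time p) + dy p)) --> 0.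
Proof.
  apply (filterlim_eq (fun p => tpow p kap * ys (time p) + tpow p kap * dy p)).
  - apply filter_forall; intros p; ring.
  - apply filterlim_Rplus_0; [apply ys_leading | apply dy_lim].
Qed.

Lemma low_order_derivative (d : (R -> R -> R) -> R -> R -> R) (fk : nat -> R -> R -> R) :
  (d = d1_2 \/ d = d2_2) -> (forall i x y, (1 <= i < n)%nat -> fk i x y = 0) ->
  forall i x y, (1 <= i < n)%nat -> d (fk i) x y = 0.
Proof.
  intros [-> | ->] Hz i x y Hi; unfold d1_2, d2_2.
  - rewrite (Derive_ext _ (fun _ => 0)); [apply Derive_const | intros; apply Hz, Hi].
  - rewrite (Derive_ext _ (fun _ => 0)); [apply Derive_const | intros; apply Hz, Hi].
Qed.

(** The coefficient of [dx] is left as a derivative at an intermediate point,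
    because for the force its limit alone is not precise enough. *)
Lemma increment_coefficients (f : R -> R -> R -> R) (fk : nat -> R -> R -> R) :
  perturbation q f fk ->
  (forall i x y, (1 <= i < n)%nat -> fk i x y = 0) ->
  exists xi B,
    (fun p => tpow p bet * d1_3 f (xi p) (ys (time p) + dy p) (time p)) --> d1_2 (fk n) 0 0 /\
    (fun p => tpow p kap * xi p) --> mu /\
    B --> d2_2 (fk n) 0 0 /\
    forall p, 0 < time p ->
      f (xs (time p) + dx p) (ys (time p) + dy p) (time p) - f (xs (time p)) (ys (time p)) (time p)
      = d1_3 f (xi p) (ys (time p) + dy p) (time p) * dx p + tau p * (B p * dy p).
Proof.
  intros (Hs & Hk & _ & _ & E1 & E2) Hz.
  destruct (mvt_family (fun p => 0 < time p)
    (fun p x => f x (ys (time p) + dy p) (time p))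
    (fun p x => d1_3 f x (ys (time p) + dy p) (time p))
    (fun p => xs (time p)) dx) as [xi Hxi].
  { intros p x Hp; apply Derive_correct, (Hs 1%nat x _ _ Hp). }
  destruct (mvt_family (fun p => 0 < time p)
    (fun p y => f (xs (time p)) y (time p))
    (fun p y => d2_3 f (xs (time p)) y (time p))
    (fun p => ys (time p)) dy) as [et Het].
  { intros p y Hp; apply Derive_correct, (Hs 1%nat _ y _ Hp). }
  assert (Lxi : (fun p => tpow p kap * xi p) --> mu).
  { apply (scaled_intermediate kap (fun p => xs (time p)) xi dx).
    - apply xs_leading.
    - apply dx_lim.
    - apply all_time; intros p Hp; apply Hxi, Hp. }
  assert (Let : (fun p => tpow p kap * et p) --> 0).
  { apply (scaled_intermediate kap (fun p => ys (time p)) et dy).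
    - apply ys_leading.
    - apply dy_lim.
    - apply all_time; intros p Hp; apply Het, Hp. }
  exists xi, (fun p => tpow p bet * d2_3 f (xs (time p)) (et p) (time p)).
  assert (Hc : forall x y, ex_diff_n (fk n) 1 x y) by (intros; apply Hk; lia).
  split; [|split; [exact Lxi|split]].
  - apply (expansion_leading q n (d1_3 f) (fun k => d1_2 (fk k)) time xi (fun p => ys (time p) + dy p)).
    + lia.
    + exact E1.
    + intros i x y Hi; apply (low_order_derivative d1_2 fk); auto.
    + destruct (Hc 0 0) as (_ & _ & _ & Hc1 & _); apply Hc1.
    + apply time_to_infinity.
    + apply (vanishes_of_scaled kap kap_pos xi mu Lxi).
    + apply (vanishes_of_scaled kap kap_pos _ 0 ys_dy_lim).
  - apply (expansion_leading q n (d2_3 f) (fun k => d2_2 (fk k)) time (fun p => xs (time p)) et).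
    + lia.
    + exact E2.
    + intros i x y Hi; apply (low_order_derivative d2_2 fk); auto.
    + destruct (Hc 0 0) as (_ & _ & _ & _ & Hc1); apply Hc1.
    + apply time_to_infinity.
    + apply (vanishes_of_scaled kap kap_pos _ mu xs_leading).
    + apply (vanishes_of_scaled kap kap_pos et 0 Let).
  - intros p Hp; destruct (Hxi p Hp) as [I1 _]; destruct (Het p Hp) as [I2 _].
    replace (tau p * (tpow p bet * d2_3 f (xs (time p)) (et p) (time p) * dy p))
      with (tau p * tpow p bet * (d2_3 f (xs (time p)) (et p) (time p) * dy p)) by ring.
    unfold tau; rewrite Rpower_cancel, Rmult_1_l, <- I1, <- I2; ring.
Qed.

Lemma velocity_coefficients : exists A B,
  A --> d1_2 (Fk n) 0 0 /\
  B --> d2_2 (Fk n) 0 0 /\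
  forall p, 0 < time p ->
    F (xs (time p) + dx p) (ys (time p) + dy p) (time p) - F (xs (time p)) (ys (time p)) (time p)
    = tau p * (A p * dx p + B p * dy p).
Proof.
  destruct (increment_coefficients F Fk F_perturbation) as (xi & B & L1 & _ & L2 & E).
  { intros i x y Hi; apply (low_order i Hi). }
  exists (fun p => tpow p bet * d1_3 F (xi p) (ys (time p) + dy p) (time p)), B.
  split; [exact L1|]; split; [exact L2|].
  intros p Hp; rewrite E by assumption.
  rewrite Rmult_plus_distr_l.
  replace (tau p * (tpow p bet * d1_3 F (xi p) (ys (time p) + dy p) (time p) * dx p))
    with (tau p * tpow p bet * (d1_3 F (xi p) (ys (time p) + dy p) (time p) * dx p)) by ring.
  unfold tau at 2; rewrite Rpower_cancel; ring.
Qed.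

(** The part of the perturbing force that is linear in [dx] exceeds the
    dissipation by the unbounded factor [t ^ (kap / 2)], so that it has to enter the
    energy; since only expansions in [t] may be differentiated, its coefficient
    is replaced by this partial sum. *)
Definition stiffness : R -> R := power_sum q 1 (fun i => d1_2 (Gk i) 0 0) (2 * n).
(** [t] times the derivative of the stiffness. *)
Definition stiffness_log : R -> R :=
  power_sum q 1 (fun i => - (INR i / INR q) * d1_2 (Gk i) 0 0) (2 * n).

Lemma c_derive t : 0 < t -> is_derive stiffness t (/ t * stiffness_log t).
Proof. intros Ht; apply power_sum_derive; [lia | assumption]. Qed.

Lemma Gk_low_order i x y : (1 <= i < n)%nat -> d1_2 (Gk i) x y = 0.
Proof.
  apply (low_order_derivative d1_2 Gk); [left; reflexivity|].
  intros j x' y' Hj; apply (low_order j Hj).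
Qed.

Lemma power_sum_from_n (b : nat -> R) :
  (forall i, (1 <= i < n)%nat -> b i = 0) ->
  (fun p => tpow p bet * power_sum q 1 b (2 * n) (time p)) --> b n.
Proof.
  intros Hb; apply (lim_time kap (fun t => Rpower t bet * power_sum q 1 b (2 * n) t)).
  apply (is_lim_ext (fun t => Rpower t bet * power_sum q n b (2 * n) t)).
  - intros t; rewrite (power_sum_skip q n); [reflexivity | lia | assumption].
  - apply (power_sum_leading q n b); lia.
Qed.

Lemma c_leading :
  (fun p => tpow p bet * stiffness (time p)) --> d1_2 (Gk n) 0 0.
Proof.
  apply (power_sum_from_n (fun i => d1_2 (Gk i) 0 0)); intros i Hi; apply Gk_low_order, Hi.
Qed.

Lemma clog_leading :
  (fun p => tpow p bet * stiffness_log (time p)) --> (- bet * d1_2 (Gk n) 0 0).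
Proof.
  apply (power_sum_from_n (fun i => - (INR i / INR q) * d1_2 (Gk i) 0 0)).
  intros i Hi; rewrite Gk_low_order by assumption; apply Rmult_0_r.
Qed.

(** The remainder of the expansion of order [2 * n] is [t ^ (- 2 * bet)], and moving
    the point to the origin costs [t ^ - bet * t ^ - kap]; both are smaller than
    [t ^ - (bet + kap / 2)] as [kap < bet]. *)
Lemma force_gradient_error (xi et : R * R * R -> R) (l : R) :
  (fun p => tpow p kap * xi p) --> l ->
  (fun p => tpow p kap * et p) --> 0 ->
  (fun p => tpow p (bet + kap / 2) * (d1_3 G (xi p) (et p) (time p) - stiffness (time p))) --> 0.
Proof.
  intros Lxi Let.
  destruct G_perturbation as (_ & Hk & _ & _ & E1 & _).
  destruct (power_sum_lipschitz_at_0 q n (2 * n) (fun i => d1_2 (Gk i)) q_pos)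
    as (K & r & HK & Hr & Hlip).
  { intros i x y Hi; apply Gk_low_order, Hi. }
  { intros i Hi; apply C1_lipschitz_at_0; intros x y.
    destruct (Hk i Hi 2%nat x y) as (_ & _ & _ & H1 & _); exact H1. }
  destruct (E1 (2 * n)%nat 1 1 Rlt_0_1) as [t1 Hexp].
  assert (Hxi := vanishes_of_scaled kap kap_pos xi l Lxi).
  assert (Het := vanishes_of_scaled kap kap_pos et 0 Let).
  apply (filterlim_squeeze_0 _ (fun p => tpow p (- (bet - kap / 2))
    + K * (s p * (Rabs (tpow p kap * xi p) + Rabs (tpow p kap * et p))))).
  - assert (Hm : 0 < Rmin r 1) by (apply Rmin_glb_lt; lra).
    generalize (filter_and _ _ (proj1 (filterlim_eps xi 0) Hxi _ Hm)
      (filter_and _ _ (proj1 (filterlim_eps et 0) Het _ Hm)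
        (filter_and _ _ (time_large kap t1) (time_large kap 1)))).
    apply filter_imp; intros p (B1 & B2 & B3 & B4).
    rewrite !Rminus_0_r in *.
    assert (M1 := Rmin_l r 1). assert (M2 := Rmin_r r 1).
    specialize (Hexp (xi p) (et p) (time p) ltac:(lra) ltac:(lra) B3).
    specialize (Hlip (time p) (xi p) (et p) ltac:(lra) ltac:(lra) ltac:(lra)).
    fold (power_sum q 1 (fun i => d1_2 (Gk i) (xi p) (et p)) (2 * n) (time p)) in Hexp.
    fold stiffness in Hlip; fold bet in Hlip.
    set (S1 := power_sum _ _ _ _ _) in *.
    assert (P1 := Rpower_pos (time p) (bet + kap / 2)).
    assert (P2 := Rpower_pos (time p) (2 * bet)).
    rewrite Rabs_mult, Rabs_pos_eq by lra.
    assert (Hexp' : Rabs (d1_3 G (xi p) (et p) (time p) - S1) <= tpow p (- (2 * bet))).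
    { replace (INR (2 * n) / INR q) with (2 * bet) in Hexp
        by (unfold bet; rewrite mult_INR; simpl; assert (Hq := INR_q_pos); field; lra).
      rewrite Rabs_mult, Rabs_pos_eq in Hexp by lra.
      apply (Rmult_le_reg_l (tpow p (2 * bet))); [lra|].
      rewrite (Rmult_comm _ (Rpower _ (- _))), Rpower_cancel; lra. }
    replace (d1_3 G (xi p) (et p) (time p) - stiffness (time p)) with
      ((d1_3 G (xi p) (et p) (time p) - S1) + (S1 - stiffness (time p))) by ring.
    eapply Rle_trans; [apply Rmult_le_compat_l; [lra | apply Rabs_triang]|].
    rewrite Rmult_plus_distr_l; apply Rplus_le_compat.
    + eapply Rle_trans; [apply Rmult_le_compat_l; [lra | exact Hexp']|].
      rewrite <- Rpower_plus; right; f_equal; field.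
    + eapply Rle_trans; [apply Rmult_le_compat_l; [lra | exact Hlip]|].
      rewrite !Rabs_mult, (Rabs_pos_eq (tpow p kap)) by (left; apply Rpower_pos).
      right.
      replace (K * (s p * (tpow p kap * Rabs (xi p) + tpow p kap * Rabs (et p))))
        with (K * (s p * tpow p kap) * (Rabs (xi p) + Rabs (et p))) by ring.
      rewrite <- !Rmult_assoc. f_equal.
      rewrite (Rmult_comm _ K), !Rmult_assoc; f_equal.
      unfold s; rewrite <- !Rpower_plus; f_equal; field.
  - apply filterlim_Rplus_0.
    + apply Rpower_time_0; assert (A := kap_lt_bet); assert (B := kap_pos); lra.
    + eapply filterlim_value; [apply filterlim_Rmult; [apply filterlim_const|]|apply Rmult_0_r].
      eapply filterlim_Rmult_0; [apply s_lim|].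
      apply filterlim_Rplus.
      * eapply filterlim_comp; [exact Lxi|].
        apply (continuous_Rabs l).
      * apply vanishing_Rabs, Let.
Qed.

Lemma force_coefficients : exists C D,
  C --> 0 /\
  D --> d2_2 (Gk n) 0 0 /\
  forall p, 0 < time p ->
    G (xs (time p) + dx p) (ys (time p) + dy p) (time p) - G (xs (time p)) (ys (time p)) (time p)
    = stiffness (time p) * dx p + tau p * (s p * C p * dx p + D p * dy p).
Proof.
  destruct (increment_coefficients G Gk G_perturbation) as (xi & D & _ & L1 & L2 & E).
  { intros i x y Hi; apply (low_order i Hi). }
  exists (fun p => tpow p (bet + kap / 2) *
     (d1_3 G (xi p) (ys (time p) + dy p) (time p) - stiffness (time p))), D.
  split; [apply (force_gradient_error xi (fun p => ys (time p) + dy p) mu L1 ys_dy_lim)|].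
  split; [exact L2|].
  intros p Hp; rewrite E by assumption.
  set (g := d1_3 G _ _ _).
  replace (tau p * (s p * (tpow p (bet + kap / 2) * (g - stiffness (time p))) * dx p + D p * dy p))
    with (tau p * s p * tpow p (bet + kap / 2) * ((g - stiffness (time p)) * dx p)
          + tau p * (D p * dy p)) by ring.
  unfold tau at 2; unfold s; rewrite <- Rpower_plus.
  replace (- bet + - (kap / 2)) with (- (bet + kap / 2)) by field.
  rewrite Rpower_cancel; ring.
Qed.

Lemma phi1_scaled (xi : R * R * R -> R) :
  (fun p => tpow p kap * xi p) --> mu ->
  (fun p => tpow p kap * phi1 (xi p)) --> (2 * w 0 * mu).
Proof.
  intros Lxi.
  apply (filterlim_eq (fun p => psi (xi p) * (tpow p kap * xi p))).
  - apply filter_forall; intros p; rewrite (lf_psi force); ring.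
  - apply filterlim_Rmult; [|exact Lxi].
    rewrite <- (lf_psi_0 force).
    eapply filterlim_comp; [apply (vanishes_of_scaled kap kap_pos xi mu Lxi) | apply (lf_psi_cont force)].
Qed.

Lemma phi2_lim (xi : R * R * R -> R) (l : R) :
  (fun p => tpow p kap * xi p) --> l ->
  (fun p => phi2 (xi p)) --> (2 * w 0).
Proof.
  intros Lxi; rewrite <- (lf_phi2_0 force).
  eapply filterlim_comp; [apply (vanishes_of_scaled kap kap_pos xi l Lxi) | apply (lf_phi2 force)].
Qed.

Lemma near_X (xi : R * R * R -> R) :
  (forall p, Rabs (xi p - xs_sum (time p)) <= Rabs (dx p)) ->
  (fun p => tpow p kap * xi p) --> mu.
Proof.
  intros Hxi; apply (scaled_intermediate kap (fun p => xs_sum (time p)) xi dx).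
  - apply X_leading.
  - apply dx_lim.
  - apply filter_forall; exact Hxi.
Qed.

Lemma restoring_coefficient : exists M,
  M --> (2 * w 0 * mu) /\
  forall p, phi (xs_sum (time p) + dx p) - phi (xs_sum (time p)) = s p ^ 2 * M p * dx p.
Proof.
  destruct (mvt_family (fun _ => True) (fun _ => phi) (fun _ => phi1)
    (fun p => xs_sum (time p)) dx) as [xi Hxi].
  { intros _ x _; apply (lf_phi force). }
  exists (fun p => tpow p kap * phi1 (xi p)); split.
  - apply phi1_scaled, near_X; intros p; apply (Hxi p I).
  - intros p; rewrite (proj1 (Hxi p I)), <- s_square.
    rewrite <- (Rmult_assoc (Rpower _ (- _))), Rpower_cancel; ring.
Qed.

Lemma potential_coefficient : exists M0,
  M0 --> (2 * w 0 * mu) /\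
  forall p, V (xs_sum (time p) + dx p) - V (xs_sum (time p)) - phi (xs_sum (time p)) * dx p
    = s p ^ 2 * M0 p * dx p ^ 2 / 2.
Proof.
  destruct (taylor_family V phi phi1 (fun p => xs_sum (time p)) dx) as [xi Hxi];
    [apply (lf_V force) | apply (lf_phi force) |].
  exists (fun p => tpow p kap * phi1 (xi p)); split.
  - apply phi1_scaled, near_X; intros p; apply (Hxi p).
  - intros p; rewrite (proj1 (Hxi p)), <- s_square.
    rewrite <- (Rmult_assoc (Rpower _ (- _))), Rpower_cancel; field.
Qed.

Lemma drift_coefficient : exists Z,
  Z --> w 0 /\
  forall p, phi (xs_sum (time p) + dx p) - phi (xs_sum (time p)) - phi1 (xs_sum (time p)) * dx p
    = Z p * dx p ^ 2.
Proof.
  destruct (taylor_family phi phi1 phi2 (fun p => xs_sum (time p)) dx) as [xi Hxi];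
    [apply (lf_phi force) | apply (lf_phi1 force) |].
  exists (fun p => phi2 (xi p) * / 2); split.
  - eapply filterlim_value.
    + apply filterlim_Rmult; [|apply filterlim_const].
      apply (phi2_lim xi mu), near_X; intros p; apply (Hxi p).
    + field.
  - intros p; apply (Hxi p).
Qed.

(** Mean value theorem for the difference of the two forces as a function of the
    deviation, then for [phi1] between the two centres. *)
Lemma truncation_coefficient : exists J,
  J --> 0 /\
  forall p, phi (xs (time p) + dx p) - phi (xs (time p))
    = phi (xs_sum (time p) + dx p) - phi (xs_sum (time p)) + tau p * s p * J p * dx p.
Proof.
  destruct (mvt_family (fun _ => True)
    (fun p z => phi (xs (time p) + z) - phi (xs_sum (time p) + z))
    (fun p z => phi1 (xs (time p) + z) - phi1 (xs_sum (time p) + z))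
    (fun _ => 0) dx) as [ze Hze].
  { intros p z _; apply is_derive_Rminus.
    - replace (phi1 (xs (time p) + z)) with (scal 1 (phi1 (xs (time p) + z))) by apply Rmult_1_l.
      apply (is_derive_comp phi (fun z => xs (time p) + z)); [apply (lf_phi force)|].
      auto_derive; [trivial | ring].
    - replace (phi1 (xs_sum (time p) + z)) with (scal 1 (phi1 (xs_sum (time p) + z))) by apply Rmult_1_l.
      apply (is_derive_comp phi (fun z => xs_sum (time p) + z)); [apply (lf_phi force)|].
      auto_derive; [trivial | ring]. }
  destruct (mvt_family (fun _ => True) (fun _ => phi1) (fun _ => phi2)
    (fun p => xs_sum (time p) + ze p) (fun p => xs (time p) - xs_sum (time p))) as [xi Hxi].
  { intros _ x _; apply (lf_phi1 force). }
  assert (Lxi : (fun p => tpow p kap * xi p) --> mu).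
  { apply (scaled_intermediate kap (fun p => xs_sum (time p) + ze p) xi
      (fun p => xs (time p) - xs_sum (time p))).
    - apply (scaled_intermediate kap (fun p => xs_sum (time p)) _ dx).
      + apply X_leading.
      + apply dx_lim.
      + apply filter_forall; intros p.
        destruct (Hze p I) as [_ Hb]; rewrite Rminus_0_r in Hb.
        replace (xs_sum (time p) + ze p - xs_sum (time p)) with (ze p) by ring; exact Hb.
    - apply (filterlim_eq (fun p => tpow p kap * xs (time p) - tpow p kap * xs_sum (time p))).
      + apply filter_forall; intros p; ring.
      + eapply filterlim_value; [apply filterlim_Rminus; [apply xs_leading | apply X_leading]|].
        apply Rminus_diag.
    - apply filter_forall; intros p; apply (Hxi p I). }
  exists (fun p => phi2 (xi p) * (tpow p (- (bet - kap / 2)) *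
     (tpow p (2 * bet) * (xs (time p) - xs_sum (time p))))); split.
  - eapply filterlim_value; [apply filterlim_Rmult|].
    + apply (phi2_lim xi mu Lxi).
    + eapply filterlim_Rmult_0; [|apply X_error].
      apply Rpower_time_0; assert (A := kap_lt_bet); assert (B := kap_pos); lra.
    + apply Rmult_0_r.
  - intros p; destruct (Hze p I) as [I1 _]; destruct (Hxi p I) as [I2 _].
    rewrite !Rplus_0_l, !Rplus_0_r in I1.
    replace (xs_sum (time p) + ze p + (xs (time p) - xs_sum (time p))) with (xs (time p) + ze p) in I2 by ring.
    rewrite I2 in I1.
    assert (E : tau p * s p * (tpow p (- (bet - kap / 2)) * tpow p (2 * bet)) = 1).
    { unfold tau, s; rewrite <- !Rpower_plus.
      replace (- bet + - (kap / 2) + (- (bet - kap / 2) + 2 * bet)) with 0 by field.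
      unfold Rpower; rewrite Rmult_0_l, exp_0; reflexivity. }
    replace (tau p * s p * (phi2 (xi p) * (tpow p (- (bet - kap / 2)) *
       (tpow p (2 * bet) * (xs (time p) - xs_sum (time p))))) * dx p)
    with (tau p * s p * (tpow p (- (bet - kap / 2)) * tpow p (2 * bet))
       * (phi2 (xi p) * (xs (time p) - xs_sum (time p)) * dx p)) by ring.
    rewrite E, Rmult_1_l, <- I1; ring.
Qed.

Let a0 := d1_2 (Fk n) 0 0.
Let d0 := d2_2 (Gk n) 0 0.
(* The dissipation acts unequally on the velocity and on the position. With this
   [e0] the term [e0 * t ^ - bet * u * v] of the energy makes its kinetic and its
   potential part change at the same rate [a0 + d0 - kap * nu0 / 2]. *)
Let e0 := (a0 + d0 - kap * nu0 / 2) / 2 - d0.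

Definition energy (t u v : R) : R :=
  v ^ 2 / 2 + (V (xs_sum t + u) - V (xs_sum t) - phi (xs_sum t) * u) - stiffness t * u ^ 2 / 2
  + e0 * Rpower t (- bet) * u * v.

(** Multiplying by [t ^ (3 * kap)] measures the energy against the depth of the
    well, and adds [3 * kap * nu0] to the rate. *)
Definition lyapunov (t u v : R) : R := Rpower t (3 * kap) * energy t u v.

Lemma energy_form : exists r1 r2 : R * R * R -> R,
  r1 --> 0 /\ r2 --> (w 0 * mu) /\
  forall p, 0 < time p -> energy (time p) (dx p) (dy p)
    = dy p ^ 2 / 2 + r1 p * (s p * dx p) * dy p + r2 p * (s p * dx p) ^ 2.
Proof.
  destruct potential_coefficient as (M0 & LM0 & EM0).
  assert (Lc := c_leading).
  exists (fun p => e0 * (k p * s p)),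
    (fun p => / 2 * M0 p - / 2 * (k p * (tpow p bet * stiffness (time p)))).
  assert (Lk := k_lim). assert (Ls := s_lim).
  split; [|split].
  - eapply filterlim_value; [limits | ring].
  - eapply filterlim_value; [limits | field].
  - intros p Hp; unfold energy; rewrite EM0. fold (tau p); rewrite tau_k_s.
    assert (Ec : stiffness (time p) = k p * s p ^ 2 * (tpow p bet * stiffness (time p))).
    { rewrite <- tau_k_s, <- Rmult_assoc; unfold tau; rewrite Rpower_cancel; ring. }
    rewrite Ec at 1; field.
Qed.

(** Three times [kap / t] comes from the factor [t ^ (3 * kap)] of the Lyapunov
    function; the remaining terms are the derivative of the energy. *)
Definition energy_rate (t u v du dv : R) : R :=
  3 * kap * / t * energy t u v + v * dv
  + (phi (xs_sum t + u) - phi (xs_sum t)) * du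
  + (phi (xs_sum t + u) - phi (xs_sum t) - phi1 (xs_sum t) * u) * (/ t * xs_sum_log t)
  - / t * stiffness_log t * u ^ 2 / 2 - stiffness t * u * du
  + e0 * (- bet * / t * Rpower t (- bet) * u * v + Rpower t (- bet) * (du * v + u * dv)).

Lemma lyapunov_derive t u v (uf vf : R -> R) (du dv : R) :
  0 < t -> uf t = u -> vf t = v -> is_derive uf t du -> is_derive vf t dv ->
  is_derive (fun t => lyapunov t (uf t) (vf t)) t
    (Rpower t (3 * kap) * energy_rate t u v du dv).
Proof.
  intros Ht Hu Hv Du Dv.
  assert (DX := X_derive t Ht). assert (Dc := c_derive t Ht).
  assert (EX := is_derive_unique _ _ _ DX). assert (Ec := is_derive_unique _ _ _ Dc).
  assert (Eu := is_derive_unique _ _ _ Du). assert (Ev := is_derive_unique _ _ _ Dv).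
  assert (EV : forall x, Derive V x = phi x) by (intros; apply is_derive_unique, (lf_V force)).
  assert (Ephi : forall x, Derive phi x = phi1 x) by (intros; apply is_derive_unique, (lf_phi force)).
  assert (XV : forall x, ex_derive V x) by (intros; eexists; apply (lf_V force)).
  assert (Xphi : forall x, ex_derive phi x) by (intros; eexists; apply (lf_phi force)).
  assert (Xu : ex_derive uf t) by (eexists; exact Du).
  assert (Xv : ex_derive vf t) by (eexists; exact Dv).
  assert (XX : ex_derive xs_sum t) by (eexists; exact DX).
  assert (Xc : ex_derive stiffness t) by (eexists; exact Dc).
  unfold lyapunov, energy_rate, energy, Rpower. clear DX Dc Du Dv.
  generalize dependent xs_sum; intros X'; intros.
  generalize dependent stiffness; intros c'; intros.
  auto_derive.
  - repeat split; auto.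
  - rewrite ?EV, ?Ephi.
    change (Derive (fun x => X' x) t) with (Derive X' t).
    change (Derive (fun x => c' x) t) with (Derive c' t).
    change (Derive (fun x => uf x) t) with (Derive uf t).
    change (Derive (fun x => vf x) t) with (Derive vf t).
    rewrite ?EX, ?Ec, ?Eu, ?Ev, ?Hu, ?Hv.
    field; lra.
Qed.
Lemma alpha_nu : alpha q n m Fk Gk = a0 + d0 + 5 / 2 * kap * nu0.
Proof.
  unfold alpha; fold a0 d0 nu0; f_equal.
  unfold nu0, kronecker; destruct (Nat.eqb_spec n q) as [E | _]; [|ring].
  unfold kap; rewrite E, plus_INR, mult_INR; simpl (INR 2).
  assert (Hq := INR_q_pos); field; lra.
Qed.

(** In the variables [s * u] and [v], of comparable size, the kinetic and the
    potential part contribute equally to the rate: [a0 + d0] comes from the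
    divergence of the perturbation, [- kap * nu0 / 2] from the slow flattening of
    the well, and [3 * kap * nu0] from its decreasing depth; the sum is [alpha]. *)
Lemma dissipation_form : exists P S R : R * R * R -> R,
  P --> (alpha q n m Fk Gk / 2) /\
  S --> 0 /\
  R --> (w 0 * mu * alpha q n m Fk Gk) /\
  forall p, 0 < time p ->
    let t := time p in let u := dx p in let v := dy p in
    let du := d2_3 H (xs t + u) (ys t + v) 0 + F (xs t + u) (ys t + v) t
       - (d2_3 H (xs t) (ys t) 0 + F (xs t) (ys t) t) in
    let dv := - d1_3 H (xs t + u) (ys t + v) 0 + G (xs t + u) (ys t + v) t
       - (- d1_3 H (xs t) (ys t) 0 + G (xs t) (ys t) t) in
    energy_rate t u v du dv
    = tau p * (P p * v ^ 2 + S p * (s p * u) * v + R p * (s p * u) ^ 2).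
Proof.
  destruct velocity_coefficients as (A & B & LA & LB & EF).
  destruct force_coefficients as (C & D & LC & LD & EG).
  destruct restoring_coefficient as (M & LM & EM).
  destruct potential_coefficient as (M0 & LM0 & EM0).
  destruct drift_coefficient as (Z & LZ & EZ).
  destruct truncation_coefficient as (J & LJ & EJ).
  pose (ct := fun p => tpow p bet * stiffness (time p)).
  pose (c1 := fun p => tpow p bet * stiffness_log (time p)).
  pose (chi := fun p => tpow p kap * xs_sum_log (time p)).
  assert (Lct : ct --> d1_2 (Gk n) 0 0) by exact c_leading.
  assert (Lc1 : c1 --> (- bet * d1_2 (Gk n) 0 0)) by exact clog_leading.
  assert (Lchi : chi --> (- kap * mu)) by exact Xlog_leading.
  assert (Lk := k_lim). assert (Ls := s_lim). assert (Lnu := nu_lim). assert (Ltau := tau_lim).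
  exists (fun p => D p + e0 + e0 * (tau p * B p) + 3 / 2 * kap * nu p).
  exists (fun p => - J p + C p + M p * B p * s p - k p * s p * ct p * B p
     - e0 * bet * (nu p * (k p * s p)) + e0 * (A p * (k p * s p)) + e0 * (k p * s p * D p)
     + 3 * kap * e0 * (nu p * (k p * s p))).
  exists (fun p => M p * A p + nu p * (Z p * chi p) - / 2 * (k p * nu p * c1 p)
     - k p * ct p * A p - e0 * M p - e0 * (k p * s p * J p)
     + e0 * (k p * (ct p + s p * C p)) + 3 * kap * (nu p * (/ 2 * M0 p - / 2 * (k p * ct p)))).
  split; [|split; [|split]].
  - eapply filterlim_value; [limits|].
    rewrite alpha_nu; fold d0; unfold e0; field.
  - eapply filterlim_value; [limits | ring].
  - eapply filterlim_value; [limits|].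
    rewrite alpha_nu; fold a0 d0; unfold e0; field.
  - intros p Hp t u v du dv.
    assert (Edu : du = v + tau p * (A p * u + B p * v)).
    { unfold du; rewrite !(lf_velocity force). unfold t, u, v. rewrite <- EF by assumption. ring. }
    assert (Edv : dv = - (s p ^ 2 * M p * u + tau p * s p * J p * u)
       + (stiffness t * u + tau p * (s p * C p * u + D p * v))).
    { unfold dv; rewrite !(lf_force force). unfold t, u, v. rewrite <- EG, <- EM, <- EJ by assumption.
      ring. }
    assert (Eden : energy t u v = v ^ 2 / 2 + s p ^ 2 * M0 p * u ^ 2 / 2 - stiffness t * u ^ 2 / 2
       + e0 * tau p * u * v).
    { unfold energy, t, u, v; rewrite EM0; reflexivity. }
    assert (Ec : stiffness t = tau p * ct p).
    { unfold ct; rewrite <- Rmult_assoc; unfold tau, t; rewrite Rpower_cancel; ring. }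
    assert (Ec1 : stiffness_log t = tau p * c1 p).
    { unfold c1; rewrite <- Rmult_assoc; unfold tau, t; rewrite Rpower_cancel; ring. }
    assert (Echi : xs_sum_log t = s p ^ 2 * chi p).
    { unfold chi; rewrite <- s_square, <- Rmult_assoc; unfold t; rewrite Rpower_cancel; ring. }
    assert (EM' : phi (xs_sum t + u) - phi (xs_sum t) = s p ^ 2 * M p * u) by apply EM.
    assert (EZ' : phi (xs_sum t + u) - phi (xs_sum t) - phi1 (xs_sum t) * u = Z p * u ^ 2) by apply EZ.
    assert (Et : / t = tau p * nu p) by (apply inv_time; assumption).
    unfold energy_rate; change (Rpower t (- bet)) with (tau p).
    rewrite EZ', EM', Eden, Edu, Edv, Ec, Ec1, Echi, Et, tau_k_s.
    field.
Qed.

Lemma limit_between {P : Type} {U : (P -> Prop) -> Prop} {FU : Filter U} (f : P -> R) (l d : R) :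
  filterlim f U (locally l) -> 0 < d -> U (fun p => l - d < f p < l + d).
Proof.
  intros Hf Hd; generalize (proj1 (filterlim_eps f l) Hf d Hd); apply filter_imp.
  intros p Hp; apply Rabs_def2 in Hp; lra.
Qed.

Lemma quadratic_form_bounds P S R x y :
  P * y ^ 2 + S * x * y + R * x ^ 2 <= (P + Rabs S / 2) * y ^ 2 + (R + Rabs S / 2) * x ^ 2 /\
  (P - Rabs S / 2) * y ^ 2 + (R - Rabs S / 2) * x ^ 2 <= P * y ^ 2 + S * x * y + R * x ^ 2.
Proof.
  assert (HS : Rabs (S * (x * y)) <= Rabs S * ((x ^ 2 + y ^ 2) / 2)).
  { rewrite Rabs_mult; apply Rmult_le_compat_l; [apply Rabs_pos|].
    apply Rabs_le; assert (P1 := pow2_ge_0 (x - y)); assert (P2 := pow2_ge_0 (x + y)); nra. }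
  apply Rabs_le_between in HS; nra.
Qed.

Lemma lyapunov_estimates : alpha q n m Fk Gk < 0 ->
  exists eta t1 c1 c2, 0 < eta /\ 0 < t1 /\ 0 < c1 /\ c1 <= c2 /\
  forall p, t1 < time p -> region_norm kap (time p) (dx p) (dy p) <= eta ->
    c1 * region_norm kap (time p) (dx p) (dy p) <= lyapunov (time p) (dx p) (dy p) /\
    lyapunov (time p) (dx p) (dy p) <= c2 * region_norm kap (time p) (dx p) (dy p) /\
    forall uf vf : R -> R, uf (time p) = dx p -> vf (time p) = dy p ->
      let t := time p in let u := dx p in let v := dy p in
      is_derive uf t (d2_3 H (xs t + u) (ys t + v) 0 + F (xs t + u) (ys t + v) t
         - (d2_3 H (xs t) (ys t) 0 + F (xs t) (ys t) t)) ->
      is_derive vf t (- d1_3 H (xs t + u) (ys t + v) 0 + G (xs t + u) (ys t + v) t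
         - (- d1_3 H (xs t) (ys t) 0 + G (xs t) (ys t) t)) ->
      exists dl, is_derive (fun t => lyapunov t (uf t) (vf t)) t dl /\ dl <= 0.
Proof.
  intros Hal; set (al := alpha q n m Fk Gk) in *.
  destruct dissipation_form as (P & S & R & LP & LS & LR & Ediss); fold al in LP, LR.
  destruct energy_form as (r1 & r2 & L1 & L2 & Een).
  assert (Hg : 0 < w 0 * mu) by (apply Rmult_lt_0_compat; [apply (lf_w force) | exact mu_pos]).
  set (g := w 0 * mu) in *.
  assert (Hga : 0 < g * - al) by (apply Rmult_lt_0_compat; lra).
  (* tolerances for the coefficients of the two quadratic forms: half of it, plus
     half of the cross term, must leave the sign of the diagonal *)
  pose (e1 := Rmin (- al / 4) (g * - al / 2)).
  assert (He1 : 0 < e1) by (apply Rmin_glb_lt; lra).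
  assert (He1a := Rmin_l (- al / 4) (g * - al / 2)). assert (He1b := Rmin_r (- al / 4) (g * - al / 2)).
  fold e1 in He1a, He1b.
  pose (e2 := Rmin (1 / 4) (g / 4)).
  assert (He2 : 0 < e2) by (apply Rmin_glb_lt; lra).
  assert (He2a := Rmin_l (1 / 4) (g / 4)). assert (He2b := Rmin_r (1 / 4) (g / 4)).
  fold e2 in He2a, He2b.
  destruct (filter_and _ _ (limit_between P _ e1 LP He1)
    (filter_and _ _ (limit_between S _ e1 LS He1)
    (filter_and _ _ (limit_between R _ e1 LR He1)
    (filter_and _ _ (limit_between r1 _ e2 L1 He2) (limit_between r2 _ e2 L2 He2)))))
    as (eta & t1 & Heta & Ht1 & Hev).
  exists eta, t1, e2, (1 + 2 * g).
  split; [assumption|]. split; [assumption|]. split; [assumption|]. split; [lra|].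
  intros p Hp Hr; destruct (Hev p Hp Hr) as (B1 & B2 & B3 & B4 & B5).
  assert (Ht : 0 < time p) by lra.
  assert (Hn : region_norm kap (time p) (dx p) (dy p)
     = tpow p (3 * kap) * (dy p ^ 2 + (s p * dx p) ^ 2)).
  { unfold region_norm; rewrite Rpow_mult_distr, <- s_square, Rmult_plus_distr_l, <- Rmult_assoc, <- Rpower_plus.
    do 3 f_equal; ring. }
  assert (Q1 := pow2_ge_0 (dy p)). assert (Q2 := pow2_ge_0 (s p * dx p)).
  assert (P3 := Rpower_pos (time p) (3 * kap)).
  assert (A1 : Rabs (r1 p) <= e2) by (apply Rabs_le; lra).
  assert (A2 : Rabs (S p) <= e1) by (apply Rabs_le; lra).
  destruct (quadratic_form_bounds (/ 2) (r1 p) (r2 p) (s p * dx p) (dy p)) as [U1 W1].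
  destruct (quadratic_form_bounds (P p) (S p) (R p) (s p * dx p) (dy p)) as [U2 _].
  assert (Een' := Een p Ht).
  replace (dy p ^ 2 / 2) with (/ 2 * dy p ^ 2) in Een' by field.
  split; [|split].
  - rewrite Hn; unfold lyapunov; rewrite <- Rmult_assoc, (Rmult_comm e2), Rmult_assoc.
    apply Rmult_le_compat_l; [lra|]. rewrite Een'; eapply Rle_trans; [|exact W1].
    rewrite Rmult_plus_distr_l; apply Rplus_le_compat; apply Rmult_le_compat_r; lra.
  - rewrite Hn; unfold lyapunov; rewrite <- Rmult_assoc, (Rmult_comm (1 + 2 * g)), Rmult_assoc.
    apply Rmult_le_compat_l; [lra|]. rewrite Een'; eapply Rle_trans; [exact U1|].
    rewrite Rmult_plus_distr_l; apply Rplus_le_compat; apply Rmult_le_compat_r; lra.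
  - intros uf vf Hu Hv t u v Du Dv.
    eexists; split; [apply (lyapunov_derive t u v uf vf _ _ Ht Hu Hv Du Dv)|].
    assert (E := Ediss p Ht); cbv zeta in E. unfold t, u, v; rewrite E.
    assert (Hneg : P p * dy p ^ 2 + S p * (s p * dx p) * dy p + R p * (s p * dx p) ^ 2 <= 0).
    { eapply Rle_trans; [exact U2|].
      assert (X1 : (P p + Rabs (S p) / 2) * dy p ^ 2 <= 0 * dy p ^ 2) by (apply Rmult_le_compat_r; lra).
      assert (X2 : (R p + Rabs (S p) / 2) * (s p * dx p) ^ 2 <= 0 * (s p * dx p) ^ 2) by (apply Rmult_le_compat_r; lra).
      lra. }
    assert (Ptau : 0 < tau p) by apply Rpower_pos.
    assert (P4 : 0 < tpow p (3 * kap) * tau p) by (apply Rmult_lt_0_compat; assumption).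
    rewrite <- Rmult_assoc. nra.
Qed.

Theorem solution_attracting : alpha q n m Fk Gk < 0 ->
  attracting_tube (fun x y t => d2_3 H x y 0 + F x y t)
    (fun x y t => - d1_3 H x y 0 + G x y t) T xs ys.
Proof.
  intros Hal.
  destruct (lyapunov_estimates Hal) as (eta & t1 & c1 & c2 & Heta & Ht1 & Hc1 & Hc12 & Hly).
  assert (Hkap := kap_pos).
  exists (Rmax (Rmax t1 T) 1 + 1).
  assert (M1 := Rmax_l (Rmax t1 T) 1). assert (M2 := Rmax_r (Rmax t1 T) 1).
  assert (M3 := Rmax_l t1 T). assert (M4 := Rmax_r t1 T).
  split; [lra|].
  intros t2 eps Ht2 Heps.
  pose (e := Rmin eps 1).
  assert (He : 0 < e) by (apply Rmin_glb_lt; lra).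
  assert (He1 : e <= 1) by apply Rmin_r. assert (Hee : e <= eps) by apply Rmin_l.
  pose (b := Rmin eta (e * e)).
  assert (Hb : 0 < b) by (apply Rmin_glb_lt; nra).
  assert (Hb1 : b <= eta) by apply Rmin_l. assert (Hb2 : b <= e * e) by apply Rmin_r.
  set (A := Rpower t2 (3 * kap) + Rpower t2 (2 * kap)).
  assert (P3 := Rpower_pos t2 (3 * kap)). assert (P2 := Rpower_pos t2 (2 * kap)).
  assert (HA : 0 < A) by (unfold A; lra).
  pose (d := Rmin 1 (c1 * b / (c2 * A))).
  assert (Hc2A : 0 < c2 * A) by (apply Rmult_lt_0_compat; lra).
  assert (Hc1b : 0 < c1 * b) by (apply Rmult_lt_0_compat; lra).
  assert (Hd : 0 < d) by (apply Rmin_glb_lt; [lra | apply Rdiv_lt_0_compat; assumption]).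
  assert (Hd1 : d <= 1) by apply Rmin_l.
  assert (Hd2 : c2 * A * d <= c1 * b).
  { replace (c1 * b) with (c2 * A * (c1 * b / (c2 * A))) by (field; lra).
    apply Rmult_le_compat_l; [lra | apply Rmin_r]. }
  exists d; split; [assumption|].
  intros u v (Hc & Lu & Lv & Hder) Hu Hv.
  pose (N := fun t => region_norm kap t (u t) (v t)).
  assert (Hsq : forall x, Rabs x < d -> x ^ 2 < d).
  { intros x Hx; apply Rabs_def2 in Hx; nra. }
  assert (HN2 : c2 * N t2 < c1 * b).
  { eapply Rlt_le_trans; [|exact Hd2]. rewrite Rmult_assoc; apply Rmult_lt_compat_l; [lra|].
    unfold N, region_norm, A. specialize (Hsq (u t2) Hu) as S1. specialize (Hsq (v t2) Hv) as S2. nra. }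
  assert (Hpos : forall t, 0 <= N t).
  { intros t; unfold N, region_norm. apply Rplus_le_le_0_compat;
    (apply Rmult_le_pos; [left; apply Rpower_pos | apply pow2_ge_0]). }
  assert (Hsmall : forall t, 1 <= t -> u t ^ 2 <= N t /\ v t ^ 2 <= N t).
  { intros t Ht; unfold N, region_norm.
    assert (Q2 : 1 <= Rpower t (2 * kap)) by (apply Rpower_ge_1; lra).
    assert (Q3 : 1 <= Rpower t (3 * kap)) by (apply Rpower_ge_1; lra).
    assert (U1 := pow2_ge_0 (u t)). assert (U2 := pow2_ge_0 (v t)). nra. }
  assert (HRp : forall e t, 0 < t -> continuous (fun t => Rpower t e) t).
  { intros e' t Ht; eapply is_derive_continuous. unfold Rpower; auto_derive; [assumption | reflexivity]. }
  assert (HRpd : forall e t, 0 < t -> filterlim (fun t => Rpower t e) (at_right t) (locally (Rpower t e))).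
  { intros e' t Ht; apply (right_limit_of_continuous (fun t => Rpower t e')), HRp, Ht. }
  assert (Hright : forall h : R -> R, filterlim h (at_right t2) (locally (h t2)) ->
    filterlim (fun t => h t ^ 2) (at_right t2) (locally (h t2 ^ 2))).
  { intros h Hh; simpl; apply filterlim_Rmult; [exact Hh|].
    apply filterlim_Rmult; [exact Hh | apply filterlim_const]. }
  assert (Hstay : forall t3 t, t2 <= t <= t3 -> N t < b).
  { intros t3; apply continuous_induction.
    - apply filterlim_Rplus; (apply filterlim_Rmult; [apply HRpd; lra | apply Hright; assumption]).
    - intros t Ht; destruct (Hc t ltac:(lra)) as [Cu Cv].
      assert (HR3 := HRp (3 * kap) t ltac:(lra)). assert (HR2 := HRp (2 * kap) t ltac:(lra)).
      unfold continuous in *; unfold N, region_norm; simpl; limits.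
    - specialize (Hpos t2); nra.
    - intros t Ht Hbelow.
      assert (Hly' : forall r, t2 <= r <= t ->
        let p := (r, u r, v r) : R * R * R in t1 < time p /\ region_norm kap (time p) (dx p) (dy p) <= eta).
      { intros r Hr p; split; [cbn; lra|]. specialize (Hbelow r Hr).
        change (N r <= eta); lra. }
      assert (Hdl : forall r, exists dl, t2 < r <= t ->
        is_derive (fun t => lyapunov t (u t) (v t)) r dl /\ dl <= 0).
      { intros r; destruct (classic (t2 < r <= t)) as [Hr | Hr]; [|exists 0; intros; contradiction].
        destruct (Hly' r ltac:(lra)) as [L1 L2].
        destruct (Hly _ L1 L2) as (_ & _ & L3).
        destruct (Hsmall r ltac:(lra)) as [S1 S2]. specialize (Hbelow r ltac:(lra)).
        destruct (Hder r ltac:(lra)) as [D1 D2].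
        { apply Rabs_le; nra. }
        { apply Rabs_le; nra. }
        destruct (L3 u v eq_refl eq_refl D1 D2) as (dl & E1 & E2).
        exists dl; intros _; split; assumption. }
      destruct (choose_function (fun r dl => t2 < r <= t ->
        is_derive (fun t => lyapunov t (u t) (v t)) r dl /\ dl <= 0) Hdl) as [dl Edl].
      assert (Hmono : - lyapunov t2 (u t2) (v t2) <= - lyapunov t (u t) (v t)).
      { apply (nondecreasing_from_right (fun t => - lyapunov t (u t) (v t)) (fun r => - dl r) t2 t).
        - lra.
        - intros r Hr; apply (is_derive_opp (V := R_NormedModule) (fun t => lyapunov t (u t) (v t))), Edl, Hr.
        - intros r Hr; destruct (Edl r Hr); lra.
        - assert (HX : forall h : R -> R, (exists l, is_derive h t2 l) ->
            filterlim h (at_right t2) (locally (h t2))).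
          { intros h [l Hh]; apply right_limit_of_continuous; eapply is_derive_continuous, Hh. }
          assert (HV : forall (h g : R -> R) l, is_derive h (g t2) l ->
            filterlim g (at_right t2) (locally (g t2)) ->
            filterlim (fun t => h (g t)) (at_right t2) (locally (h (g t2)))).
          { intros h g' l Hh Hg'; eapply filterlim_comp; [exact Hg' | eapply is_derive_continuous, Hh]. }
          assert (LX : filterlim xs_sum (at_right t2) (locally (xs_sum t2))) by (apply HX; eexists; apply X_derive; lra).
          assert (Lc : filterlim stiffness (at_right t2) (locally (stiffness t2))) by (apply HX; eexists; apply c_derive; lra).
          assert (LXu : filterlim (fun t => xs_sum t + u t) (at_right t2) (locally (xs_sum t2 + u t2)))
            by (apply filterlim_Rplus; assumption).
          assert (L1 := HV V (fun t => xs_sum t + u t) _ (lf_V force _) LXu).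
          assert (L2 := HV V xs_sum _ (lf_V force _) LX).
          assert (L3 := HV phi xs_sum _ (lf_phi force _) LX).
          assert (Lu2 := Hright u Lu). assert (Lv2 := Hright v Lv).
          assert (LR1 := HRpd (3 * kap) t2 ltac:(lra)). assert (LR2 := HRpd (- bet) t2 ltac:(lra)).
          clear - Lu Lv LX Lc L1 L2 L3 Lu2 Lv2 LR1 LR2.
          unfold lyapunov, energy, Rdiv; limits. }
      destruct (Hly' t ltac:(lra)) as [L1 L2]. destruct (Hly _ L1 L2) as (L3 & _ & _).
      destruct (Hly' t2 ltac:(lra)) as [L1' L2']. destruct (Hly _ L1' L2') as (_ & L4 & _).
      change (c1 * N t <= lyapunov t (u t) (v t)) in L3.
      change (lyapunov t2 (u t2) (v t2) <= c2 * N t2) in L4.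
      apply (Rmult_lt_reg_l c1); lra. }
  intros t Ht; specialize (Hstay t t ltac:(lra)).
  destruct (Hsmall t ltac:(lra)) as [S1 S2].
  split; apply Rabs_def1; nra.
Qed.

End Stability.

(** * Counting lattice points *)

Local Open Scope nat_scope.

Lemma filter_filter_length {A : Type} (P Q : A -> bool) (l : list A) :
  length (filter P (filter Q l)) <= length (filter P l).
Proof.
  induction l as [|x l IH]; cbn; [lia|].
  destruct (Q x); cbn; destruct (P x); cbn; lia.
Qed.

Lemma length_le_classes {A : Type} (f : A -> nat) (Q B : nat) : forall l,
  (forall x, In x l -> f x < Q) ->
  (forall b, b < Q -> length (filter (fun x => f x =? b) l) <= B) ->
  length l <= Q * B.
Proof.
  induction Q as [|Q IH]; intros l Hf Hb.
  - destruct l as [|x l]; [cbn; lia|]. specialize (Hf x (or_introl eq_refl)); lia.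
  - assert (Hl : length (filter (fun x => f x =? Q) l)
       + length (filter (fun x => negb (f x =? Q)) l) = length l) by apply filter_length.
    assert (H1 := Hb Q (Nat.lt_succ_diag_r Q)).
    assert (H2 : length (filter (fun x => negb (f x =? Q)) l) <= Q * B).
    { apply IH.
      - intros x Hx; apply filter_In in Hx; destruct Hx as [Hx HQ].
        specialize (Hf x Hx); destruct (Nat.eqb_spec (f x) Q); cbn in HQ; [discriminate | lia].
      - intros b Hb'; eapply Nat.le_trans; [apply filter_filter_length | apply Hb; lia]. }
    lia.
Qed.

Lemma exists_min {A : Type} (f : A -> nat) (l : list A) : l <> nil ->
  exists x, In x l /\ forall y, In y l -> f x <= f y.
Proof.
  induction l as [|a l IH]; [congruence|]; intros _.
  destruct l as [|b l].
  - exists a; split; [now left|]; intros y [<- | []]; lia.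
  - destruct IH as (x & Hx & Hmin); [congruence|].
    destruct (le_lt_dec (f a) (f x)).
    + exists a; split; [now left|]; intros y [<- | Hy]; [lia|]; specialize (Hmin y Hy); lia.
    + exists x; split; [now right|]; intros y [<- | Hy]; [lia | apply Hmin, Hy].
Qed.

Lemma exists_max {A : Type} (f : A -> nat) (l : list A) : l <> nil ->
  exists x, In x l /\ forall y, In y l -> f y <= f x.
Proof.
  induction l as [|a l IH]; [congruence|]; intros _.
  destruct l as [|b l].
  - exists a; split; [now left|]; intros y [<- | []]; lia.
  - destruct IH as (x & Hx & Hmax); [congruence|].
    destruct (le_lt_dec (f x) (f a)).
    + exists a; split; [now left|]; intros y [<- | Hy]; [lia|]; specialize (Hmax y Hy); lia.
    + exists x; split; [now right|]; intros y [<- | Hy]; [lia | apply Hmax, Hy].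
Qed.

Lemma mod_close_eq a b g : a mod (S g) = b mod (S g) -> a <= b + g -> b <= a + g -> a = b.
Proof.
  intros Hm H1 H2.
  assert (Ea := Nat.div_mod_eq a (S g)). assert (Eb := Nat.div_mod_eq b (S g)).
  rewrite Hm in Ea.
  set (r := b mod S g) in *; set (x := a / S g) in *; set (y := b / S g) in *.
  assert (x = y); [|congruence]. nia.
Qed.

(** If the extreme columns are [W] apart, then each column is at distance at least
    [W / 2] from one of them, so that it spans at most [2 * S / W] by the bound on
    triangles with a vertical side. Hence the column and the height modulo this
    span determine a point. *)
Lemma few_lattice_points (R S : nat) (l : list (nat * nat)) :
  NoDup l ->
  (forall p p', In p l -> In p' l -> fst p <= fst p' + R /\ snd p <= snd p' + R) ->
  (forall p p' z, In p l -> In p' l -> In z l -> fst p = fst p' ->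
     (fst p - fst z) * (snd p - snd p') <= S /\ (fst z - fst p) * (snd p - snd p') <= S) ->
  length l <= 4 * S + R + 1.
Proof.
  intros Hnd Hdiam Harea.
  destruct l as [|p0 l0]; [cbn; lia|].
  set (l := p0 :: l0) in *.
  assert (Hne : l <> nil) by (unfold l; congruence).
  destruct (exists_min fst l Hne) as (a & Ha & Hmin).
  destruct (exists_max fst l Hne) as (z & Hz & Hmax).
  set (W := fst z - fst a).
  assert (Haz : fst a <= fst z) by (apply Hmin, Hz).
  assert (HWR : W <= R) by (unfold W; specialize (proj1 (Hdiam z a Hz Ha)); lia).
  assert (Hg : exists g, (W + 1) * (g + 1) <= 4 * S + R + 1 /\
    forall p p', In p l -> In p' l -> fst p = fst p' -> snd p <= snd p' + g).
  { destruct (Nat.eq_dec W 0) as [HW | HW].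
    - exists R; split; [rewrite HW; lia|]. intros p p' Hp Hp' _; apply (Hdiam p p' Hp Hp').
    - exists (2 * S / W).
      assert (Hdiv : W * (2 * S / W) <= 2 * S) by (apply Nat.Div0.mul_div_le).
      split; [nia|].
      intros p p' Hp Hp' E.
      destruct (Harea p p' a Hp Hp' Ha E) as [A1 _].
      destruct (Harea p p' z Hp Hp' Hz E) as [_ A2].
      assert (Hw : W * (snd p - snd p') <= 2 * S).
      { specialize (Hmin p Hp); specialize (Hmax p Hp).
        replace W with ((fst p - fst a) + (fst z - fst p)) by (unfold W; lia). lia. }
      assert (Hw' : snd p - snd p' <= 2 * S / W) by (apply Nat.div_le_lower_bound; lia).
      lia. }
  destruct Hg as (g & Hbound & Hcol).
  pose (h := fun p : nat * nat => (fst p - fst a, snd p mod (g + 1))).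
  assert (Hinj : NoDup (map h l)).
  { apply NoDup_map_NoDup_ForallPairs; [|assumption].
    intros [i j] [i' j'] Hp Hp' E; injection E as E1 E2; cbn in *.
    specialize (Hmin _ Hp) as M1; specialize (Hmin _ Hp') as M2; cbn in M1, M2.
    assert (Ei : i = i') by lia.
    assert (C1 := Hcol _ _ Hp Hp' Ei); assert (C2 := Hcol _ _ Hp' Hp (eq_sym Ei)); cbn in C1, C2.
    rewrite Nat.add_1_r in E2.
    f_equal; [exact Ei | apply (mod_close_eq _ _ g); assumption]. }
  assert (Hincl : incl (map h l) (list_prod (seq 0 (W + 1)) (seq 0 (g + 1)))).
  { intros y Hy; apply in_map_iff in Hy; destruct Hy as (p & <- & Hp); unfold h.
    apply in_prod; apply in_seq; cbn [Nat.add].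
    - specialize (Hmax p Hp); unfold W; lia.
    - split; [lia|]. apply Nat.mod_upper_bound; lia. }
  assert (Hlen := NoDup_incl_length Hinj Hincl).
  rewrite length_map, length_prod, !length_seq in Hlen. lia.
Qed.

Lemma NoDup_list_prod {A B : Type} (l : list A) (l' : list B) :
  NoDup l -> NoDup l' -> NoDup (list_prod l l').
Proof.
  intros Hl Hl'; induction Hl as [|a l Ha Hl IH]; cbn; [constructor|].
  apply NoDup_app; [|exact IH|].
  - apply FinFun.Injective_map_NoDup; [|assumption]. intros x y E; congruence.
  - intros [x y] Hx Hy. apply in_map_iff in Hx; destruct Hx as (y' & E & _); injection E as <- _.
    apply in_prod_iff in Hy; tauto.
Qed.

Theorem lattice_pigeonhole (N Q R S : nat) (box : nat -> nat -> nat) :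
  (forall i j, i < N -> j < N -> box i j < Q) ->
  (forall i j i' j', i < N -> j < N -> i' < N -> j' < N -> box i j = box i' j' ->
     i <= i' + R /\ j <= j' + R) ->
  (forall i j j' i' l, i < N -> j < N -> j' < N -> i' < N -> l < N ->
     box i j = box i j' -> box i j = box i' l ->
     (i - i') * (j - j') <= S /\ (i' - i) * (j - j') <= S) ->
  N * N <= Q * (4 * S + R + 1).
Proof.
  intros HQ Hdiam Harea.
  set (grid := list_prod (seq 0 N) (seq 0 N)).
  assert (Hin : forall p, In p grid -> fst p < N /\ snd p < N).
  { intros [i j] Hp; apply in_prod_iff in Hp; rewrite !in_seq in Hp; cbn in *; lia. }
  assert (Hlen : length grid = N * N) by (unfold grid; rewrite length_prod, !length_seq; reflexivity).
  rewrite <- Hlen.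
  apply (length_le_classes (fun p => box (fst p) (snd p))).
  - intros p Hp; apply Hin in Hp; apply HQ; apply Hp.
  - intros b Hb; apply few_lattice_points.
    + apply NoDup_filter, NoDup_list_prod; apply seq_NoDup.
    + intros p p' Hp Hp'; apply filter_In in Hp, Hp'.
      destruct Hp as [Hp Eb], Hp' as [Hp' Eb']; apply Nat.eqb_eq in Eb, Eb'.
      apply Hin in Hp, Hp'; apply Hdiam; try tauto; congruence.
    + intros [i j] [i' j'] [i'' l] Hp Hp' Hz E; cbn in E; subst i'.
      apply filter_In in Hp, Hp', Hz.
      destruct Hp as [Hp Eb], Hp' as [Hp' Eb'], Hz as [Hz Ez]; cbn in *.
      apply Nat.eqb_eq in Eb, Eb', Ez; apply Hin in Hp, Hp', Hz; cbn in *.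
      apply (Harea i j j' i'' l); try tauto; congruence.
Qed.

Local Close Scope nat_scope.

(** * Expansion of area *)

Section Expansion.

Variables f g f1 f2 g1 g2 : R -> R -> R -> R.
Variables t0 r c : R.
Hypothesis f_taylor : taylor_box f f1 f2.
Hypothesis g_taylor : taylor_box g g1 g2.
Hypothesis t0_ge_1 : 1 <= t0.
Hypothesis c_pos : 0 < c.
Hypothesis expanding : forall t x y, t0 <= t -> Rabs x <= r -> Rabs y <= r ->
  c / t <= f1 x y t + g2 x y t.

Definition trajectory (x y : R -> R) : Prop :=
  filterlim x (at_right t0) (locally (x t0)) /\
  filterlim y (at_right t0) (locally (y t0)) /\
  (forall t, t0 < t -> is_derive x t (f (x t) (y t) t) /\ is_derive y t (g (x t) (y t) t)) /\
  forall t, t0 <= t -> Rabs (x t) <= r /\ Rabs (y t) <= r.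

Lemma trajectory_right_limits x y t : trajectory x y -> t0 <= t ->
  filterlim x (at_right t) (locally (x t)) /\ filterlim y (at_right t) (locally (y t)).
Proof.
  intros (Lx & Ly & Hd & _) Ht.
  destruct (Req_dec t0 t) as [<- | Hne]; [split; assumption|].
  destruct (Hd t ltac:(lra)) as [D1 D2].
  split; apply right_limit_of_continuous; eapply is_derive_continuous; eassumption.
Qed.

(** Gronwall's inequality in backward time. *)
Lemma trajectories_were_close T1 : t0 <= T1 -> exists K, 0 < K /\
  forall x y x' y' h, trajectory x y -> trajectory x' y' -> 0 <= h ->
    Rabs (x' T1 - x T1) <= h -> Rabs (y' T1 - y T1) <= h ->
    forall t, t0 <= t <= T1 -> Rabs (x' t - x t) <= K * h /\ Rabs (y' t - y t) <= K * h.
Proof.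
  intros HT1.
  destruct (taylor_box_lipschitz f f1 f2 f_taylor r t0 T1) as (L1 & HL1 & Hl1); [lra|].
  destruct (taylor_box_lipschitz g g1 g2 g_taylor r t0 T1) as (L2 & HL2 & Hl2); [lra|].
  pose (L := L1 + L2).
  assert (HL : 0 < L) by (unfold L; lra).
  exists (2 * exp (2 * L * (T1 - t0))).
  split; [assert (P := exp_pos (2 * L * (T1 - t0))); lra|].
  intros x y x' y' h Hxy Hxy' Hh Ha Hb t Ht.
  destruct Hxy as (Lx & Ly & Hd & Hr). destruct Hxy' as (Lx' & Ly' & Hd' & Hr').
  pose (a := fun s => x' s - x s). pose (b := fun s => y' s - y s).
  pose (N := fun s => a s * a s + b s * b s).
  destruct (trajectory_right_limits x y t) as [Rx Ry]; [repeat split; (assumption || apply Hd || apply Hr); assumption | lra |].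
  destruct (trajectory_right_limits x' y' t) as [Rx' Ry']; [repeat split; (assumption || apply Hd' || apply Hr'); assumption | lra |].
  assert (Hgr : N t <= N T1 * exp (4 * L * (T1 - t))).
  { apply (gronwall_squares a b (fun s => f (x' s) (y' s) s - f (x s) (y s) s)
      (fun s => g (x' s) (y' s) s - g (x s) (y s) s)); try lra.
    - intros s Hs; destruct (Hd s ltac:(lra)); destruct (Hd' s ltac:(lra)).
      split; apply is_derive_Rminus; assumption.
    - intros s Hs; destruct (Hr s ltac:(lra)) as [B1 B2]; destruct (Hr' s ltac:(lra)) as [B1' B2'].
      specialize (Hl1 s _ _ _ _ ltac:(lra) B1 B2 B1' B2').
      specialize (Hl2 s _ _ _ _ ltac:(lra) B1 B2 B1' B2').
      fold (a s) (b s) in Hl1, Hl2.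
      assert (P : 0 <= Rabs (a s) + Rabs (b s)) by (apply Rplus_le_le_0_compat; apply Rabs_pos).
      unfold L; split; nra.
    - apply filterlim_Rminus; assumption.
    - apply filterlim_Rminus; assumption. }
  pose (E := exp (2 * L * (T1 - t0))).
  assert (HE : 0 < E) by apply exp_pos.
  assert (HEE : exp (4 * L * (T1 - t)) <= E * E).
  { unfold E; rewrite <- exp_plus.
    destruct (Req_dec t t0) as [-> | Hne].
    - right; f_equal; ring.
    - left; apply exp_increasing; nra. }
  assert (HNT : N T1 <= 2 * (h * h)).
  { unfold N; fold (a T1) in Ha; fold (b T1) in Hb.
    apply Rabs_le_between in Ha, Hb; nra. }
  assert (HNt : N t <= (2 * E * h) ^ 2).
  { assert (0 <= N T1) by (unfold N; nra).
    assert (N T1 * exp (4 * L * (T1 - t)) <= 2 * (h * h) * (E * E)).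
    { apply Rmult_le_compat; try assumption. left; apply exp_pos. }
    nra. }
  assert (H0 : 0 <= 2 * E * h) by nra.
  fold E; fold (a t) (b t). unfold N in HNt.
  split; apply Rabs_le; split; nra.
Qed.

Definition area (x0 y0 x1 y1 x2 y2 : R) : R :=
  (x1 - x0) * (y2 - y0) - (x2 - x0) * (y1 - y0).

Lemma Rabs_mult_le a b A B : Rabs a <= A -> Rabs b <= B -> Rabs (a * b) <= A * B.
Proof.
  intros Ha Hb; rewrite Rabs_mult; apply Rmult_le_compat; try apply Rabs_pos; assumption.
Qed.

(** Liouville's theorem for small triangles, without differentiating the flow with
    respect to initial data: the Jacobian at one vertex multiplies the area by its
    trace, and the Taylor remainders are of third order in the diameter. The square
    of the area, of fourth order, is used because its growth does not depend on
    the orientation. *)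
Lemma small_triangles_expand T1 : t0 <= T1 -> exists K, 0 < K /\
  forall x0 y0 x1 y1 x2 y2 rho,
    trajectory x0 y0 -> trajectory x1 y1 -> trajectory x2 y2 -> 0 <= rho ->
    (forall t, t0 <= t <= T1 ->
       Rabs (x1 t - x0 t) <= rho /\ Rabs (y1 t - y0 t) <= rho /\
       Rabs (x2 t - x0 t) <= rho /\ Rabs (y2 t - y0 t) <= rho) ->
    area (x0 t0) (y0 t0) (x1 t0) (y1 t0) (x2 t0) (y2 t0) ^ 2 <=
      Rpower t0 (2 * c) * Rpower T1 (- (2 * c)) *
        area (x0 T1) (y0 T1) (x1 T1) (y1 T1) (x2 T1) (y2 T1) ^ 2
      + K * rho ^ 5.
Proof.
  intros HT1.
  destruct (f_taylor r t0 T1) as (C1 & HC1 & Hf); [lra|].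
  destruct (g_taylor r t0 T1) as (C2 & HC2 & Hg); [lra|].
  pose (C := C1 + C2).
  assert (HC : 0 < C) by (unfold C; lra).
  exists (Rpower t0 (2 * c) * (64 * C * T1)).
  split; [apply Rmult_lt_0_compat; [apply Rpower_pos | nra]|].
  intros x0 y0 x1 y1 x2 y2 rho (Lx0 & Ly0 & Hd0 & Hr0) (Lx1 & Ly1 & Hd1 & Hr1)
    (Lx2 & Ly2 & Hd2 & Hr2) Hrho Hclose.
  pose (D := fun t => (x1 t - x0 t) * (y2 t - y0 t) - (x2 t - x0 t) * (y1 t - y0 t)).
  pose (dD := fun t =>
    ((f (x1 t) (y1 t) t - f (x0 t) (y0 t) t) * (y2 t - y0 t)
      + (x1 t - x0 t) * (g (x2 t) (y2 t) t - g (x0 t) (y0 t) t))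
    - ((f (x2 t) (y2 t) t - f (x0 t) (y0 t) t) * (y1 t - y0 t)
      + (x2 t - x0 t) * (g (x1 t) (y1 t) t - g (x0 t) (y0 t) t))).
  assert (DD : forall t, t0 < t -> is_derive D t (dD t)).
  { intros t Ht; destruct (Hd0 t Ht), (Hd1 t Ht), (Hd2 t Ht).
    apply (is_derive_Rminus (fun t => (x1 t - x0 t) * (y2 t - y0 t))
      (fun t => (x2 t - x0 t) * (y1 t - y0 t))).
    - apply (is_derive_Rmult (fun t => x1 t - x0 t) (fun t => y2 t - y0 t));
      apply is_derive_Rminus; assumption.
    - apply (is_derive_Rmult (fun t => x2 t - x0 t) (fun t => y1 t - y0 t));
      apply is_derive_Rminus; assumption. }
  pose (W := fun t => Rpower t (- (2 * c))).
  assert (DW : forall t, 0 < t -> is_derive W t (- (2 * c) / t * W t)).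
  { intros t Ht; unfold W, Rpower; auto_derive; [assumption | field; lra]. }
  pose (e := 64 * C * rho ^ 5).
  assert (He : 0 <= e) by (apply Rmult_le_pos; [lra | apply pow_le; assumption]).
  assert (Hmono : D t0 * D t0 * W t0 + e * t0 <= D T1 * D T1 * W T1 + e * T1).
  { apply (nondecreasing_from_right (fun t => D t * D t * W t + e * t)
      (fun t => (2 * D t * dD t - 2 * c / t * (D t * D t)) * W t + e)).
    - assumption.
    - intros t Ht; specialize (DD t ltac:(lra)); specialize (DW t ltac:(lra)).
      apply is_derive_Rplus.
      + replace ((2 * D t * dD t - 2 * c / t * (D t * D t)) * W t) with
          ((dD t * D t + D t * dD t) * W t + D t * D t * (- (2 * c) / t * W t)) by (field; lra).
        apply (is_derive_Rmult (fun t => D t * D t) W); [|exact DW].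
        apply is_derive_Rmult; assumption.
      + auto_derive; [trivial | ring].
    - intros t Ht.
      destruct (Hr0 t ltac:(lra)) as [B0 B0']; destruct (Hr1 t ltac:(lra)) as [B1 B1'];
      destruct (Hr2 t ltac:(lra)) as [B2 B2'].
      destruct (Hclose t ltac:(lra)) as (M1 & N1 & M2 & N2).
      assert (Hdiv := expanding t (x0 t) (y0 t) ltac:(lra) B0 B0').
      destruct (Hf t _ _ _ _ ltac:(lra) B0 B0' B1 B1') as (_ & _ & F1).
      destruct (Hf t _ _ _ _ ltac:(lra) B0 B0' B2 B2') as (_ & _ & F2).
      destruct (Hg t _ _ _ _ ltac:(lra) B0 B0' B1 B1') as (_ & _ & G1).
      destruct (Hg t _ _ _ _ ltac:(lra) B0 B0' B2 B2') as (_ & _ & G2).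
      unfold D, dD.
      set (a1 := x1 t - x0 t) in *; set (b1 := y1 t - y0 t) in *.
      set (a2 := x2 t - x0 t) in *; set (b2 := y2 t - y0 t) in *.
      set (p := f1 (x0 t) (y0 t) t) in *; set (p' := f2 (x0 t) (y0 t) t) in *.
      set (q := g1 (x0 t) (y0 t) t) in *; set (q' := g2 (x0 t) (y0 t) t) in *.
      set (u1 := f (x1 t) (y1 t) t - f (x0 t) (y0 t) t) in *.
      set (u2 := f (x2 t) (y2 t) t - f (x0 t) (y0 t) t) in *.
      set (v1 := g (x1 t) (y1 t) t - g (x0 t) (y0 t) t) in *.
      set (v2 := g (x2 t) (y2 t) t - g (x0 t) (y0 t) t) in *.
      assert (Hsq : forall a b Ci z, 0 < Ci <= C -> Rabs a <= rho -> Rabs b <= rho ->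
        Rabs z <= Ci * (Rabs a + Rabs b) ^ 2 -> Rabs z <= 4 * C * rho ^ 2).
      { intros a b Ci z HCi Ha Hb Hz; eapply Rle_trans; [exact Hz|].
        assert (P1 := Rabs_pos a); assert (P2 := Rabs_pos b).
        assert ((Rabs a + Rabs b) ^ 2 <= (2 * rho) ^ 2) by (apply pow_incr; lra).
        apply Rle_trans with (C * (2 * rho) ^ 2); [|right; ring].
        apply Rmult_le_compat; try lra; apply pow2_ge_0. }
      assert (HC1' : 0 < C1 <= C) by (unfold C; lra).
      assert (HC2' : 0 < C2 <= C) by (unfold C; lra).
      assert (E1 := Hsq _ _ _ _ HC1' M1 N1 F1). assert (E2 := Hsq _ _ _ _ HC1' M2 N2 F2).
      assert (E3 := Hsq _ _ _ _ HC2' M1 N1 G1). assert (E4 := Hsq _ _ _ _ HC2' M2 N2 G2).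
      set (z1 := u1 - p * a1 - p' * b1) in *. set (z2 := u2 - p * a2 - p' * b2) in *.
      set (z3 := v1 - q * a1 - q' * b1) in *. set (z4 := v2 - q * a2 - q' * b2) in *.
      pose (err := z1 * b2 + a1 * z4 - z2 * b1 - a2 * z3).
      assert (Edec : u1 * b2 + a1 * v2 - (u2 * b1 + a2 * v1)
        = (p + q') * (a1 * b2 - a2 * b1) + err).
      { unfold err, z1, z2, z3, z4; ring. }
      assert (Herr : Rabs err <= 16 * C * rho ^ 3).
      { unfold err.
        assert (R1 := Rabs_mult_le _ _ _ _ E1 N2). assert (R2 := Rabs_mult_le _ _ _ _ M1 E4).
        assert (R3 := Rabs_mult_le _ _ _ _ E2 N1). assert (R4 := Rabs_mult_le _ _ _ _ M2 E3).
        apply Rabs_le_between in R1, R2, R3, R4. apply Rabs_le.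
        replace (16 * C * rho ^ 3) with
          (4 * C * rho ^ 2 * rho + rho * (4 * C * rho ^ 2) + 4 * C * rho ^ 2 * rho + rho * (4 * C * rho ^ 2)) by ring.
        lra. }
      assert (HD : Rabs (a1 * b2 - a2 * b1) <= 2 * rho ^ 2).
      { assert (R1 := Rabs_mult_le _ _ _ _ M1 N2). assert (R2 := Rabs_mult_le _ _ _ _ M2 N1).
        apply Rabs_le_between in R1, R2. apply Rabs_le.
        replace (2 * rho ^ 2) with (rho * rho + rho * rho) by ring. lra. }
      rewrite Edec.
      set (d := a1 * b2 - a2 * b1) in *.
      assert (Hde := Rabs_mult_le _ _ _ _ HD Herr).
      apply Rabs_le_between in Hde.
      assert (Hw : 0 < W t <= 1).
      { split; [apply Rpower_pos|]. unfold W; rewrite Rpower_Ropp.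
        rewrite <- Rinv_1; apply Rinv_le_contravar; [lra|]. apply Rpower_ge_1; lra. }
      assert (Hee : 2 * (2 * rho ^ 2 * (16 * C * rho ^ 3)) = e) by (unfold e; ring).
      assert (Hdd : 0 <= d * d) by exact (Rle_0_sqr d).
      assert (Hk : c / t * (d * d) <= (p + q') * (d * d)) by (apply Rmult_le_compat_r; assumption).
      assert (Hlow : - e <= 2 * d * ((p + q') * d + err) - 2 * c / t * (d * d)).
      { replace (2 * c / t) with (2 * (c / t)) by (field; lra). lra. }
      assert (- e * W t <= (2 * d * ((p + q') * d + err) - 2 * c / t * (d * d)) * W t)
        by (apply Rmult_le_compat_r; lra).
      assert (e * W t <= e * 1) by (apply Rmult_le_compat_l; lra).
      lra.
    - apply filterlim_Rplus.
      + apply filterlim_Rmult.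
        * apply filterlim_Rmult; apply filterlim_Rminus; apply filterlim_Rmult;
          apply filterlim_Rminus; assumption.
        * apply (right_limit_of_continuous W). eapply is_derive_continuous, DW; lra.
      + apply filterlim_Rmult; [apply filterlim_const|].
        apply (right_limit_of_continuous (fun t => t)), continuous_id. }
  assert (HW0 : Rpower t0 (2 * c) * W t0 = 1).
  { unfold W; rewrite Rmult_comm; apply Rpower_cancel. }
  assert (P0 := Rpower_pos t0 (2 * c)).
  change (D t0 ^ 2 <= Rpower t0 (2 * c) * W T1 * D T1 ^ 2
     + Rpower t0 (2 * c) * (64 * C * T1) * rho ^ 5).
  replace (D t0 ^ 2) with (Rpower t0 (2 * c) * W t0 * (D t0 * D t0)) by (rewrite HW0; ring).
  replace (Rpower t0 (2 * c) * W T1 * D T1 ^ 2 + Rpower t0 (2 * c) * (64 * C * T1) * rho ^ 5)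
    with (Rpower t0 (2 * c) * (D T1 * D T1 * W T1 + e * T1)) by (unfold e; ring).
  rewrite Rmult_assoc; apply Rmult_le_compat_l; [lra|].
  assert (0 <= e * t0) by (apply Rmult_le_pos; lra). lra.
Qed.

Lemma INR_sub_mult_le a b d e (B : R) :
  Rabs ((INR b - INR a) * (INR e - INR d)) <= B -> INR ((a - b) * (d - e)) <= B.
Proof.
  intros HB; assert (H0 := Rabs_pos ((INR b - INR a) * (INR e - INR d))).
  destruct (le_lt_dec a b); [replace (a - b)%nat with O by lia; simpl; lra|].
  destruct (le_lt_dec d e); [replace (d - e)%nat with O by lia; rewrite Nat.mul_0_r; simpl; lra|].
  rewrite mult_INR, !minus_INR by lia.
  apply Rabs_le_between in HB; lra.
Qed.

Lemma floor_exists : exists fl : R -> nat, forall x, 0 <= x -> INR (fl x) <= x < INR (fl x) + 1.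
Proof.
  assert (H : forall x, exists n : nat, 0 <= x -> INR n <= x < INR n + 1).
  { intros x; destruct (Rle_lt_dec 0 x) as [Hx | Hx].
    - destruct (nfloor_ex x Hx) as [n Hn]; exists n; auto.
    - exists O; lra. }
  exists (fun x => proj1_sig (constructive_indefinite_description _ (H x))).
  intros x; apply (proj2_sig (constructive_indefinite_description _ (H x))).
Qed.

Lemma floor_le_of_INR a (x : R) (n : nat) : INR a <= x -> x < INR n + 1 -> (a <= n)%nat.
Proof.
  intros H1 H2; apply Nat.lt_succ_r, INR_lt; rewrite S_INR; lra.
Qed.

Lemma expansion_time theta : 0 < theta < 1 ->
  exists T1, t0 <= T1 /\ Rpower t0 (2 * c) * Rpower T1 (- (2 * c)) = theta ^ 2.
Proof.
  intros Hth.
  assert (Hi : 1 <= / theta) by (rewrite <- Rinv_1; apply Rinv_le_contravar; lra).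
  assert (Hic : 0 < / c) by (apply Rinv_0_lt_compat; assumption).
  exists (t0 * Rpower (/ theta) (/ c)); split.
  - rewrite <- (Rmult_1_r t0) at 1; apply Rmult_le_compat_l; [lra|].
    apply Rpower_ge_1; lra.
  - rewrite <- Rpower_mult_distr; [|lra | apply Rpower_pos].
    rewrite <- Rmult_assoc, (Rmult_comm (Rpower t0 (2 * c))), Rpower_cancel, Rmult_1_l.
    rewrite Rpower_mult; replace (/ c * - (2 * c)) with (- (INR 2)) by (simpl; field; lra).
    rewrite Rpower_Ropp, Rpower_pow by lra.
    rewrite <- pow_inv, Rinv_inv; reflexivity.
Qed.

(** By expansion of area the trajectories starting in the square would occupy, at a
    late time [T1], far more room than there is. In terms of finitely many of
    them: cover the bounded set by boxes of side [h]. Trajectories in the same box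
    at [T1] started close to each other and in triangles of so small an area that
    the boxes together contain fewer of them than start in a lattice. *)
Theorem trajectories_leave (X0 Y0 delta : R) : r <= 1 -> 0 < delta ->
  ~ (forall a b, Rabs (a - X0) <= delta -> Rabs (b - Y0) <= delta ->
       exists x y, x t0 = a /\ y t0 = b /\ trajectory x y).
Proof.
  intros Hr1 Hdelta Hall.
  (* [theta] is the factor by which areas at [t0] are smaller than at [T1], and
     [1 / B] the ratio of the lattice spacing to the side of the boxes. The count
     yields [B ^ 2 * delta ^ 2 <= 9 * (12 * theta * B ^ 2 + K * B + 1)], which these
     choices contradict; [K] depends on [theta], but not on [B]. *)
  pose (theta := Rmin (1 / 2) (delta ^ 2 / 432)).
  assert (Hd2 : 0 < delta ^ 2) by (apply pow_lt; assumption).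
  assert (Hth : 0 < theta) by (apply Rmin_glb_lt; lra).
  assert (Hth1 : theta <= 1 / 2) by apply Rmin_l.
  assert (Hth2 : theta <= delta ^ 2 / 432) by apply Rmin_r.
  destruct (expansion_time theta) as (T1 & HT1 & HthT); [lra|].
  destruct (trajectories_were_close T1 HT1) as (K & HK & Hclose).
  destruct (small_triangles_expand T1 HT1) as (K2 & HK2 & Htri).
  pose (B := 12 * (K + 1) / delta ^ 2 + 1).
  assert (HB1 : 0 < 12 * (K + 1) / delta ^ 2) by (apply Rdiv_lt_0_compat; lra).
  assert (HB : 1 < B) by (unfold B; lra).
  assert (HBd : delta ^ 2 * B = 12 * (K + 1) + delta ^ 2) by (unfold B; field; lra).
  assert (HK5 : 0 < K2 * K ^ 5) by (apply Rmult_lt_0_compat; [assumption | apply pow_lt; assumption]).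
  assert (Hth4 : 0 < theta ^ 2) by (apply pow_lt; assumption).
  (* for boxes of side below [h0] the error of the area estimate is at most a
     constant multiple of its main term *)
  pose (h0 := Rmin 1 (5 * theta ^ 2 / (K2 * K ^ 5))).
  assert (Hh0 : 0 < h0) by (apply Rmin_glb_lt; [lra | apply Rdiv_lt_0_compat; lra]).
  assert (Hh01 : h0 <= 1) by apply Rmin_l.
  assert (Hh02 : K2 * K ^ 5 * h0 <= 5 * theta ^ 2).
  { replace (5 * theta ^ 2) with (K2 * K ^ 5 * (5 * theta ^ 2 / (K2 * K ^ 5))).
    - apply Rmult_le_compat_l; [lra | apply Rmin_r].
    - field; split; lra. }
  assert (HBd0 : 0 < B * delta) by (apply Rmult_lt_0_compat; lra).
  destruct (INR_unbounded (B * delta / h0)) as [N HN].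
  assert (HN0 : 0 < INR N).
  { assert (0 < B * delta / h0) by (apply Rdiv_lt_0_compat; assumption). lra. }
  pose (eta := delta / INR N).
  assert (Heta : 0 < eta) by (apply Rdiv_lt_0_compat; assumption).
  pose (h := B * eta).
  assert (Hh : 0 < h) by (apply Rmult_lt_0_compat; lra).
  assert (Hhh0 : h <= h0).
  { unfold h, eta. apply (Rmult_le_reg_r (INR N / h0)); [apply Rdiv_lt_0_compat; assumption|].
    replace (B * (delta / INR N) * (INR N / h0)) with (B * delta / h0) by (field; lra).
    replace (h0 * (INR N / h0)) with (INR N) by (field; lra). lra. }
  assert (Hsol : forall p : nat * nat, exists z : (R -> R) * (R -> R),
    (fst p < N)%nat -> (snd p < N)%nat ->
    fst z t0 = X0 + eta * INR (fst p) /\ snd z t0 = Y0 + eta * INR (snd p) /\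
    trajectory (fst z) (snd z)).
  { intros [i j]; cbn [fst snd].
    destruct (classic ((i < N)%nat /\ (j < N)%nat)) as [[Hi Hj] | Hn].
    - assert (Hin : forall (a : R) (k : nat), (k < N)%nat -> Rabs (a + eta * INR k - a) <= delta).
      { intros a k Hk; replace (a + eta * INR k - a) with (eta * INR k) by ring.
        assert (0 <= INR k) by apply pos_INR. assert (INR k <= INR N) by (apply le_INR; lia).
        rewrite Rabs_pos_eq by (apply Rmult_le_pos; lra).
        replace delta with (eta * INR N) by (unfold eta; field; lra).
        apply Rmult_le_compat_l; lra. }
      destruct (Hall _ _ (Hin X0 i Hi) (Hin Y0 j Hj)) as (x & y & E1 & E2 & Hxy).
      exists (x, y); intros _ _; cbn [fst snd]; auto.
    - exists (fun _ => 0, fun _ => 0); intros; exfalso; apply Hn; auto. }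
  pose (z := fun i j => proj1_sig (constructive_indefinite_description _ (Hsol (i, j)))).
  assert (Hz : forall i j, (i < N)%nat -> (j < N)%nat ->
    fst (z i j) t0 = X0 + eta * INR i /\ snd (z i j) t0 = Y0 + eta * INR j /\
    trajectory (fst (z i j)) (snd (z i j))).
  { intros i j; apply (proj2_sig (constructive_indefinite_description _ (Hsol (i, j)))). }
  clearbody z; clear Hsol Hall.
  destruct floor_exists as [fl Hfl].
  pose (cell := fun x => fl ((x + 1) / h)).
  pose (P := S (fl (2 / h))).
  pose (box := fun i j => (cell (fst (z i j) T1) * P + cell (snd (z i j) T1))%nat).
  assert (Hcell0 : forall x, Rabs x <= r -> 0 <= (x + 1) / h <= 2 / h).
  { intros x Hx; apply Rabs_le_between in Hx; split.
    - apply Rdiv_le_0_compat; lra.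
    - apply Rmult_le_compat_r; [left; apply Rinv_0_lt_compat; assumption | lra]. }
  assert (H2h : 0 <= 2 / h) by (apply Rdiv_le_0_compat; lra).
  assert (HcellP : forall x, Rabs x <= r -> (cell x < P)%nat).
  { intros x Hx; destruct (Hcell0 x Hx) as [A1 A2].
    apply Nat.lt_succ_r, (floor_le_of_INR _ (2 / h)).
    - eapply Rle_trans; [apply Hfl, A1 | exact A2].
    - apply Hfl, H2h. }
  assert (Hcell : forall x x', Rabs x <= r -> Rabs x' <= r -> cell x = cell x' -> Rabs (x' - x) <= h).
  { intros x x' Hx Hx' E; destruct (Hcell0 x Hx) as [A1 _]; destruct (Hcell0 x' Hx') as [A2 _].
    apply Hfl in A1, A2; fold (cell x) in A1; fold (cell x') in A2; rewrite E in A1.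
    assert (Q : Rabs ((x' - x) / h) <= 1).
    { replace ((x' - x) / h) with ((x' + 1) / h - (x + 1) / h) by (field; lra).
      apply Rabs_le; lra. }
    replace (x' - x) with ((x' - x) / h * h) by (field; lra).
    rewrite Rabs_mult, (Rabs_pos_eq h) by lra.
    apply Rle_trans with (1 * h); [apply Rmult_le_compat_r|]; lra. }
  assert (Hbound : forall i j, (i < N)%nat -> (j < N)%nat ->
    Rabs (fst (z i j) T1) <= r /\ Rabs (snd (z i j) T1) <= r).
  { intros i j Hi Hj; destruct (Hz i j Hi Hj) as (_ & _ & _ & _ & _ & Hb); apply Hb; lra. }
  assert (Hbox : forall i j i' j', (i < N)%nat -> (j < N)%nat -> (i' < N)%nat -> (j' < N)%nat ->
    box i j = box i' j' ->
    Rabs (fst (z i' j') T1 - fst (z i j) T1) <= h /\ Rabs (snd (z i' j') T1 - snd (z i j) T1) <= h).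
  { intros i j i' j' Hi Hj Hi' Hj' E; unfold box in E.
    destruct (Hbound i j Hi Hj) as [B1 B2]; destruct (Hbound i' j' Hi' Hj') as [B1' B2'].
    assert (C1 := HcellP _ B2); assert (C2 := HcellP _ B2').
    assert (E2 : cell (fst (z i j) T1) = cell (fst (z i' j') T1)) by nia.
    assert (E3 : cell (snd (z i j) T1) = cell (snd (z i' j') T1)) by (rewrite E2 in E; lia).
    split; apply Hcell; assumption. }
  assert (Hpast : forall i j i' j', (i < N)%nat -> (j < N)%nat -> (i' < N)%nat -> (j' < N)%nat ->
    box i j = box i' j' -> forall t, t0 <= t <= T1 ->
    Rabs (fst (z i' j') t - fst (z i j) t) <= K * h /\ Rabs (snd (z i' j') t - snd (z i j) t) <= K * h).
  { intros i j i' j' Hi Hj Hi' Hj' E.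
    destruct (Hbox i j i' j' Hi Hj Hi' Hj' E) as [B1 B2].
    apply Hclose; try assumption; [apply Hz; assumption | apply Hz; assumption | lra]. }
  assert (Hcount : (N * N <= P * P * (4 * fl (3 * theta * B ^ 2)%R + fl (K * B)%R + 1))%nat).
  { apply (lattice_pigeonhole N (P * P) _ _ box).
    - intros i j Hi Hj; destruct (Hbound i j Hi Hj) as [B1 B2].
      assert (C1 := HcellP _ B1); assert (C2 := HcellP _ B2); unfold box; nia.
    - intros i j i' j' Hi Hj Hi' Hj' E.
      destruct (Hpast i j i' j' Hi Hj Hi' Hj' E t0 ltac:(lra)) as [A1 A2].
      destruct (Hz i j Hi Hj) as (X1 & Y1 & _); destruct (Hz i' j' Hi' Hj') as (X2 & Y2 & _).
      rewrite X1, X2 in A1; rewrite Y1, Y2 in A2.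
      assert (Hgen : forall (a : R) (k k' : nat), Rabs (a + eta * INR k' - (a + eta * INR k)) <= K * h ->
        (k <= k' + fl (K * B)%R)%nat).
      { intros a k k' Hk. assert (HKB : 0 <= K * B) by nra.
        apply Rabs_le_between in Hk; unfold h in Hk.
        assert (Hkk : INR k - INR k' <= K * B).
        { apply (Rmult_le_reg_l eta); [assumption|]. nra. }
        destruct (Hfl _ HKB) as [_ F].
        apply Nat.lt_succ_r, INR_lt; rewrite S_INR, plus_INR; lra. }
      split; [apply (Hgen X0) | apply (Hgen Y0)]; assumption.
    - intros i j j' i' l Hi Hj Hj' Hi' Hl E1 E2.
      destruct (Hbox i j i j' Hi Hj Hi Hj' E1) as [A1 A2].
      destruct (Hbox i j i' l Hi Hj Hi' Hl E2) as [A3 A4].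
      assert (HH := Htri (fst (z i j)) (snd (z i j)) (fst (z i j')) (snd (z i j'))
        (fst (z i' l)) (snd (z i' l)) (K * h)).
      destruct (Hz i j Hi Hj) as (X1 & Y1 & Z1); destruct (Hz i j' Hi Hj') as (X2 & Y2 & Z2);
      destruct (Hz i' l Hi' Hl) as (X3 & Y3 & Z3).
      specialize (HH Z1 Z2 Z3 ltac:(nra)).
      assert (Hrho : forall t, t0 <= t <= T1 ->
        Rabs (fst (z i j') t - fst (z i j) t) <= K * h /\ Rabs (snd (z i j') t - snd (z i j) t) <= K * h /\
        Rabs (fst (z i' l) t - fst (z i j) t) <= K * h /\ Rabs (snd (z i' l) t - snd (z i j) t) <= K * h).
      { intros t Ht; destruct (Hpast i j i j' Hi Hj Hi Hj' E1 t Ht).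
        destruct (Hpast i j i' l Hi Hj Hi' Hl E2 t Ht). auto. }
      specialize (HH Hrho). rewrite HthT in HH.
      assert (HaT : area (fst (z i j) T1) (snd (z i j) T1) (fst (z i j') T1) (snd (z i j') T1)
         (fst (z i' l) T1) (snd (z i' l) T1) ^ 2 <= 4 * h ^ 4).
      { unfold area; assert (R1 := Rabs_mult_le _ _ _ _ A1 A4). assert (R2 := Rabs_mult_le _ _ _ _ A3 A2).
        apply Rabs_le_between in R1, R2.
        set (ar := _ - _ * (snd (z i j') T1 - _)).
        assert (Har : - (2 * (h * h)) <= ar <= 2 * (h * h)) by (unfold ar; lra).
        replace (4 * h ^ 4) with (2 * (h * h) * (2 * (h * h))) by ring. nra. }
      assert (Ha0 : area (fst (z i j) t0) (snd (z i j) t0) (fst (z i j') t0) (snd (z i j') t0)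
         (fst (z i' l) t0) (snd (z i' l) t0) ^ 2
         = eta ^ 4 * ((INR i' - INR i) * (INR j' - INR j)) ^ 2).
      { unfold area; rewrite X1, X2, X3, Y1, Y2, Y3; ring. }
      rewrite Ha0 in HH.
      assert (H5 : K2 * (K * h) ^ 5 <= 5 * theta ^ 2 * h ^ 4).
      { replace (K2 * (K * h) ^ 5) with (K2 * K ^ 5 * h * h ^ 4) by ring.
        apply Rmult_le_compat_r; [apply pow_le; lra|].
        eapply Rle_trans; [|exact Hh02]. apply Rmult_le_compat_l; lra. }
      assert (H9 : eta ^ 4 * ((INR i' - INR i) * (INR j' - INR j)) ^ 2
         <= eta ^ 4 * (3 * theta * B ^ 2) ^ 2).
      { replace (eta ^ 4 * (3 * theta * B ^ 2) ^ 2) with (9 * (theta ^ 2 * h ^ 4)) by (unfold h; ring).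
        assert (theta ^ 2 * area (fst (z i j) T1) (snd (z i j) T1) (fst (z i j') T1) (snd (z i j') T1)
         (fst (z i' l) T1) (snd (z i' l) T1) ^ 2 <= theta ^ 2 * (4 * h ^ 4))
          by (apply Rmult_le_compat_l; lra).
        lra. }
      apply Rmult_le_reg_l in H9; [|apply pow_lt; assumption].
      assert (HS : 0 <= 3 * theta * B ^ 2) by (apply Rmult_le_pos; [lra | apply pow2_ge_0]).
      assert (Habs : Rabs ((INR i' - INR i) * (INR j' - INR j)) <= 3 * theta * B ^ 2).
      { set (u := (INR i' - INR i) * (INR j' - INR j)) in *. apply Rabs_le; split; nra. }
      destruct (Hfl _ HS) as [_ F].
      split; apply (floor_le_of_INR _ (3 * theta * B ^ 2)); try assumption.
      + apply INR_sub_mult_le; assumption.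
      + apply INR_sub_mult_le.
        rewrite Rabs_mult, (Rabs_minus_sym (INR i)), <- Rabs_mult; assumption. }
  apply le_INR in Hcount.
  rewrite !mult_INR, !plus_INR, mult_INR in Hcount.
  assert (HS : 0 <= 3 * theta * B ^ 2) by (apply Rmult_le_pos; [lra | apply pow2_ge_0]).
  assert (HKB : 0 <= K * B) by nra.
  destruct (Hfl _ HS) as [FS _]; destruct (Hfl _ HKB) as [FK _]; destruct (Hfl _ H2h) as [FP _].
  assert (HP : INR P <= 3 / h).
  { unfold P; rewrite S_INR. assert (1 <= / h) by (rewrite <- Rinv_1; apply Rinv_le_contravar; lra).
    unfold Rdiv in *; lra. }
  replace (INR 4) with 4 in Hcount by (simpl; ring). replace (INR 1) with 1 in Hcount by reflexivity.
  assert (Hfin : INR N * INR N <= (3 / h) * (3 / h) * (12 * theta * B ^ 2 + K * B + 1)).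
  { eapply Rle_trans; [exact Hcount|].
    assert (P0 : 0 <= INR P) by apply pos_INR.
    assert (S0 : 0 <= INR (fl (3 * theta * B ^ 2))) by apply pos_INR.
    assert (R0 : 0 <= INR (fl (K * B))) by apply pos_INR.
    apply Rmult_le_compat.
    - apply Rmult_le_pos; assumption.
    - lra.
    - apply Rmult_le_compat; assumption.
    - lra. }
  assert (Hkey : B ^ 2 * delta ^ 2 <= 9 * (12 * theta * B ^ 2 + K * B + 1)).
  { apply (Rmult_le_compat_r (h * h)) in Hfin; [|nra].
    replace (3 / h * (3 / h) * (12 * theta * B ^ 2 + K * B + 1) * (h * h))
      with (9 * (12 * theta * B ^ 2 + K * B + 1)) in Hfin by (field; lra).
    replace (INR N * INR N * (h * h)) with (B ^ 2 * delta ^ 2) in Hfin by (unfold h, eta; field; lra).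
    exact Hfin. }
  assert (Hq : 108 * theta * B ^ 2 <= delta ^ 2 / 4 * B ^ 2)
    by (apply Rmult_le_compat_r; [apply pow2_ge_0 | lra]).
  assert (Hbad : B * (delta ^ 2 * B) <= B * (12 * (K + 1))).
  { replace (B * (delta ^ 2 * B)) with (B ^ 2 * delta ^ 2) by ring. nra. }
  apply Rmult_le_reg_l in Hbad; lra.
Qed.

End Expansion.

(** * Stability and instability *)

Lemma asymptotic_series_vanishes p k0 u a : (1 <= k0)%nat ->
  asymptotic_series p k0 u a -> is_lim u p_infty 0.
Proof.
  intros Hk Hu; apply (is_lim_ext (fun t => Rpower t (INR 0 / INR p) *
    (u t - sum_n_m (fun k => Rpower t (- (INR k / INR p)) * a k) k0 0))); [|apply (Hu O)].
  intros t; rewrite sum_n_m_zero by lia.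
  unfold zero; cbn; unfold Rdiv, Rpower; rewrite !Rmult_0_l, exp_0; ring.
Qed.

(** The leading term is of order [t ^ (- n / q)], which is at least [1 / t] because
    [n <= q]. *)
Lemma divergence_bounded_below (q n : nat) (F G : R -> R -> R -> R) (Fk Gk : nat -> R -> R -> R) :
  (1 <= n <= q)%nat -> perturbation q F Fk -> perturbation q G Gk ->
  (forall i x y, (1 <= i < n)%nat -> Fk i x y = 0 /\ Gk i x y = 0) ->
  0 < d1_2 (Fk n) 0 0 + d2_2 (Gk n) 0 0 ->
  exists r c t1, 0 < r /\ 0 < c /\ forall t x y, t1 <= t -> Rabs x <= r -> Rabs y <= r ->
    c / t <= d1_3 F x y t + d2_3 G x y t.
Proof.
  intros Hn (_ & FS & _ & _ & FE & _) (_ & GS & _ & _ & _ & GE) Hz Hpos.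
  set (d := d1_2 (Fk n) 0 0 + d2_2 (Gk n) 0 0) in *.
  pose (U := filter_prod (filter_prod (locally 0) (locally 0)) (Rbar_locally p_infty)).
  assert (Lt : filterlim snd U (Rbar_locally p_infty)) by apply filterlim_snd.
  assert (Lx : filterlim (fun p => fst (fst p)) U (locally 0)).
  { eapply filterlim_comp; [apply filterlim_fst | apply filterlim_fst]. }
  assert (Ly : filterlim (fun p => snd (fst p)) U (locally 0)).
  { eapply filterlim_comp; [apply filterlim_fst | apply filterlim_snd]. }
  assert (LF := expansion_leading q n (d1_3 F) (fun k => d1_2 (Fk k)) snd _ _
    (proj1 Hn) FE
    (low_order_derivative n d1_2 Fk (or_introl eq_refl) (fun i x y Hi => proj1 (Hz i x y Hi)))
    (proj1 (proj1 (proj2 (proj2 (proj2 (FS n (proj1 Hn) 1%nat 0 0)))))) Lt Lx Ly).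
  assert (LG := expansion_leading q n (d2_3 G) (fun k => d2_2 (Gk k)) snd _ _
    (proj1 Hn) GE
    (low_order_derivative n d2_2 Gk (or_intror eq_refl) (fun i x y Hi => proj2 (Hz i x y Hi)))
    (proj1 (proj2 (proj2 (proj2 (proj2 (GS n (proj1 Hn) 1%nat 0 0)))))) Lt Lx Ly).
  assert (LFG := filterlim_Rplus _ _ _ _ LF LG). fold d in LFG.
  assert (Hd2 : 0 < d / 2) by lra.
  destruct (proj1 (filterlim_eps _ _) LFG _ Hd2) as [Q1 Q2 HQ1 [t1 HQ2] HQ].
  destruct HQ1 as [Q3 Q4 [r3 HQ3] [r4 HQ4] HQ1].
  assert (Hr : 0 < Rmin r3 r4) by (apply Rmin_glb_lt; apply cond_pos).
  assert (M1 := Rmin_l r3 r4). assert (M2 := Rmin_r r3 r4).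
  exists (Rmin r3 r4 / 2), (d / 2), (Rmax (t1 + 1) 1).
  split; [lra|]; split; [lra|].
  intros t x y Ht Hx Hy.
  assert (M3 := Rmax_l (t1 + 1) 1). assert (M4 := Rmax_r (t1 + 1) 1).
  assert (Hxy : Q1 (x, y)).
  { apply HQ1; [apply HQ3 | apply HQ4]; apply ball_Rabs; rewrite Rminus_0_r; lra. }
  specialize (HQ (x, y) t Hxy (HQ2 t ltac:(lra))); cbn [fst snd] in HQ.
  apply Rabs_def2 in HQ; rewrite <- Rmult_plus_distr_l in HQ.
  set (s := d1_3 F x y t + d2_3 G x y t) in *.
  set (b := INR n / INR q) in *.
  assert (Hb : b <= 1).
  { assert (0 < INR q) by (apply lt_0_INR; lia). assert (INR n <= INR q) by (apply le_INR; lia).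
    unfold b; apply (Rmult_le_reg_r (INR q)); [assumption|].
    unfold Rdiv; rewrite Rmult_assoc, Rinv_l; lra. }
  assert (Hbt : Rpower t b <= t).
  { rewrite <- (Rpower_1 t) at 2 by lra; apply Rle_Rpower; lra. }
  assert (Hbp := Rpower_pos t b).
  assert (Hs : 0 <= s) by nra.
  apply (Rmult_le_reg_r t); [lra|].
  replace (d / 2 / t * t) with (d / 2) by (field; lra). nra.
Qed.

(** Lyapunov stability would keep all solutions that start near the given one in a
    bounded set, on which the divergence is at least [c / t]; no such set
    exists. *)
Lemma unstable_of_expansion (q n k1 k2 : nat) (H F G : R -> R -> R -> R) (w : R -> R)
    (V phi phi1 phi2 psi : R -> R) (Fk Gk : nat -> R -> R -> R)
    (T : R) (xs ys : R -> R) (xk yk : nat -> R) :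
  limiting_force H w V phi phi1 phi2 psi ->
  (1 <= n <= q)%nat -> (1 <= k1)%nat -> (1 <= k2)%nat ->
  perturbation q F Fk -> perturbation q G Gk ->
  (forall i x y, (1 <= i < n)%nat -> Fk i x y = 0 /\ Gk i x y = 0) ->
  0 < d1_2 (Fk n) 0 0 + d2_2 (Gk n) 0 0 ->
  asymptotic_series (2 * q) k1 xs xk -> asymptotic_series (2 * q) k2 ys yk ->
  lyapunov_unstable H F G 0 T xs ys.
Proof.
  intros Hlf Hn Hk1 Hk2 HF HG Hz Hpos Hx Hy Hstable.
  destruct (divergence_bounded_below q n F G Fk Gk Hn HF HG Hz Hpos)
    as (r' & c & t1 & Hr' & Hc & Hdiv).
  pose (r := Rmin r' 1).
  assert (Hr : 0 < r) by (apply Rmin_glb_lt; lra).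
  assert (Hrr : r <= r') by apply Rmin_l. assert (Hr1 : r <= 1) by apply Rmin_r.
  assert (Hr2 : 0 < r / 2) by lra.
  apply (asymptotic_series_vanishes _ _ _ _ Hk1) in Hx.
  apply (asymptotic_series_vanishes _ _ _ _ Hk2) in Hy.
  destruct (proj1 (filterlim_eps (U := Rbar_locally p_infty) xs 0) Hx _ Hr2) as [t2 Ht2].
  destruct (proj1 (filterlim_eps (U := Rbar_locally p_infty) ys 0) Hy _ Hr2) as [t3 Ht3].
  pose (t0 := Rmax (Rmax T 1) (Rmax t1 (Rmax t2 t3)) + 1).
  assert (Ht0 : T < t0 /\ 1 <= t0 /\ t1 <= t0 /\ t2 < t0 /\ t3 < t0).
  { unfold t0, Rmax; repeat destruct Rle_dec; lra. }
  destruct (Hstable t0 (r / 2) ltac:(lra) Hr2) as (delta & Hdelta & Hst).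
  set (f := fun x y t => d2_3 H x y 0 + F x y t).
  set (g := fun x y t => - d1_3 H x y 0 + G x y t).
  apply (trajectories_leave f g (d1_3 F) (fun x y t => 1 + d2_3 F x y t)
    (fun x y t => - phi1 x + d1_3 G x y t) (d2_3 G) t0 r c) with (X0 := xs t0) (Y0 := ys t0) (delta := delta / 3);
  try lra.
  - apply (velocity_taylor_box Hlf), smooth_taylor_box, HF.
  - apply (force_taylor_box Hlf), smooth_taylor_box, HG.
  - intros t x y Ht Bx By; apply Hdiv; lra.
  - intros a b Ha Hb.
    destruct (Hst a b) as [(x & y & Hxy) Hclose].
    { eapply Rlt_le_trans; [apply (dist2_of_small _ _ _ _ (delta / 2)); lra | lra]. }
    specialize (Hclose x y Hxy).
    destruct Hxy as (Ex & Ey & Lx & Ly & Hsol).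
    exists x, y; split; [assumption|]; split; [assumption|].
    split; [rewrite Ex; assumption|]; split; [rewrite Ey; assumption|].
    split; [exact Hsol|].
    intros t Ht; destruct (dist2_small _ _ _ _ _ (Hclose t Ht)) as [B1 B2].
    specialize (Ht2 t ltac:(lra)); specialize (Ht3 t ltac:(lra)).
    rewrite Rminus_0_r in Ht2, Ht3.
    apply Rabs_def2 in B1, B2, Ht2, Ht3; split; apply Rabs_le; lra.
Qed.

Theorem theorem9 :
  forall (q : nat) (H F G : R -> R -> R -> R) (w : R -> R)
         (Fk Gk : nat -> R -> R -> R),
  (0 < q)%nat ->
  limiting_hamiltonian H w ->
  perturbation q F Fk ->
  perturbation q G Gk ->
  forall n m : nat,
  (1 <= n <= q)%nat -> (0 <= m < n)%nat ->
  (forall i : nat, (1 <= i < n)%nat ->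
     forall x y : R, Fk i x y = 0 /\ Gk i x y = 0) ->
  Gk (n + m)%nat 0 0 <> 0 ->
  (forall l : nat, (0 <= l < m)%nat -> Gk (n + l)%nat 0 0 = 0) ->
  0 < Gk (n + m)%nat 0 0 ->
  forall (T : R) (xs ys : R -> R) (xk yk : nat -> R),
  0 <= T ->
  solution_after H F G 0 T xs ys ->
  asymptotic_series (2 * q) (n + m) xs xk ->
  asymptotic_series (2 * q) (2 * n) ys yk ->
  xk (n + m)%nat = sqrt (Gk (n + m)%nat 0 0 / w 0) ->
  (alpha q n m Fk Gk < 0 ->
     lyapunov_stable H F G 0 T xs ys) /\
  (kronecker n q * (3 * (INR q + INR m) / (2 * INR q)) < alpha q n m Fk Gk ->
     lyapunov_unstable H F G 0 T xs ys).
Proof.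
  intros q H F G w Fk Gk Hq HH HF HG n m Hn Hm Hlow _ _ Hpos T xs ys xk yk HT Hsol Hx Hy Hmu.
  destruct (limiting_force_exists H w HH) as (V & phi & phi1 & phi2 & psi & Hlf).
  split; intros Halpha.
  - apply (stable_of_attracting_tube H F G 0 T xs ys
      (d1_3 F) (fun x y t => 1 + d2_3 F x y t)
      (fun x y t => - phi1 x + d1_3 G x y t) (d2_3 G)); try assumption.
    + apply (velocity_taylor_box Hlf), smooth_taylor_box, HF.
    + apply (force_taylor_box Hlf), smooth_taylor_box, HG.
    + apply (velocity_continuous_along_curves Hlf), smooth_continuous_along_curves, HF.
    + apply (force_continuous_along_curves Hlf), smooth_continuous_along_curves, HG.
    + apply (solution_attracting H F G w V phi phi1 phi2 psi Fk Gk q n m T xs ys xk yk);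
      try assumption; [lia|].
      rewrite Hmu; apply sqrt_lt_R0, Rdiv_lt_0_compat; [assumption | apply (lf_w Hlf)].
  - apply (unstable_of_expansion q n (n + m) (2 * n) H F G w V phi phi1 phi2 psi Fk Gk T xs ys xk yk);
    try assumption; try lia.
    + intros i x y Hi; apply (Hlow i Hi).
    + unfold alpha, kronecker in Halpha; destruct (Nat.eqb n q); [|lra].
      assert (Q0 : 0 < INR q) by (apply lt_0_INR; assumption).
      assert (M0 := pos_INR m).
      assert (E0 : 3 * (INR q + INR m) / (2 * INR q) - 5 * (INR q + INR m) / (4 * INR q)
        = (INR q + INR m) / (4 * INR q)) by (field; lra).
      assert (0 < (INR q + INR m) / (4 * INR q)) by (apply Rdiv_lt_0_compat; lra).
      lra.
Qed.
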